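(* Let $q\ge1$, let $\chi$ be an even primitive Dirichlet character modulo $q$, let $x>0$ and let $N$ be an odd positive integer. Then $$\sum_{r=1}^{q}\sum_{n=1}^{\infty}\frac{\chi(r)}{n}\frac{\exp\left(-\frac{r}{q}n^Nx\right)}{1-\exp(-n^Nx)}=\mathcal{R}_0+\mathcal{R}_1+\mathcal{R}(N)+\mathcal{K}_{\chi,N}(x),$$ where $$\mathcal{R}_0=\begin{cases}\frac{1}{2N}\left(\gamma(1-N)-\log(2\pi)+\log x\right),& q=1,\\ -\frac{1}{2N}\sum_{r=1}^{q-1}\chi(r)\log\left(\sin\left(\frac{r\pi}{q}\right)\right),& q>1,\end{cases}\qquad \mathcal{R}_1=\begin{cases}\frac{\zeta(N+1)}{x},& q=1,\\0,& q>1,\end{cases}$$ $$\mathcal{R}(N)=\begin{cases}\frac{x}{2q}L(-1,\chi),& N=1,\\0,& N>1,\end{cases}$$ and $$\mathcal{K}_{\chi,N}(x)=(-1)^{\frac{N+3}{2}}\frac{\mathcal{G}(\chi)}{N}\sum_{n=1}^{\infty}\frac{\bar\chi(n)}{n}\sum_{j\in\{-(N-1),-(N-3),\dots,N-1\}}\frac{\exp\left(\frac{i\pi j}{2}\right)}{\exp\left(2\pi\left(\frac{2\pi n}{x}\right)^{1/N}\exp\left(-\frac{i\pi j}{2N}\right)\right)-1}.$$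
   Context: $\gamma$ is Euler's constant, $\zeta(s)$ the Riemann zeta function, $L(s,\chi)$ the Dirichlet $L$-function (for $q=1$, $\chi$ is trivial and $L(s,\chi)=\zeta(s)$), $\bar\chi$ the conjugate character, and $\mathcal{G}(\chi)=\sum_{r=1}^{q}\chi(r)e^{2\pi i r/q}$ the Gauss sum. A character is even if $\chi(-1)=1$. *)

(* Defs.v *)
From Stdlib Require Import Reals ZArith Znumtheory.
From Coquelicot Require Import Coquelicot.
Open Scope R_scope.

Notation CC := Complex.C.

Definition Cexp (z : CC) : CC :=
  (exp (fst z) * cos (snd z), exp (fst z) * sin (snd z)).

Definition CSeries (a : nat -> CC) : CC :=
  (Series (fun n => fst (a n)), Series (fun n => snd (a n))).

Definition euler_gamma : R :=
  real (Lim_seq (fun n => sum_n_m (fun k => / INR k) 1 n - ln (INR n))).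

Definition zeta_real (s : R) : R :=
  Series (fun n => / Rpower (INR (n + 1)) s).

Definition dirichlet_character (q : Z) (chi : Z -> CC) : Prop :=
  (1 <= q)%Z /\
  (forall n : Z, chi (n + q)%Z = chi n) /\
  (forall m n : Z, chi (m * n)%Z = (chi m * chi n)%C) /\
  chi 1%Z = 1%C /\
  (forall n : Z, chi n <> 0%C <-> Z.gcd n q = 1%Z).

Definition induced_modulus (q : Z) (chi : Z -> CC) (d : Z) : Prop :=
  forall a : Z, Z.gcd a q = 1%Z -> (a mod d = 1 mod d)%Z -> chi a = 1%C.

Definition primitive_character (q : Z) (chi : Z -> CC) : Prop :=
  dirichlet_character q chi /\
  forall d : Z, (0 < d)%Z -> (d | q)%Z -> induced_modulus q chi d -> d = q.

Definition even_character (chi : Z -> CC) : Prop := chi (-1)%Z = 1%C.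

Definition gauss_sum (q : nat) (chi : Z -> CC) : CC :=
  sum_n_m (fun r => (chi (Z.of_nat r) * Cexp (0%R, (2 * PI * INR r / INR q)%R))%C) 1 q.

Definition C_differentiable_at (F : CC -> CC) (s : CC) : Prop :=
  exists l : CC, forall eps : R, 0 < eps -> exists delta : R, 0 < delta /\
    forall h : CC, 0 < Cmod h < delta ->
      Cmod (((F (s + h) - F s) / h) - l)%C < eps.

(* F is the analytic continuation of L(s,chi) to C \ {1}:
   holomorphic on C \ {1} and equal to the Dirichlet series
   sum_{n>=1} chi(n) n^{-s} for Re s > 1 (unique by the identity theorem). *)
Definition L_continuation (chi : Z -> CC) (F : CC -> CC) : Prop :=
  (forall s : CC, s <> 1%C -> C_differentiable_at F s) /\
  (forall s : CC, 1 < fst s ->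
     F s = CSeries (fun n => (chi (Z.of_nat (n + 1)) *
                              Cexp (- s * RtoC (ln (INR (n + 1)))))%C)).

(* Main.v *)
Require Import Defs.
From Stdlib Require Import Reals ZArith Znumtheory Lra Lia Psatz Classical.
From Coquelicot Require Import Coquelicot.
Open Scope R_scope.

(** With y = n^N x, the partial fraction expansion of the finite sum over r turns the left-hand
    side into the double series of G(chi) conj(chi(k)) (1/n) 2 y / (y^2 + 4 pi^2 k^2).  Summing
    first over n instead, and decomposing n^(N-1) / (n^(2N) + (2 pi k / x)^2) along the N-th roots
    of unity, gives 1/(e^z - 1) - 1/z + 1/2 at the N points z of the inner sum over j.  The terms
    1/2 and 1/z contribute L(1, conj chi) (a log-sine sum) and, when N = 1, L(2, conj chi), which
    is proportional to L(-1, chi).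

    The double series is not absolutely convergent.  For q > 1 the partial sums over k are dominated
    by summation by parts, since chi has mean value zero.  For q = 1 one first subtracts the integral
    over k; the resulting sum of (1/n) arctan(B / n^N) produces log B / N and Euler's constant.

    L(-1, chi) is only known through some holomorphic continuation L.  Subtracting from L a partial
    sum and its Euler-Maclaurin tail leaves a function which is bounded on a circle about
    -1 + i delta and tends to 0 on an arc of it in Re s > 1.  The product of its rotates about the
    centre is then small on the whole circle, so the mean value property (from Goursat's theorem)
    forces it to tend to 0 at the centre. *)

(** * Finite sums *)

(** The cosine expansion behind the left-hand side holds only for the average of the terms at t and
    1 - t; evenness of chi, pairing r with q - r, makes this average as good as the one-sided term.
    The expansion is proved without residues: a finite Fourier identity for the Poisson kernel at
    e^(-z/n) tends to the partial fraction series by dominated convergence. It is stated for complex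
    z with Re z > 0, so that it serves both on the real side and at the points of the sum over j.

    The centre -1 + i delta in the argument for L(-1, chi) is forced by the possible pole at 1: a
    disc about -1 reaching Re s > 1 contains 1, whereas one about -1 + i delta of squared radius 4 +
    delta^2/2 reaches Re s > 1 and leaves 1 outside. The price is an error at the centre, of order
    delta because the Euler-Maclaurin remainder carries the factor s + 1. Summation to order six
    keeps the remainder summable for Re s >= -4, which covers these discs. *)

Fixpoint Rsum (f : nat -> R) (n : nat) : R :=
  match n with O => 0 | S m => Rsum f m + f m end.

Fixpoint Csum (f : nat -> CC) (n : nat) : CC :=
  match n with O => 0%C | S m => (Csum f m + f m)%C end.

Lemma fst_Csum f n : fst (Csum f n) = Rsum (fun k => fst (f k)) n.
Proof. induction n as [|n IH]; simpl; [easy|now rewrite IH]. Qed.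

Lemma snd_Csum f n : snd (Csum f n) = Rsum (fun k => snd (f k)) n.
Proof. induction n as [|n IH]; simpl; [easy|now rewrite IH]. Qed.

Lemma Rsum_ext f g n : (forall k, (k < n)%nat -> f k = g k) -> Rsum f n = Rsum g n.
Proof.
  induction n as [|n IH]; intros H; simpl; [easy|].
  rewrite IH by (intros; apply H; lia). now rewrite H by lia.
Qed.

Lemma Csum_ext f g n : (forall k, (k < n)%nat -> f k = g k) -> Csum f n = Csum g n.
Proof.
  induction n as [|n IH]; intros H; simpl; [easy|].
  rewrite IH by (intros; apply H; lia). now rewrite H by lia.
Qed.

Lemma Rsum_plus f g n : Rsum (fun k => f k + g k) n = Rsum f n + Rsum g n.
Proof. induction n as [|n IH]; simpl; [lra|rewrite IH; ring]. Qed.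

Lemma Rsum_scal c f n : Rsum (fun k => c * f k) n = c * Rsum f n.
Proof. induction n as [|n IH]; simpl; [lra|rewrite IH; ring]. Qed.

Lemma Csum_plus f g n : Csum (fun k => f k + g k)%C n = (Csum f n + Csum g n)%C.
Proof. induction n as [|n IH]; simpl; [ring|rewrite IH; ring]. Qed.

Lemma Csum_scal c f n : Csum (fun k => c * f k)%C n = (c * Csum f n)%C.
Proof. induction n as [|n IH]; simpl; [ring|rewrite IH; ring]. Qed.

Lemma Csum_RtoC f n : Csum (fun k => RtoC (f k)) n = RtoC (Rsum f n).
Proof. induction n as [|n IH]; simpl; [easy|rewrite IH, RtoC_plus; easy]. Qed.

Lemma Csum_0 n : Csum (fun _ => 0%C) n = 0%C.
Proof. induction n as [|n IH]; simpl; [easy|rewrite IH; ring]. Qed.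

Lemma Csum_swap f n m :
  Csum (fun i => Csum (fun j => f i j) m) n = Csum (fun j => Csum (fun i => f i j) n) m.
Proof.
  induction n as [|n IH]; simpl.
  - now rewrite Csum_0.
  - now rewrite IH, Csum_plus.
Qed.

Lemma Csum_app f n m : Csum f (n + m) = (Csum f n + Csum (fun k => f (n + k)%nat) m)%C.
Proof.
  induction m as [|m IH]; [rewrite Nat.add_0_r; simpl; ring|].
  rewrite Nat.add_succ_r; simpl. rewrite IH; ring.
Qed.

Lemma Rsum_app f n m : Rsum f (n + m) = Rsum f n + Rsum (fun k => f (n + k)%nat) m.
Proof.
  induction m as [|m IH]; [rewrite Nat.add_0_r; simpl; ring|].
  rewrite Nat.add_succ_r; simpl. rewrite IH; ring.
Qed.

Lemma Csum_shift f n : Csum f (S n) = (f O + Csum (fun k => f (S k)) n)%C.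
Proof. replace (S n) with (1 + n)%nat by lia. rewrite Csum_app; simpl; ring. Qed.

Lemma Rsum_shift f n : Rsum f (S n) = f O + Rsum (fun k => f (S k)) n.
Proof. replace (S n) with (1 + n)%nat by lia. rewrite Rsum_app; simpl; ring. Qed.

Lemma Csum_rev f n : Csum f n = Csum (fun k => f (n - 1 - k)%nat) n.
Proof.
  induction n as [|n IH]; [easy|].
  rewrite (Csum_shift (fun k => f (S n - 1 - k)%nat)). simpl Csum at 1. rewrite IH.
  replace (S n - 1 - 0)%nat with n by lia.
  rewrite Cplus_comm; f_equal. apply Csum_ext; intros k Hk. f_equal; lia.
Qed.

Lemma Rsum_le f g n : (forall k, (k < n)%nat -> f k <= g k) -> Rsum f n <= Rsum g n.
Proof.
  induction n as [|n IH]; intros H; simpl; [lra|].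
  apply Rplus_le_compat; [apply IH; intros; apply H; lia|apply H; lia].
Qed.

Lemma Rsum_nonneg f n : (forall k, 0 <= f k) -> 0 <= Rsum f n.
Proof. intros H; induction n as [|n IH]; simpl; [lra|specialize (H n); lra]. Qed.

Lemma Cmod_Csum f n : Cmod (Csum f n) <= Rsum (fun k => Cmod (f k)) n.
Proof.
  induction n as [|n IH]; simpl; [rewrite Cmod_0; lra|].
  eapply Rle_trans; [apply Cmod_triangle|lra].
Qed.

Lemma Rabs_Rsum f n : Rabs (Rsum f n) <= Rsum (fun k => Rabs (f k)) n.
Proof.
  induction n as [|n IH]; simpl; [rewrite Rabs_R0; lra|].
  eapply Rle_trans; [apply Rabs_triang|lra].
Qed.

Lemma Rsum_telescope f n : Rsum (fun k => f k - f (S k)) n = f O - f n.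
Proof. induction n as [|n IH]; simpl; [ring|rewrite IH; ring]. Qed.

Lemma sum_n_Rsum (f : nat -> R) n : sum_n f n = Rsum f (S n).
Proof.
  induction n as [|n IH]; [rewrite sum_O; simpl; ring|].
  rewrite sum_Sn, IH. reflexivity.
Qed.

Lemma sum_n_m_Csum (f : nat -> CC) a n : sum_n_m f a (a + n) = Csum (fun k => f (a + k)%nat) (S n).
Proof.
  induction n as [|n IH].
  - rewrite Nat.add_0_r, sum_n_n. simpl. rewrite Nat.add_0_r. ring.
  - rewrite Nat.add_succ_r, sum_n_Sm by lia. rewrite IH.
    change (Csum (fun k => f (a + k)%nat) (S (S n))) with
      (Csum (fun k => f (a + k)%nat) (S n) + f (a + S n)%nat)%C.
    now rewrite Nat.add_succ_r.
Qed.

Lemma sum_n_m_1_Csum (f : nat -> CC) n : sum_n_m f 1 n = Csum (fun k => f (S k)) n.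
Proof.
  destruct n as [|n]; [now rewrite sum_n_m_zero by lia|].
  exact (sum_n_m_Csum f 1 n).
Qed.

Lemma is_series_Rsum a l : is_series a l <-> is_lim_seq (Rsum a) l.
Proof.
  rewrite is_lim_seq_incr_1. split; intros H.
  - apply (is_lim_seq_ext (sum_n a)); [apply sum_n_Rsum|exact H].
  - apply (is_lim_seq_ext _ (sum_n a)) in H; [exact H|intros n; now rewrite sum_n_Rsum].
Qed.

Lemma Series_Rsum a l : is_lim_seq (Rsum a) (Finite l) -> Series a = l.
Proof. intros H; apply is_series_unique, is_series_Rsum, H. Qed.

Lemma Rsum_le_Series b n : (forall k, 0 <= b k) -> ex_series b -> Rsum b n <= Series b.
Proof.
  intros Hb Hs. apply Series_correct, is_series_Rsum in Hs.
  apply (is_lim_seq_incr_compare (Rsum b) (Series b) Hs).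
  intros k; simpl; specialize (Hb k); lra.
Qed.

(** * Complex limits *)

Definition is_Clim (u : nat -> CC) (l : CC) : Prop :=
  is_lim_seq (fun n => fst (u n)) (fst l) /\ is_lim_seq (fun n => snd (u n)) (snd l).

Lemma is_Clim_ext u v l : (forall n, u n = v n) -> is_Clim u l -> is_Clim v l.
Proof.
  intros E [H1 H2]; split; [eapply is_lim_seq_ext; [|exact H1]|eapply is_lim_seq_ext; [|exact H2]];
    intros n; simpl; now rewrite E.
Qed.

Lemma is_Clim_ext_loc u v l :
  eventually (fun n => u n = v n) -> is_Clim u l -> is_Clim v l.
Proof.
  intros [n0 E] [H1 H2]; split; [eapply is_lim_seq_ext_loc; [|exact H1]|eapply is_lim_seq_ext_loc; [|exact H2]];
    exists n0; intros n Hn; simpl; now rewrite E.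
Qed.

Lemma is_Clim_eq u (a b : CC) : is_Clim u a -> a = b -> is_Clim u b.
Proof. now intros H <-. Qed.

Lemma is_Clim_const c : is_Clim (fun _ => c) c.
Proof. split; apply is_lim_seq_const. Qed.

Lemma is_Clim_plus u v a b : is_Clim u a -> is_Clim v b -> is_Clim (fun n => u n + v n)%C (a + b)%C.
Proof. intros [? ?] [? ?]; split; apply is_lim_seq_plus'; assumption. Qed.

Lemma is_Clim_opp u a : is_Clim u a -> is_Clim (fun n => - u n)%C (- a)%C.
Proof. intros [H1 H2]; split; [apply is_lim_seq_opp in H1|apply is_lim_seq_opp in H2]; assumption. Qed.

Lemma is_Clim_minus u v a b : is_Clim u a -> is_Clim v b -> is_Clim (fun n => u n - v n)%C (a - b)%C.
Proof. intros H1 H2; apply is_Clim_plus; [|apply is_Clim_opp]; assumption. Qed.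

Lemma is_Clim_mult u v a b : is_Clim u a -> is_Clim v b -> is_Clim (fun n => u n * v n)%C (a * b)%C.
Proof.
  intros [? ?] [? ?]; split; simpl.
  - apply is_lim_seq_minus'; apply is_lim_seq_mult'; assumption.
  - apply is_lim_seq_plus'; apply is_lim_seq_mult'; assumption.
Qed.

Lemma is_Clim_inv u (a : CC) : a <> 0%C -> is_Clim u a -> is_Clim (fun n => / u n)%C (/ a)%C.
Proof.
  intros Ha [H1 H2].
  assert (Hd : fst a * (fst a * 1) + snd a * (snd a * 1) <> 0).
  { intros E. apply Ha. destruct a as [p r]; simpl in *. apply injective_projections; simpl; nra. }
  assert (L : is_lim_seq (fun n => fst (u n) * (fst (u n) * 1) + snd (u n) * (snd (u n) * 1))
                (fst a * (fst a * 1) + snd a * (snd a * 1))).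
  { apply is_lim_seq_plus'; repeat apply is_lim_seq_mult'; auto; apply is_lim_seq_const. }
  split; simpl.
  - apply is_lim_seq_div'; auto.
  - apply is_lim_seq_div'; auto. apply is_lim_seq_opp in H2; exact H2.
Qed.

Lemma is_Clim_div u v (a b : CC) :
  b <> 0%C -> is_Clim u a -> is_Clim v b -> is_Clim (fun n => u n / v n)%C (a / b)%C.
Proof. intros; apply is_Clim_mult; [|apply is_Clim_inv]; assumption. Qed.

Lemma is_Clim_RtoC (u : nat -> R) (l : R) : is_lim_seq u l -> is_Clim (fun n => RtoC (u n)) l.
Proof. intros H; split; simpl; [exact H|apply is_lim_seq_const]. Qed.

Lemma is_Clim_unique u a b : is_Clim u a -> is_Clim u b -> a = b.
Proof.
  intros [H1 H2] [H3 H4].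
  apply is_lim_seq_unique in H1, H2, H3, H4.
  apply injective_projections; congruence.
Qed.

Lemma is_Clim_subseq u l phi :
  filterlim phi eventually eventually -> is_Clim u l -> is_Clim (fun n => u (phi n)) l.
Proof.
  intros Hp [H1 H2]; split.
  - exact (is_lim_seq_subseq _ _ phi Hp H1).
  - exact (is_lim_seq_subseq _ _ phi Hp H2).
Qed.

Lemma is_Clim_Csum (u : nat -> nat -> CC) (l : nat -> CC) K :
  (forall k, (k < K)%nat -> is_Clim (fun n => u n k) (l k)) ->
  is_Clim (fun n => Csum (u n) K) (Csum l K).
Proof.
  induction K as [|K IH]; intros H; simpl; [apply is_Clim_const|].
  apply is_Clim_plus; [apply IH; intros; apply H; lia|apply H; lia].
Qed.

Lemma Rabs_fst_le (z : CC) : Rabs (fst z) <= Cmod z.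
Proof. eapply Rle_trans; [apply Rmax_l|apply Rmax_Cmod]. Qed.

Lemma Rabs_snd_le (z : CC) : Rabs (snd z) <= Cmod z.
Proof. eapply Rle_trans; [apply Rmax_r|apply Rmax_Cmod]. Qed.

Lemma Cmod_le_sum (z : CC) : Cmod z <= Rabs (fst z) + Rabs (snd z).
Proof.
  destruct z as [a b].
  replace ((a, b) : CC) with (RtoC a + Ci * RtoC b)%C
    by (apply injective_projections; simpl; ring).
  eapply Rle_trans; [apply Cmod_triangle|].
  rewrite Cmod_mult, Cmod_Ci, !Cmod_R; simpl.
  replace (a + (0 * b - 1 * 0)) with a by ring.
  replace (0 + (0 * 0 + 1 * b)) with b by ring. lra.
Qed.

Lemma is_lim_seq_squeeze_0 (u v : nat -> R) :
  (forall n, Rabs (u n) <= v n) -> is_lim_seq v 0 -> is_lim_seq u 0.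
Proof.
  intros H Hv. apply (is_lim_seq_le_le (fun n => - v n) u v).
  - intros n; specialize (H n); apply Rabs_le_between in H; exact H.
  - replace (Finite 0) with (Rbar_opp 0) by (simpl; f_equal; ring).
    now apply -> is_lim_seq_opp.
  - exact Hv.
Qed.

Lemma is_Clim_squeeze u l (v : nat -> R) :
  (forall n, Cmod (u n - l)%C <= v n) -> is_lim_seq v 0 -> is_Clim u l.
Proof.
  intros H Hv.
  assert (G : forall (f : CC -> R), (forall z, Rabs (f z) <= Cmod z) ->
     is_lim_seq (fun n => f (u n - l)%C) 0).
  { intros f Hf. apply is_lim_seq_squeeze_0 with v; [|exact Hv].
    intros n; eapply Rle_trans; [apply Hf|apply H]. }
  split.
  - apply (is_lim_seq_ext (fun n => fst (u n - l)%C + fst l)); [intros n; simpl; ring|].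
    replace (Finite (fst l)) with (Finite (0 + fst l)) by (f_equal; ring).
    apply is_lim_seq_plus'; [apply (G fst), Rabs_fst_le|apply is_lim_seq_const].
  - apply (is_lim_seq_ext (fun n => snd (u n - l)%C + snd l)); [intros n; simpl; ring|].
    replace (Finite (snd l)) with (Finite (0 + snd l)) by (f_equal; ring).
    apply is_lim_seq_plus'; [apply (G snd), Rabs_snd_le|apply is_lim_seq_const].
Qed.

Lemma is_Clim_Cmod u l : is_Clim u l -> is_lim_seq (fun n => Cmod (u n - l)%C) 0.
Proof.
  intros [H1 H2].
  assert (G : forall (v : nat -> R) (a : R), is_lim_seq v a -> is_lim_seq (fun n => Rabs (v n - a)) 0).
  { intros v a Hv. replace (Finite 0) with (Rbar_abs (a - a)) by (simpl; f_equal; rewrite Rminus_diag; apply Rabs_R0).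
    apply is_lim_seq_abs. apply is_lim_seq_minus'; [exact Hv|apply is_lim_seq_const]. }
  apply is_lim_seq_squeeze_0 with (fun n => Rabs (fst (u n) - fst l) + Rabs (snd (u n) - snd l)).
  - intros n. rewrite Rabs_pos_eq by apply Cmod_ge_0. apply Cmod_le_sum.
  - replace (Finite 0) with (Finite (0 + 0)) by (f_equal; ring).
    apply is_lim_seq_plus'; apply G; assumption.
Qed.

Lemma is_Clim_bound u l M :
  is_Clim u l -> eventually (fun n => Cmod (u n) <= M) -> Cmod l <= M.
Proof.
  intros H [n0 Hb]. apply is_Clim_Cmod in H.
  apply le_epsilon; intros eps Heps.
  apply is_lim_seq_spec in H. destruct (H (mkposreal eps Heps)) as [n1 H1].
  specialize (H1 (n0 + n1)%nat ltac:(lia)). specialize (Hb (n0 + n1)%nat ltac:(lia)).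
  simpl in H1. rewrite Rminus_0_r, Rabs_pos_eq in H1 by apply Cmod_ge_0.
  replace l with (u (n0 + n1)%nat + - (u (n0 + n1)%nat - l))%C by ring.
  eapply Rle_trans; [apply Cmod_triangle|]. rewrite Cmod_opp. lra.
Qed.

Lemma CSeries_Clim a l : is_Clim (Csum a) l -> CSeries a = l.
Proof.
  intros [H1 H2]. unfold CSeries.
  rewrite (Series_Rsum _ (fst l)), (Series_Rsum _ (snd l)).
  - now destruct l.
  - eapply is_lim_seq_ext; [|exact H2]; intros n; apply snd_Csum.
  - eapply is_lim_seq_ext; [|exact H1]; intros n; apply fst_Csum.
Qed.

(** * Dominated convergence for series *)

(** Interchange of limits in a weak form: [T] only has to be followed by the [K]-th partial sums up
    to [r K], for n beyond a bound depending on [K]. This makes [T] Cauchy, and its limit is then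
    the sum of the termwise limits, whose convergence is part of the conclusion. [k0] allows an
    estimate valid only for late terms. *)
Lemma tannery (a : nat -> nat -> R) (T l r : nat -> R) (k0 : nat) :
  (forall K, (k0 <= K)%nat -> eventually (fun n => Rabs (T n - Rsum (a n) K) <= r K)) ->
  is_lim_seq r 0 ->
  (forall k, is_lim_seq (fun n => a n k) (l k)) ->
  exists S : R, is_lim_seq (Rsum l) S /\ is_lim_seq T S.
Proof.
  intros HT Hr Ha.
  assert (HS : forall K, is_lim_seq (fun n => Rsum (a n) K) (Rsum l K)).
  { induction K as [|K IH]; simpl; [apply is_lim_seq_const|].
    apply is_lim_seq_plus'; [exact IH|apply Ha]. }
  assert (HK : forall eps : posreal, exists K, (k0 <= K)%nat /\ forall K', (K <= K')%nat -> Rabs (r K') < eps).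
  { intros eps. apply is_lim_seq_spec in Hr. destruct (Hr eps) as [K1 H1].
    exists (k0 + K1)%nat; split; [lia|]. intros K' HK'.
    specialize (H1 K' ltac:(lia)). now rewrite Rminus_0_r in H1. }
  assert (Hc : ex_finite_lim_seq T).
  { apply ex_lim_seq_cauchy_corr. intros eps.
    destruct (HK (pos_div_2 (pos_div_2 eps))) as (K & Hk0 & HK').
    specialize (HK' K ltac:(lia)). apply Rabs_def2 in HK'.
    destruct (HT K Hk0) as [n1 H1].
    pose proof (HS K) as HSK. apply is_lim_seq_spec in HSK.
    destruct (HSK (pos_div_2 (pos_div_2 eps))) as [n2 H2]. simpl in *.
    exists (n1 + n2)%nat. intros n m Hn Hm.
    pose proof (H1 n ltac:(lia)) as A1. pose proof (H1 m ltac:(lia)) as A2.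
    pose proof (H2 n ltac:(lia)) as A3. pose proof (H2 m ltac:(lia)) as A4.
    apply Rabs_le_between in A1, A2. apply Rabs_def2 in A3, A4. apply Rabs_def1; lra. }
  destruct Hc as [S HSl]. exists S; split; [|exact HSl].
  assert (Hd : forall K, (k0 <= K)%nat -> Rabs (Rsum l K - S) <= r K).
  { intros K Hk. rewrite Rabs_minus_sym.
    apply (is_lim_seq_le_loc (fun n => Rabs (T n - Rsum (a n) K)) (fun _ => r K)
             (Rabs (S - Rsum l K)) (r K)).
    - apply HT, Hk.
    - apply (is_lim_seq_abs _ (S - Rsum l K)). apply is_lim_seq_minus'; auto.
    - apply is_lim_seq_const. }
  apply is_lim_seq_spec. intros eps. destruct (HK eps) as (K & Hk & HK').
  exists K. intros n Hn. specialize (Hd n ltac:(lia)). specialize (HK' n Hn).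
  apply Rabs_def2 in HK'. lra.
Qed.

Lemma Rsum_tail_le (a b : nat -> R) K n :
  (K <= n)%nat -> (forall k, (K <= k < n)%nat -> Rabs (a k) <= b k) ->
  Rabs (Rsum a n - Rsum a K) <= Rsum b n - Rsum b K.
Proof.
  intros HK H. replace n with (K + (n - K))%nat by lia. rewrite !Rsum_app.
  replace (Rsum a K + _ - Rsum a K) with (Rsum (fun k => a (K + k)%nat) (n - K)) by ring.
  replace (Rsum b K + _ - Rsum b K) with (Rsum (fun k => b (K + k)%nat) (n - K)) by ring.
  eapply Rle_trans; [apply Rabs_Rsum|]. apply Rsum_le; intros; apply H; lia.
Qed.

Lemma tail_lim b : ex_series b -> is_lim_seq (fun K => Series b - Rsum b K) 0.
Proof.
  intros H. apply Series_correct, is_series_Rsum in H.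
  replace (Finite 0) with (Finite (Series b - Series b)) by (f_equal; ring).
  apply is_lim_seq_minus'; [apply is_lim_seq_const|exact H].
Qed.

(** The number of terms [p n] may depend on n, as it does for a finite partial fraction identity
    whose length grows with the discretisation. *)
Lemma dominated_Rsum (a : nat -> nat -> R) (p : nat -> nat) (l b : nat -> R) (k0 : nat) :
  (forall k, 0 <= b k) -> ex_series b ->
  (forall K, eventually (fun n => (K <= p n)%nat)) ->
  eventually (fun n => forall k, (k0 <= k < p n)%nat -> Rabs (a n k) <= b k) ->
  (forall k, is_lim_seq (fun n => a n k) (l k)) ->
  exists S : R, is_lim_seq (Rsum l) S /\ is_lim_seq (fun n => Rsum (a n) (p n)) S.
Proof.
  intros Hb Hs Hp [n0 Ha] Hl.
  apply tannery with a (fun K => Series b - Rsum b K) k0; [|now apply tail_lim|exact Hl].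
  intros K HK. destruct (Hp K) as [n1 H1]. exists (n0 + n1)%nat; intros n Hn.
  specialize (H1 n ltac:(lia)).
  eapply Rle_trans; [apply (Rsum_tail_le _ b); [exact H1|]|].
  - intros k Hk; apply Ha; lia.
  - pose proof (Rsum_le_Series b (p n) Hb Hs); lra.
Qed.

Lemma dominated_Csum (a : nat -> nat -> CC) (p : nat -> nat) (l : nat -> CC) (b : nat -> R) (k0 : nat) :
  (forall k, 0 <= b k) -> ex_series b ->
  (forall K, eventually (fun n => (K <= p n)%nat)) ->
  eventually (fun n => forall k, (k0 <= k < p n)%nat -> Cmod (a n k) <= b k) ->
  (forall k, is_Clim (fun n => a n k) (l k)) ->
  exists S : CC, is_Clim (Csum l) S /\ is_Clim (fun n => Csum (a n) (p n)) S.
Proof.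
  intros Hb Hs Hp [n0 Ha] Hl.
  destruct (dominated_Rsum (fun n k => fst (a n k)) p (fun k => fst (l k)) b k0) as (S1 & A1 & B1); auto.
  { exists n0; intros n Hn k Hk. eapply Rle_trans; [apply Rabs_fst_le|now apply Ha]. }
  { intros k; apply Hl. }
  destruct (dominated_Rsum (fun n k => snd (a n k)) p (fun k => snd (l k)) b k0) as (S2 & A2 & B2); auto.
  { exists n0; intros n Hn k Hk. eapply Rle_trans; [apply Rabs_snd_le|now apply Ha]. }
  { intros k; apply Hl. }
  exists ((S1, S2) : CC). split; split; simpl.
  - eapply is_lim_seq_ext; [|exact A1]; intros; now rewrite fst_Csum.
  - eapply is_lim_seq_ext; [|exact A2]; intros; now rewrite snd_Csum.
  - eapply is_lim_seq_ext; [|exact B1]; intros; simpl; now rewrite fst_Csum.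
  - eapply is_lim_seq_ext; [|exact B2]; intros; simpl; now rewrite snd_Csum.
Qed.

Lemma ex_series_dominated (a b : nat -> R) :
  (forall k, Rabs (a k) <= b k) -> ex_series b -> ex_series a.
Proof. intros H Hb; apply (@ex_series_le R_AbsRing R_CompleteNormedModule a b); [exact H|exact Hb]. Qed.

Lemma dominated_Series (a : nat -> nat -> R) (l b : nat -> R) :
  (forall n k, Rabs (a n k) <= b k) -> ex_series b ->
  (forall k, is_lim_seq (fun n => a n k) (l k)) ->
  is_lim_seq (fun n => Series (a n)) (Series l).
Proof.
  intros Ha Hs Hl.
  assert (Hb : forall k, 0 <= b k).
  { intros k; eapply Rle_trans; [apply Rabs_pos|apply (Ha O)]. }
  destruct (tannery a (fun n => Series (a n)) l (fun K => Series b - Rsum b K) O) as (S & A & B).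
  - intros K _. exists O; intros n _.
    assert (L : ex_series (a n)) by (apply ex_series_dominated with b; auto).
    apply Series_correct, is_series_Rsum in L.
    apply (is_lim_seq_le_loc (fun m => Rabs (Rsum (a n) m - Rsum (a n) K)) (fun _ => Series b - Rsum b K)
             (Rabs (Series (a n) - Rsum (a n) K)) (Series b - Rsum b K)).
    + exists K; intros m Hm. eapply Rle_trans; [apply (Rsum_tail_le _ b); auto|].
      pose proof (Rsum_le_Series b m Hb Hs); lra.
    + apply (is_lim_seq_abs _ (Series (a n) - Rsum (a n) K)).
      apply is_lim_seq_minus'; [exact L|apply is_lim_seq_const].
    + apply is_lim_seq_const.
  - now apply tail_lim.
  - exact Hl.
  - now rewrite (Series_Rsum l S A).
Qed.

(** Comparison, from the second term on, with the telescoping series of 1/(k+1) - 1/(k+2). *)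
Lemma ex_series_inv_sqr : ex_series (fun k => / INR (S k) ^ 2).
Proof.
  apply ex_series_incr_1.
  apply ex_series_dominated with (fun k => / INR (S k) - / INR (S (S k))).
  - intros k. pose proof (pos_INR k). rewrite !S_INR.
    rewrite Rabs_pos_eq by (left; apply Rinv_0_lt_compat; nra).
    apply Rminus_le_0. replace (_ - _) with (/ ((INR k + 1) * (INR k + 1 + 1) ^ 2)) by (field; lra).
    left; apply Rinv_0_lt_compat; nra.
  - exists 1. apply is_series_Rsum.
    apply (is_lim_seq_ext (fun n => 1 - / INR (S n))).
    + intros n. rewrite (Rsum_telescope (fun k => / INR (S k))). simpl; field.
      destruct n; [lra|pose proof (pos_INR (S n)); lra].
    + replace (Finite 1) with (Finite (1 - 0)) by (f_equal; ring).
      apply is_lim_seq_minus'; [apply is_lim_seq_const|].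

      replace (Finite 0) with (Rbar_inv p_infty) by reflexivity.
      apply is_lim_seq_inv; [|discriminate].
      apply -> is_lim_seq_incr_1. apply is_lim_seq_INR.
Qed.

Lemma ex_series_scal_inv_sqr C : ex_series (fun k => C * / INR (S k) ^ 2).
Proof. apply (@ex_series_scal R_AbsRing R_NormedModule C). exact ex_series_inv_sqr. Qed.

(** * The complex exponential *)

Lemma Cexp_plus z w : Cexp (z + w) = (Cexp z * Cexp w)%C.
Proof.
  unfold Cexp, Cplus, Cmult; simpl.
  rewrite exp_plus, cos_plus, sin_plus. apply injective_projections; simpl; ring.
Qed.

Lemma Cexp_0 : Cexp 0 = 1%C.
Proof. unfold Cexp; simpl. rewrite exp_0, cos_0, sin_0. apply injective_projections; simpl; ring. Qed.

Lemma Cmod_Cexp z : Cmod (Cexp z) = exp (fst z).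
Proof.
  unfold Cexp, Cmod; simpl.
  replace (_ + _) with (exp (fst z) * exp (fst z) * ((sin (snd z))² + (cos (snd z))²)) by (unfold Rsqr; ring).
  rewrite sin2_cos2, Rmult_1_r. apply sqrt_square. left; apply exp_pos.
Qed.

Lemma Cexp_neq_0 z : Cexp z <> 0%C.
Proof. apply Cmod_gt_0. rewrite Cmod_Cexp. apply exp_pos. Qed.

Lemma Cexp_opp z : Cexp (- z) = (/ Cexp z)%C.
Proof.
  pose proof (Cexp_neq_0 z).
  assert (E : (Cexp (- z) * Cexp z = 1)%C) by (rewrite <- Cexp_plus, <- Cexp_0; f_equal; ring).
  rewrite <- (Cmult_1_l (/ Cexp z)), <- E. field; auto.
Qed.

Lemma Cexp_RtoC (r : R) : Cexp r = RtoC (exp r).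
Proof. unfold Cexp; simpl. rewrite cos_0, sin_0. apply injective_projections; simpl; ring. Qed.

Lemma Cexp_pow z n : (Cexp z ^ n)%C = Cexp (RtoC (INR n) * z).
Proof.
  induction n as [|n IH].
  - simpl. replace (RtoC 0 * z)%C with (RtoC 0) by ring. now rewrite Cexp_0.
  - simpl Cpow. rewrite IH, S_INR, RtoC_plus, <- Cexp_plus. f_equal; ring.
Qed.

Lemma exp_le (a b : R) : a <= b -> exp a <= exp b.
Proof. intros [H|H]; [left; now apply exp_increasing|subst; lra]. Qed.

(** * Complex-valued functions of a real variable *)

Definition is_Cderive (f : R -> CC) (t : R) (l : CC) : Prop :=
  is_derive (fun x => fst (f x)) t (fst l) /\ is_derive (fun x => snd (f x)) t (snd l).

Lemma is_Cderive_const c t : is_Cderive (fun _ => c) t 0.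
Proof. split; simpl; apply (@is_derive_const R_AbsRing). Qed.

Lemma is_Cderive_RtoC (f : R -> R) t (l : R) : is_derive f t l -> is_Cderive (fun x => RtoC (f x)) t l.
Proof. intros H; split; simpl; [exact H|apply (@is_derive_const R_AbsRing)]. Qed.

Lemma is_Cderive_id t : is_Cderive RtoC t 1.
Proof. apply (is_Cderive_RtoC (fun x => x)), (@is_derive_id R_AbsRing). Qed.

Lemma is_Cderive_plus f g t a b :
  is_Cderive f t a -> is_Cderive g t b -> is_Cderive (fun x => f x + g x)%C t (a + b)%C.
Proof. intros [? ?] [? ?]; split; apply (@is_derive_plus R_AbsRing R_NormedModule); assumption. Qed.

Lemma is_derive_mult_R (f g : R -> R) t a b :
  is_derive f t a -> is_derive g t b -> is_derive (fun x => f x * g x) t (a * g t + f t * b).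
Proof. intros; apply (@is_derive_mult R_AbsRing f g t a b); auto. intros; apply Rmult_comm. Qed.

Lemma is_Cderive_mult f g t a b :
  is_Cderive f t a -> is_Cderive g t b -> is_Cderive (fun x => f x * g x)%C t (a * g t + f t * b)%C.
Proof.
  intros [A1 A2] [B1 B2]; split; simpl.
  - pose proof (@is_derive_minus R_AbsRing R_NormedModule _ _ _ _ _ (is_derive_mult_R _ _ _ _ _ A1 B1) (is_derive_mult_R _ _ _ _ _ A2 B2)) as H.
    unfold minus, plus, opp in H; simpl in H.
    eapply is_derive_ext; [|replace (_ + _) with ((fst a * fst (g t) + fst (f t) * fst b) + - (snd a * snd (g t) + snd (f t) * snd b)) by ring; exact H].
    intros x; simpl; ring.
  - pose proof (@is_derive_plus R_AbsRing R_NormedModule _ _ _ _ _ (is_derive_mult_R _ _ _ _ _ A1 B2) (is_derive_mult_R _ _ _ _ _ A2 B1)) as H.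
    unfold plus in H; simpl in H.
    eapply is_derive_ext; [|replace (_ + _) with ((fst a * snd (g t) + fst (f t) * snd b) + (snd a * fst (g t) + snd (f t) * fst b)) by ring; exact H].
    intros x; simpl; ring.
Qed.

Lemma is_Cderive_Cexp f t l :
  is_Cderive f t l -> is_Cderive (fun x => Cexp (f x)) t (l * Cexp (f t))%C.
Proof.
  intros [A1 A2]; unfold Cexp; split; simpl.
  - evar_last.
    + apply is_derive_mult_R.
      * apply (is_derive_comp exp (fun x => fst (f x))); [apply is_derive_exp|exact A1].
      * apply (is_derive_comp cos (fun x => snd (f x))); [apply is_derive_cos|exact A2].
    + unfold scal; simpl; unfold mult; simpl. ring.
  - evar_last.
    + apply is_derive_mult_R.
      * apply (is_derive_comp exp (fun x => fst (f x))); [apply is_derive_exp|exact A1].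
      * apply (is_derive_comp sin (fun x => snd (f x))); [apply is_derive_sin|exact A2].
    + unfold scal; simpl; unfold mult; simpl. ring.
Qed.

Lemma is_Cderive_eq f t a b : is_Cderive f t a -> a = b -> is_Cderive f t b.
Proof. now intros H <-. Qed.

(** The real mean value theorem is applied to Re (conj(w) f) with w = f b - f a, which gives |w|^2
    <= |w| M (b - a). *)
Lemma C_mean_value f g a b M :
  a <= b ->
  (forall t, a <= t <= b -> is_Cderive f t (g t)) ->
  (forall t, a <= t <= b -> Cmod (g t) <= M) ->
  Cmod (f b - f a)%C <= M * (b - a).
Proof.
  intros Hab Hd HM.
  set (w := (f b - f a)%C).
  set (phi := fun t => fst w * fst (f t) + snd w * snd (f t)).
  destruct (MVT_gen phi a b (fun t => fst w * fst (g t) + snd w * snd (g t))) as (c & Hc & E).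
  - rewrite Rmin_left, Rmax_right by lra. intros t Ht. destruct (Hd t ltac:(lra)) as [D1 D2].
    unfold phi. apply (@is_derive_plus R_AbsRing R_NormedModule);
      apply is_derive_scal; assumption.
  - rewrite Rmin_left, Rmax_right by lra. intros t Ht. destruct (Hd t ltac:(lra)) as [D1 D2].
    apply continuity_pt_filterlim. apply (ex_derive_continuous phi). eexists.
    unfold phi. apply (@is_derive_plus R_AbsRing R_NormedModule); apply is_derive_scal; eassumption.
  - rewrite Rmin_left, Rmax_right in Hc by lra. specialize (HM c Hc).
    assert (E1 : Cmod w * Cmod w = phi b - phi a).
    { pose proof (Cmod2_alt w) as E2. replace (Cmod w * Cmod w) with (Cmod w ^ 2) by ring.
      rewrite E2. unfold phi, w, Re, Im; simpl; ring. }
    assert (E2 : fst w * fst (g c) + snd w * snd (g c) <= Cmod w * Cmod (g c)).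
    { rewrite <- (Cmod_conj w), <- Cmod_mult.
      eapply Rle_trans; [|apply Rabs_fst_le].
      eapply Rle_trans; [|apply Rle_abs]. simpl. lra. }
    pose proof (Cmod_ge_0 w) as Hw.
    destruct (Req_dec (Cmod w) 0) as [Z|Z].
    + rewrite Z. pose proof (Cmod_ge_0 (g c)). nra.
    + assert (Cmod w * Cmod w <= Cmod w * (M * (b - a))).
      { rewrite E1, E.
        assert (Cmod w * Cmod (g c) <= Cmod w * M) by (apply Rmult_le_compat_l; lra). nra. }
      apply Rmult_le_reg_l with (Cmod w); lra.
Qed.

Lemma is_Cderive_exp_line w t : is_Cderive (fun x => Cexp (RtoC x * w)) t (w * Cexp (RtoC t * w))%C.
Proof.
  eapply is_Cderive_eq; [apply is_Cderive_Cexp, is_Cderive_mult;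
    [apply is_Cderive_id|apply is_Cderive_const]|].
  cbv beta. ring.
Qed.

Lemma exp_fst_le w t : 0 <= t <= 1 -> exp (fst (RtoC t * w)%C) <= exp (Cmod w).
Proof.
  intros Ht. apply exp_le. simpl. pose proof (Rabs_fst_le w). apply Rabs_le_between in H.
  pose proof (Cmod_ge_0 w). nra.
Qed.

Lemma Cexp_sub_1 w : Cmod (Cexp w - 1)%C <= Cmod w * exp (Cmod w).
Proof.
  pose proof (C_mean_value (fun t => Cexp (RtoC t * w)) (fun t => w * Cexp (RtoC t * w))%C 0 1
    (Cmod w * exp (Cmod w))) as H.
  replace (Cexp w - 1)%C with (Cexp (1 * w) - Cexp (0 * w))%C.
  - eapply Rle_trans; [apply H|right; ring]; [lra|intros; apply is_Cderive_exp_line|].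
    intros t Ht. rewrite Cmod_mult, Cmod_Cexp. apply Rmult_le_compat_l; [apply Cmod_ge_0|now apply exp_fst_le].
  - replace (1 * w)%C with w by ring. replace (0 * w)%C with (RtoC 0) by ring. now rewrite Cexp_0.
Qed.

(** The function e^(tw) - tw has derivative w (e^(tw) - 1), to which the first-order bound
    applies. *)
Lemma Cexp_sub_1_sub w : Cmod (Cexp w - 1 - w)%C <= Cmod w ^ 2 * exp (Cmod w).
Proof.
  pose proof (C_mean_value (fun t => Cexp (RtoC t * w) + RtoC t * - w)%C
    (fun t => w * (Cexp (RtoC t * w) - 1))%C 0 1
    (Cmod w ^ 2 * exp (Cmod w))) as H.
  replace (Cexp w - 1 - w)%C with ((Cexp (1 * w) + 1 * - w) - (Cexp (0 * w) + 0 * - w))%C.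
  - eapply Rle_trans; [apply H|right; ring]; [lra| |].
    + intros t _. eapply is_Cderive_eq; [apply is_Cderive_plus; [apply is_Cderive_exp_line|
        apply is_Cderive_mult; [apply is_Cderive_id|apply is_Cderive_const]]|].
      cbv beta. ring.
    + intros t Ht. rewrite Cmod_mult. replace (Cmod w ^ 2 * exp (Cmod w)) with (Cmod w * (Cmod w * exp (Cmod w))) by ring.
      apply Rmult_le_compat_l; [apply Cmod_ge_0|].
      eapply Rle_trans; [apply Cexp_sub_1|]. rewrite Cmod_mult, Cmod_R, Rabs_pos_eq by lra.
      pose proof (Cmod_ge_0 w). pose proof (exp_pos (Cmod w)).
      assert (exp (t * Cmod w) <= exp (Cmod w)) by (apply exp_le; nra).
      assert (0 < exp (t * Cmod w)) by apply exp_pos.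
      apply Rmult_le_compat; nra.
  - replace (1 * w)%C with w by ring. replace (0 * w)%C with (RtoC 0) by ring. rewrite Cexp_0. ring.
Qed.

Lemma is_lim_seq_inv_INR : is_lim_seq (fun n => / INR n) 0.
Proof.
  replace (Finite 0) with (Rbar_inv p_infty) by reflexivity.
  apply is_lim_seq_inv; [apply is_lim_seq_INR|discriminate].
Qed.

(** For Y = e^(-z/m) this is the limit of m (1 - Y), from which those of Y and of the scaled kernel
    are deduced. At an imaginary z it also yields the limit of n sin(b/n). *)
Lemma lim_expm1 (z : CC) :
  is_Clim (fun n => RtoC (INR (S n)) * (1 - Cexp (- z / RtoC (INR (S n)))))%C z.
Proof.
  apply is_Clim_squeeze with (fun n => Cmod z ^ 2 * exp (Cmod z) * / INR (S n)).
  - intros n. set (m := INR (S n)).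
    assert (Hm : 1 <= m) by (unfold m; rewrite S_INR; pose proof (pos_INR n); lra).
    assert (Hm0 : RtoC m <> 0%C) by (intros E; apply (f_equal fst) in E; simpl in E; lra).
    set (w := (- z / RtoC m)%C).
    replace (RtoC m * (1 - Cexp w) - z)%C with (- (RtoC m * (Cexp w - 1 - w)))%C
      by (unfold w; field; auto).
    rewrite Cmod_opp, Cmod_mult, Cmod_R, Rabs_pos_eq by lra.
    pose proof (Cexp_sub_1_sub w) as H.
    assert (Ew : Cmod w = Cmod z / m).
    { unfold w. rewrite Cmod_div, Cmod_opp, Cmod_R, Rabs_pos_eq by (lra || auto). easy. }
    rewrite Ew in H.
    pose proof (Cmod_ge_0 z) as Hz.
    assert (Hi : 0 < / m <= 1).
    { split; [apply Rinv_0_lt_compat; lra|]. rewrite <- Rinv_1. apply Rinv_le_contravar; lra. }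
    assert (exp (Cmod z / m) <= exp (Cmod z)) by (apply exp_le; unfold Rdiv; nra).
    apply Rle_trans with (m * ((Cmod z / m) ^ 2 * exp (Cmod z))).
    + apply Rmult_le_compat_l; [lra|]. eapply Rle_trans; [exact H|].
      apply Rmult_le_compat_l; [apply pow2_ge_0|assumption].
    + right. field. lra.
  - replace (Finite 0) with (Rbar_mult (Cmod z ^ 2 * exp (Cmod z)) 0) by (simpl; f_equal; ring).
    apply is_lim_seq_scal_l. apply (is_lim_seq_incr_1 (fun n => / INR n)), is_lim_seq_inv_INR.
Qed.

(** * Roots of unity and a discrete Poisson formula *)

Definition cis (a : R) : CC := Cexp (0, a).

Lemma cis_plus a b : cis (a + b) = (cis a * cis b)%C.
Proof. unfold cis. rewrite <- Cexp_plus. f_equal. apply injective_projections; simpl; ring. Qed.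

Lemma cis_0 : cis 0 = 1%C.
Proof. apply Cexp_0. Qed.

Lemma Cmod_cis a : Cmod (cis a) = 1.
Proof. unfold cis. rewrite Cmod_Cexp. apply exp_0. Qed.

Lemma cis_neq_0 a : cis a <> 0%C.
Proof. apply Cexp_neq_0. Qed.

Lemma cis_opp a : cis (- a) = (/ cis a)%C.
Proof. unfold cis. rewrite <- Cexp_opp. f_equal. apply injective_projections; simpl; ring. Qed.

Lemma cis_pow a n : (cis a ^ n)%C = cis (INR n * a).
Proof. unfold cis. rewrite Cexp_pow. f_equal. apply injective_projections; simpl; ring. Qed.

Lemma cis_eq a : cis a = (cos a, sin a).
Proof. unfold cis, Cexp; simpl. rewrite exp_0. apply injective_projections; simpl; ring. Qed.

Lemma cis_add_opp a : (cis a + cis (- a))%C = RtoC (2 * cos a).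
Proof. rewrite !cis_eq, cos_neg, sin_neg. apply injective_projections; simpl; ring. Qed.

Lemma cis_2PI_Z (d : Z) : cis (2 * PI * IZR d) = 1%C.
Proof.
  rewrite cis_eq.
  assert (E : cos (2 * PI * IZR d) = 1 /\ sin (2 * PI * IZR d) = 0).
  { split.
    - replace (2 * PI * IZR d) with (2 * (IZR d * PI)) by ring.
      rewrite cos_2a_sin, sin_eq_0_1 by (now exists d). ring.
    - apply sin_eq_0_1. exists (2 * d)%Z. rewrite mult_IZR. ring. }
  destruct E as [-> ->]. reflexivity.
Qed.

Lemma cis_eq_1 a : cis a = 1%C -> exists d : Z, a = 2 * PI * IZR d.
Proof.
  rewrite cis_eq. intros H. apply (f_equal fst) in H; simpl in H.
  destruct (sin_eq_0_0 (a / 2)) as [d Hd].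
  - replace a with (2 * (a / 2)) in H by field. rewrite cos_2a_sin in H. nra.
  - exists d. lra.
Qed.

Lemma Csum_geom (w : CC) n : ((w - 1) * Csum (fun k => w ^ k) n)%C = (w ^ n - 1)%C.
Proof. induction n as [|n IH]; simpl; [ring|]. rewrite Cmult_plus_distr_l, IH. ring. Qed.

Lemma Csum_const (c : CC) n : Csum (fun _ => c) n = (RtoC (INR n) * c)%C.
Proof.
  induction n as [|n IH]; [simpl; ring|].
  rewrite S_INR, RtoC_plus. simpl Csum. rewrite IH. ring.
Qed.

Lemma RtoC_neq_0 (r : R) : r <> 0 -> RtoC r <> 0%C.
Proof. intros H E; apply H. now apply (f_equal fst) in E. Qed.

Lemma root_of_unity_sum (n : nat) (d : Z) : (1 <= n)%nat ->
  Csum (fun k => cis (2 * PI * IZR d * INR k / INR n)) n =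
  if Z.eq_dec (d mod Z.of_nat n) 0 then RtoC (INR n) else RtoC 0.
Proof.
  intros Hn. assert (Hn' : INR n <> 0) by (apply not_0_INR; lia).
  set (w := cis (2 * PI * IZR d / INR n)).
  assert (E : forall k, cis (2 * PI * IZR d * INR k / INR n) = (w ^ k)%C).
  { intros k. unfold w. rewrite cis_pow. f_equal. field; auto. }
  rewrite (Csum_ext _ (fun k => w ^ k)%C) by (intros; apply E).
  destruct (Z.eq_dec (d mod Z.of_nat n) 0) as [H|H].
  - assert (Ew : w = 1%C).
    { unfold w. apply Z.mod_divide in H; [|lia]. destruct H as [c ->].
      rewrite mult_IZR, <- INR_IZR_INZ.
      replace (2 * PI * (IZR c * INR n) / INR n) with (2 * PI * IZR c) by (field; auto).
      apply cis_2PI_Z. }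
    rewrite (Csum_ext _ (fun _ => 1%C)).
    + rewrite Csum_const. ring.
    + intros k _. rewrite Ew. clear. induction k as [|k IH]; simpl; [easy|rewrite IH; ring].
  - assert (Ew : (w - 1)%C <> 0%C).
    { intros Ew. assert (E1 : w = 1%C) by (replace w with (w - 1 + 1)%C by ring; rewrite Ew; ring).
      destruct (cis_eq_1 _ E1) as [c Hc]. apply H.
      apply Z.mod_divide; [lia|]. exists c. apply eq_IZR. rewrite mult_IZR, <- INR_IZR_INZ.
      pose proof PI_RGT_0. apply (Rmult_eq_reg_l (2 * PI / INR n)).
      - rewrite <- Rmult_div_swap. replace (2 * PI / INR n * (IZR c * INR n)) with (2 * PI * IZR c) by (field; auto).
        rewrite <- Hc. field; auto.
      - intros Z. apply (Rmult_eq_compat_r (INR n)) in Z. field_simplify in Z; auto. lra. }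
    assert (E0 : ((w - 1) * Csum (fun k => w ^ k) n)%C = 0%C).
    { rewrite Csum_geom. unfold w at 1. rewrite cis_pow.
      replace (INR n * _) with (2 * PI * IZR d) by (field; auto). rewrite cis_2PI_Z. ring. }
    destruct (Ceq_dec (Csum (fun k => w ^ k)%C n) 0) as [Z|Z]; [exact Z|].
    exfalso. revert E0. now apply Cmult_neq_0.
Qed.

Lemma Csum_single (f : nat -> CC) n j0 : (j0 < n)%nat ->
  (forall j, (j < n)%nat -> j <> j0 -> f j = 0%C) -> Csum f n = f j0.
Proof.
  induction n as [|n IH]; intros Hj H; [lia|]. simpl.
  destruct (Nat.eq_dec j0 n) as [->|Hne].
  - rewrite (Csum_ext f (fun _ => 0%C)), Csum_0 by (intros; apply H; lia). ring.
  - rewrite IH, (H n) by (lia || (intros; apply H; lia)). ring.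
Qed.

Lemma Cmod_1_minus (w : CC) : Cmod w < 1 -> (1 - w)%C <> 0%C.
Proof.
  intros H E. assert (w = 1%C) by (replace w with (1 - (1 - w))%C by ring; rewrite E; ring).
  subst w. rewrite Cmod_1 in H. lra.
Qed.

Lemma Cmod_pow_lt_1 (w : CC) n : Cmod w < 1 -> (1 <= n)%nat -> Cmod (w ^ n)%C < 1.
Proof.
  intros H Hn. rewrite Cmod_pow. apply pow_lt_1_compat; [split; [apply Cmod_ge_0|exact H]|lia].
Qed.

(** The Poisson kernel, the sum over all integers j of Y^|j| e^(ija), for complex Y of modulus below
    1. *)
Definition poisson (Y : CC) (a : R) : CC :=
  (/ (1 - Y * cis a) + Y * cis (- a) / (1 - Y * cis (- a)))%C.

Lemma Cmod_mul_cis Y a : Cmod (Y * cis a)%C = Cmod Y.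
Proof. rewrite Cmod_mult, Cmod_cis. ring. Qed.

(** The product of the two denominators is 1 - 2 Y cos a + Y^2. It is written with sin(a/2)^2
    because, for a = 2 pi k/n, both n sin(a/2) and n (1 - Y) have finite limits as n grows. *)
Lemma poisson_closed Y a : Cmod Y < 1 ->
  poisson Y a = ((1 - Y * Y) / ((1 - Y) * (1 - Y) + 4 * Y * RtoC (sin (a / 2) ^ 2)))%C.
Proof.
  intros HY. unfold poisson.
  assert (H1 : (1 - Y * cis a)%C <> 0%C) by (apply Cmod_1_minus; now rewrite Cmod_mul_cis).
  assert (H2 : (1 - Y * cis (- a))%C <> 0%C) by (apply Cmod_1_minus; now rewrite Cmod_mul_cis).
  assert (E : ((1 - Y * cis a) * (1 - Y * cis (- a)) = (1 - Y) * (1 - Y) + 4 * Y * RtoC (sin (a / 2) ^ 2))%C).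
  { replace ((1 - Y * cis a) * (1 - Y * cis (- a)))%C
      with (1 - Y * (cis a + cis (- a)) + Y * Y * (cis a * cis (- a)))%C by ring.
    rewrite <- cis_plus, Rplus_opp_r, cis_0, cis_add_opp.
    replace (cos a) with (1 - 2 * sin (a / 2) * sin (a / 2)) by (rewrite <- cos_2a_sin; f_equal; field).
    rewrite !RtoC_mult, !RtoC_minus, !RtoC_mult, RtoC_pow. ring. }
  rewrite <- E. rewrite cis_opp in *. pose proof (cis_neq_0 a).
  field. repeat split; auto.
  intros Z. apply H2. replace (1 - Y * / cis a)%C with ((cis a - Y) / cis a)%C by (field; auto).
  rewrite Z. unfold Cdiv. ring.
Qed.

Lemma poisson_periodic Y a b : cis a = cis b -> poisson Y a = poisson Y b.
Proof. intros H. unfold poisson. now rewrite !cis_opp, H. Qed.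

Lemma poisson_opp Y a : Cmod Y < 1 -> poisson Y (- a) = poisson Y a.
Proof.
  intros H. rewrite !poisson_closed by exact H.
  replace (- a / 2) with (- (a / 2)) by field. rewrite sin_neg.
  replace ((- sin (a / 2)) ^ 2) with (sin (a / 2) ^ 2) by ring. reflexivity.
Qed.

(** Since (Y e^(ia))^n = Y^n, the factor 1 - Y^n turns the geometric series into a polynomial. *)
Lemma inv_one_minus Y a n : (1 <= n)%nat -> Cmod Y < 1 -> cis (INR n * a) = 1%C ->
  ((1 - Y ^ n) * / (1 - Y * cis a))%C = Csum (fun j => Y ^ j * cis (INR j * a))%C n.
Proof.
  intros Hn HY Ha.
  assert (H1 : (1 - Y * cis a)%C <> 0%C) by (apply Cmod_1_minus; now rewrite Cmod_mul_cis).
  rewrite (Csum_ext _ (fun j => (Y * cis a) ^ j)%C).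
  - pose proof (Csum_geom (Y * cis a)%C n) as G.
    assert (E : ((Y * cis a) ^ n)%C = (Y ^ n)%C) by (rewrite Cpow_mult_l, cis_pow, Ha; ring).
    rewrite E in G.
    replace (1 - Y ^ n)%C with (- (Y ^ n - 1))%C by ring. rewrite <- G. field; auto.
  - intros j _. now rewrite Cpow_mult_l, cis_pow.
Qed.

Lemma cis_Z_mod (n : nat) (d : Z) : (1 <= n)%nat -> cis (INR n * (2 * PI * IZR d / INR n)) = 1%C.
Proof.
  intros Hn. assert (INR n <> 0) by (apply not_0_INR; lia).
  replace (INR n * _) with (2 * PI * IZR d) by (field; auto). apply cis_2PI_Z.
Qed.

(** Aliasing on n points: the discrete Fourier coefficient at frequency m collects Y^|j| over all j
    congruent to -m modulo n. After the factor 1 - Y^n only two of them survive, exponent n - m from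
    the first half of the kernel and m from the second. *)
Lemma poisson_sum Y (n m : nat) : (1 <= m <= n)%nat -> Cmod Y < 1 ->
  ((1 - Y ^ n) * Csum (fun k => cis (2 * PI * INR m * INR k / INR n) * poisson Y (2 * PI * INR k / INR n)) n)%C
  = (RtoC (INR n) * (Y ^ (n - m) + Y ^ m))%C.
Proof.
  intros Hm HY. assert (Hn : INR n <> 0) by (apply not_0_INR; lia).
  rewrite <- Csum_scal.
  rewrite (Csum_ext _ (fun k =>
    Csum (fun j => Y ^ j * cis (2 * PI * IZR (Z.of_nat (m + j)) * INR k / INR n)) n +
    Csum (fun j => Y ^ S j * cis (2 * PI * IZR (Z.of_nat m - Z.of_nat (S j)) * INR k / INR n)) n)%C).
  - rewrite Csum_plus.
    rewrite (Csum_swap (fun k j => Y ^ j * cis (2 * PI * IZR (Z.of_nat (m + j)) * INR k / INR n))%C).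
    rewrite (Csum_swap (fun k j => Y ^ S j * cis (2 * PI * IZR (Z.of_nat m - Z.of_nat (S j)) * INR k / INR n))%C).
    rewrite Cmult_plus_distr_l. f_equal.
    + rewrite (Csum_ext _ (fun j => Y ^ j * if Z.eq_dec (Z.of_nat (m + j) mod Z.of_nat n) 0 then RtoC (INR n) else RtoC 0)%C).
      * rewrite (Csum_single _ n (n - m)).
        -- destruct (Z.eq_dec _ _) as [_|H]; [ring|]. exfalso; apply H.
           replace (m + (n - m))%nat with n by lia. apply Z_mod_same_full.
        -- lia.
        -- intros j Hj Hne. destruct (Z.eq_dec _ _) as [H|_]; [|ring].
           exfalso. apply Z.mod_divide in H; [|lia]. destruct H as [c Hc].
           assert (c = 1)%Z by nia. lia.
      * intros j _. rewrite Csum_scal. f_equal. apply root_of_unity_sum; lia.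
    + rewrite (Csum_ext _ (fun j => Y ^ S j * if Z.eq_dec ((Z.of_nat m - Z.of_nat (S j)) mod Z.of_nat n) 0 then RtoC (INR n) else RtoC 0)%C).
      * rewrite (Csum_single _ n (m - 1)).
        -- replace (S (m - 1)) with m by lia. rewrite Z.sub_diag.
           destruct (Z.eq_dec _ _) as [_|H]; [ring|]. exfalso; apply H. reflexivity.
        -- lia.
        -- intros j Hj Hne. destruct (Z.eq_dec _ _) as [H|_]; [|ring].
           exfalso. apply Z.mod_divide in H; [|lia]. destruct H as [c Hc].
           assert (c = 0)%Z by nia. lia.
      * intros j _. rewrite Csum_scal. f_equal. apply root_of_unity_sum; lia.
  - intros k _. unfold poisson.
    set (a := 2 * PI * INR k / INR n).
    assert (Ha : cis (INR n * a) = 1%C).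
    { unfold a. rewrite (INR_IZR_INZ k). apply cis_Z_mod; lia. }
    assert (Ha' : cis (INR n * - a) = 1%C).
    { replace (INR n * - a) with (- (INR n * a)) by ring. rewrite cis_opp, Ha. field. }
    pose proof (inv_one_minus Y a n ltac:(lia) HY Ha) as E1.
    pose proof (inv_one_minus Y (- a) n ltac:(lia) HY Ha') as E2.
    transitivity (cis (2 * PI * INR m * INR k / INR n) * ((1 - Y ^ n) * / (1 - Y * cis a)) +
      cis (2 * PI * INR m * INR k / INR n) * (Y * cis (- a)) * ((1 - Y ^ n) * / (1 - Y * cis (- a))))%C;
      [unfold Cdiv; ring|].
    rewrite E1, E2, <- !Csum_scal. f_equal; apply Csum_ext; intros j _.
    + rewrite <- INR_IZR_INZ, plus_INR.
      replace (2 * PI * (INR m + INR j) * INR k / INR n) with (2 * PI * INR m * INR k / INR n + INR j * a)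
        by (unfold a; field; auto). rewrite cis_plus. ring.
    + rewrite minus_IZR, <- !INR_IZR_INZ, S_INR.
      replace (2 * PI * (INR m - (INR j + 1)) * INR k / INR n) with (2 * PI * INR m * INR k / INR n + - a + INR j * - a)
        by (unfold a; field; auto). rewrite !cis_plus. simpl Cpow. ring.
Qed.

(** * Partial fractions of the symmetrised exponential kernel *)

(** Pairs k with 2p - k; the two fixed points 0 and p stand apart. *)
Lemma Csum_fold F p : (1 <= p)%nat ->
  Csum F (2 * p) = (F O + F p + Csum (fun k => F (S k) + F (2 * p - S k)%nat) (p - 1))%C.
Proof.
  destruct p as [|p]; [lia|]. intros _.
  replace (2 * S p)%nat with (S p + S p)%nat by lia. replace (S p - 1)%nat with p by lia.
  rewrite Csum_app, Csum_plus, !(Csum_shift _ p).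
  rewrite (Csum_rev (fun k => F (S p + S k)%nat) p).
  rewrite (Csum_ext (fun k => F (S p + S (p - 1 - k))%nat) (fun k => F (S p + S p - S k)%nat))
    by (intros; f_equal; lia).
  rewrite Nat.add_0_r. ring.
Qed.

(** Folding uses that the kernel is even and periodic in the angle. It confines k to k < p, where pi
    k/(2p) stays in the interval [0, pi/2] on which the sine has a linear lower bound. *)
Lemma poisson_half_sum Y (p m : nat) : (1 <= p)%nat -> (1 <= m <= 2 * p)%nat -> Cmod Y < 1 ->
  ((Y ^ (2 * p - m) + Y ^ m) / (1 - Y ^ (2 * p)))%C =
  (RtoC (/ INR (2 * p)) * (poisson Y 0 + cis (2 * PI * INR m * INR p / INR (2 * p)) * poisson Y PI) +
   Csum (fun k => RtoC (2 * cos (2 * PI * INR (S k) * (INR m / INR (2 * p)))) *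
     (RtoC (/ INR (2 * p)) * poisson Y (2 * PI * INR (S k) / INR (2 * p)))) (p - 1))%C.
Proof.
  intros Hp Hm HY. set (n := INR (2 * p)).
  assert (Hn : n <> 0) by (apply not_0_INR; lia).
  assert (Hn' : RtoC n <> 0%C) by now apply RtoC_neq_0.
  pose proof (poisson_sum Y (2 * p) m Hm HY) as E. fold n in E.
  assert (H1 : (1 - Y ^ (2 * p))%C <> 0%C) by (apply Cmod_1_minus, Cmod_pow_lt_1; [exact HY|lia]).
  rewrite Csum_fold in E by exact Hp.
  set (S0 := Csum _ (p - 1)) in E.
  transitivity (RtoC (/ n) * ((poisson Y 0 + cis (2 * PI * INR m * INR p / n) * poisson Y PI) + S0))%C.
  - rewrite RtoC_inv by exact Hn.
    replace (poisson Y 0) with (cis (2 * PI * INR m * INR 0 / n) * poisson Y (2 * PI * INR 0 / n))%C.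
    2: { simpl INR. replace (2 * PI * INR m * 0 / n) with 0 by (field; auto).
         replace (2 * PI * 0 / n) with 0 by (field; auto). rewrite cis_0. ring. }
    replace (poisson Y PI) with (poisson Y (2 * PI * INR p / n)).
    2: { f_equal. unfold n. rewrite mult_INR. simpl. field. apply not_0_INR; lia. }
    apply (f_equal (fun z => / RtoC n * z / (1 - Y ^ (2 * p)))%C) in E.
    transitivity (/ RtoC n * (RtoC n * (Y ^ (2 * p - m) + Y ^ m)) / (1 - Y ^ (2 * p)))%C.
    { field; auto. }
    rewrite <- E. field; auto.
  - rewrite Cmult_plus_distr_l. f_equal. unfold S0. rewrite <- Csum_scal.
    apply Csum_ext. intros k Hk.
    assert (EI : INR (2 * p - S k) = n - INR (S k)) by (rewrite minus_INR by lia; reflexivity).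
    rewrite EI.
    replace (2 * PI * INR m * (n - INR (S k)) / n) with (2 * PI * IZR (Z.of_nat m) + - (2 * PI * INR m * INR (S k) / n))
      by (rewrite <- INR_IZR_INZ; field; auto).
    rewrite cis_plus, cis_2PI_Z.
    replace (poisson Y (2 * PI * (n - INR (S k)) / n)) with (poisson Y (2 * PI * INR (S k) / n)).
    2: { rewrite <- (poisson_opp Y (2 * PI * INR (S k) / n)) by exact HY. apply poisson_periodic.
         replace (2 * PI * (n - INR (S k)) / n) with (2 * PI * IZR 1 + - (2 * PI * INR (S k) / n)) by (field; auto).
         rewrite cis_plus, cis_2PI_Z. ring. }
    replace (2 * PI * INR (S k) * (INR m / n)) with (2 * PI * INR m * INR (S k) / n) by (field; auto).
    rewrite <- cis_add_opp. ring.
Qed.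

(** From sin a >= a - a^3/6 and a^2 <= 4. *)
Lemma sin_lower a : 0 <= a <= PI / 2 -> a / 3 <= sin a.
Proof.
  intros [H1 H2]. pose proof PI_4. pose proof PI_RGT_0.
  destruct (sin_bound a 0 H1 ltac:(lra)) as [Hs _].
  unfold sin_approx, sin_term in Hs. simpl in Hs.
  eapply Rle_trans; [|exact Hs].
  assert (a * a <= 4) by nra. assert (a * (a * a) <= 4 * a) by nra. lra.
Qed.

Lemma lim_n_sin (b : R) : is_lim_seq (fun n => INR (S n) * sin (b / INR (S n))) b.
Proof.
  destruct (lim_expm1 (0, b)) as [_ H].
  eapply is_lim_seq_ext; [|exact H]. intros n. cbv beta.
  assert (Hn : INR (S n) <> 0) by (apply not_0_INR; lia).
  replace (- (0, b) / RtoC (INR (S n)))%C with ((0, - (b / INR (S n))) : CC).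
  - change (Cexp (0, - (b / INR (S n)))) with (cis (- (b / INR (S n)))).
    rewrite cis_eq, sin_neg. set (m := INR (S n)). simpl. ring.
  - unfold Cdiv. rewrite <- RtoC_inv by exact Hn. apply injective_projections; simpl; field; auto.
Qed.

Section PartialFractions.
Variable z : CC.
Hypothesis Hz : 0 < fst z.

Definition pfY (n : nat) : CC := Cexp (- z / RtoC (INR (S n))).

Lemma pfY_lt n : Cmod (pfY n) < 1.
Proof.
  unfold pfY. rewrite Cmod_Cexp, <- exp_0. apply exp_increasing.
  assert (Hn : 0 < INR (S n)) by (apply lt_0_INR; lia).
  set (m := INR (S n)) in *. unfold Cdiv. rewrite <- RtoC_inv by lra. simpl fst.
  assert (0 < / m) by now apply Rinv_0_lt_compat. nra.
Qed.

Lemma pfY_pow n m : (pfY n ^ m)%C = Cexp (- (RtoC (INR m / INR (S n)) * z))%C.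
Proof.
  assert (Hn : INR (S n) <> 0) by (apply not_0_INR; lia).
  unfold pfY. rewrite Cexp_pow. f_equal. rewrite RtoC_div by exact Hn.
  assert (RtoC (INR (S n)) <> 0%C) by now apply RtoC_neq_0. field; auto.
Qed.

Definition pfA (n : nat) : CC := (RtoC (INR (S n)) * (1 - pfY n))%C.

Lemma pfA_lim : is_Clim pfA z.
Proof. apply lim_expm1. Qed.

Lemma pfY_lim : is_Clim pfY 1.
Proof.
  apply (is_Clim_ext (fun n => 1 - RtoC (/ INR (S n)) * pfA n)%C).
  - intros n. unfold pfA.
    assert (Hn : INR (S n) <> 0) by (apply not_0_INR; lia).
    rewrite RtoC_inv by exact Hn. field. now apply RtoC_neq_0.
  - apply is_Clim_eq with (1 - RtoC 0 * z)%C; [|ring].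
    apply is_Clim_minus; [apply is_Clim_const|]. apply is_Clim_mult; [|exact pfA_lim].
    apply is_Clim_RtoC. apply (is_lim_seq_incr_1 (fun n => / INR n)), is_lim_seq_inv_INR.
Qed.

Definition pfB (n : nat) : CC := (pfA n * (1 + pfY n))%C.

Lemma pfB_lim : is_Clim pfB (2 * z)%C.
Proof.
  replace (2 * z)%C with (z * (1 + 1))%C by ring.
  apply is_Clim_mult; [exact pfA_lim|]. apply is_Clim_plus; [apply is_Clim_const|exact pfY_lim].
Qed.

(** The quotient [pfB n / pfD n a] is the kernel at [pfY n] divided by n + 1, once numerator and
    denominator are multiplied by (n + 1)^2; the argument [a] stands for the scaled sine (n + 1)
    sin(angle/2). *)
Definition pfD (n : nat) (a : R) : CC := (pfA n * pfA n + 4 * pfY n * RtoC (a ^ 2))%C.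

Lemma poisson_scaled n a :
  (RtoC (/ INR (S n)) * poisson (pfY n) a)%C = (pfB n / pfD n (INR (S n) * sin (a / 2)))%C.
Proof.
  assert (Hn : INR (S n) <> 0) by (apply not_0_INR; lia).
  assert (Hn' : RtoC (INR (S n)) <> 0%C) by now apply RtoC_neq_0.
  rewrite poisson_closed by apply pfY_lt.
  set (y := pfY n). set (s := sin (a / 2)). set (c := RtoC (INR (S n))) in *.
  unfold pfB, pfD, pfA. fold y. fold c. rewrite Rpow_mult_distr, RtoC_mult, (RtoC_pow (INR (S n))). fold c.
  rewrite RtoC_inv by exact Hn. fold c.
  (* The inverse of 0 being 0, both sides would be 0 if the denominator vanished. *)
  destruct (Ceq_dec ((1 - y) * (1 - y) + 4 * y * RtoC (s ^ 2))%C 0) as [Z|Z].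
  - replace (c * (1 - y) * (c * (1 - y)) + 4 * y * (c ^ 2 * RtoC (s ^ 2)))%C with (c * c * ((1 - y) * (1 - y) + 4 * y * RtoC (s ^ 2)))%C by ring.
    rewrite Z. unfold Cdiv.
    assert (E0 : (/ RtoC 0)%C = RtoC 0).
    { apply injective_projections; simpl; unfold Rdiv; ring. }
    replace (c * c * 0)%C with (RtoC 0) by ring. rewrite E0. ring.
  - field. repeat split; auto.
    intros W. apply Z.
    replace (c * (1 - y) * (c * (1 - y)) + 4 * y * (c ^ 2 * RtoC (s ^ 2)))%C with (c * c * ((1 - y) * (1 - y) + 4 * y * RtoC (s ^ 2)))%C in W by ring.
    destruct (Ceq_dec ((1 - y) * (1 - y) + 4 * y * RtoC (s ^ 2))%C 0) as [V|V]; [exact V|].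
    exfalso. revert W. apply Cmult_neq_0; [apply Cmult_neq_0; auto|exact V].
Qed.

Lemma pf_den_neq_0 (b : R) : (z * z + RtoC (b ^ 2))%C <> 0%C.
Proof.
  intros E. pose proof (f_equal fst E) as E1. pose proof (f_equal snd E) as E2.
  simpl in E1, E2. assert (snd z = 0) by nra. rewrite H in E1. nra.
Qed.

Lemma pf_term_lim (a : nat -> R) (b : R) : is_lim_seq a b ->
  is_Clim (fun n => pfB n / pfD n (a n))%C (2 * z / (z * z + RtoC ((2 * b) ^ 2)))%C.
Proof.
  intros Ha. apply is_Clim_div; [apply pf_den_neq_0|exact pfB_lim|].
  unfold pfD. apply is_Clim_plus; [apply is_Clim_mult; exact pfA_lim|].
  replace (RtoC ((2 * b) ^ 2)) with (4 * 1 * RtoC (b ^ 2))%C.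
  - apply is_Clim_mult; [apply is_Clim_mult; [apply is_Clim_const|exact pfY_lim]|].
    apply is_Clim_RtoC. simpl. repeat apply is_lim_seq_mult'; auto; apply is_lim_seq_const.
  - rewrite <- !RtoC_mult. f_equal. ring.
Qed.

Lemma is_Clim_eventually_lt u l c : is_Clim u l -> Cmod l < c -> eventually (fun n => Cmod (u n) < c).
Proof.
  intros H Hc. apply is_Clim_Cmod, is_lim_seq_spec in H.
  destruct (H (mkposreal (c - Cmod l) ltac:(lra))) as [n0 H0].
  exists n0; intros n Hn. specialize (H0 n Hn). simpl in H0.
  rewrite Rminus_0_r, Rabs_pos_eq in H0 by apply Cmod_ge_0.
  replace (u n) with (u n - l + l)%C by ring. eapply Rle_lt_trans; [apply Cmod_triangle|]. lra.
Qed.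

Lemma Cmod_minus_ge a b : Cmod a - Cmod b <= Cmod (a + b)%C.
Proof.
  replace a with (a + b + - b)%C at 1 by ring.
  pose proof (Cmod_triangle (a + b)%C (- b)%C). rewrite Cmod_opp in H. lra.
Qed.

(** Write s for the scaled sine and k for [S k]. For 2k <= n + 1 the linear lower bound on the sine
    gives s >= k, because pi/3 >= 1. Once |Y| >= 1/2, the term 4 |Y| s^2 is at least 2 s^2, while
    |[pfA n]|^2 < k^2 as soon as k exceeds |z| + 1; the denominator is therefore at least k^2. The
    threshold [k0] comes from the second condition. *)
Lemma pf_dominated : exists C k0, 0 <= C /\
  eventually (fun n => forall k, (k0 <= k)%nat -> (2 * S k <= S n)%nat ->
    Cmod (pfB n / pfD n (INR (S n) * sin (2 * PI * INR (S k) / INR (S n) / 2)))%C <= C * / INR (S k) ^ 2).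
Proof.
  set (c := Cmod z + 1). pose proof (Cmod_ge_0 z) as Hz0.
  exists (2 * Cmod z + 1). destruct (nfloor_ex c) as [k0 Hk0]; [unfold c; lra|].
  exists k0. split; [lra|].
  destruct (is_Clim_eventually_lt _ _ c pfA_lim) as [n1 H1]; [unfold c; lra|].
  destruct (is_Clim_eventually_lt _ _ (2 * Cmod z + 1) pfB_lim) as [n2 H2].
  { rewrite Cmod_mult, Cmod_R, Rabs_pos_eq; lra. }
  destruct (is_Clim_eventually_lt _ _ (1 / 2) (is_Clim_minus _ _ _ _ (is_Clim_const 1) pfY_lim)) as [n3 H3].
  { replace (1 - 1)%C with (RtoC 0) by ring. rewrite Cmod_0. lra. }
  exists (n1 + n2 + n3)%nat. intros n Hn k Hk Hkn.
  specialize (H1 n ltac:(lia)). specialize (H2 n ltac:(lia)). specialize (H3 n ltac:(lia)).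
  assert (HN : 0 < INR (S n)) by (apply lt_0_INR; lia).
  assert (HK : 0 < INR (S k)) by (apply lt_0_INR; lia).
  assert (HK0 : c < INR (S k)).
  { rewrite S_INR. apply le_INR in Hk. destruct Hk0 as [_ Hk0]. lra. }
  assert (Hle : 2 * INR (S k) <= INR (S n)) by (apply le_INR in Hkn; rewrite mult_INR in Hkn; simpl (INR 2) in Hkn; lra).
  set (s := INR (S n) * sin (2 * PI * INR (S k) / INR (S n) / 2)).
  assert (Hs : INR (S k) <= s).
  { unfold s. pose proof PI2_3_2. pose proof PI_RGT_0.
    replace (2 * PI * INR (S k) / INR (S n) / 2) with (PI * INR (S k) / INR (S n)) by (field; lra).
    apply Rle_trans with (INR (S n) * (PI * INR (S k) / INR (S n) / 3)).
    - replace (INR (S n) * _) with (PI / 3 * INR (S k)) by (field; lra). nra.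
    - apply Rmult_le_compat_l; [lra|]. apply sin_lower. split.
      + apply Rmult_le_pos; [nra|]. left; now apply Rinv_0_lt_compat.
      + apply Rmult_le_reg_r with (INR (S n)); [lra|].
        replace (PI * INR (S k) / INR (S n) * INR (S n)) with (PI * INR (S k)) by (field; lra). nra. }
  assert (HY : 1 / 2 <= Cmod (pfY n)).
  { pose proof (Cmod_triangle (1 - pfY n)%C (pfY n)) as T.
    replace (1 - pfY n + pfY n)%C with (RtoC 1) in T by ring. rewrite Cmod_1 in T. lra. }
  assert (HD : INR (S k) ^ 2 <= Cmod (pfD n s)).
  { unfold pfD. rewrite Cplus_comm. eapply Rle_trans; [|apply Cmod_minus_ge].
    rewrite !Cmod_mult, !Cmod_R, (Rabs_pos_eq 4), (Rabs_pos_eq (s ^ 2)) by (lra || apply pow2_ge_0).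
    pose proof (Cmod_ge_0 (pfA n)).
    assert (Cmod (pfA n) * Cmod (pfA n) <= INR (S k) ^ 2) by nra.
    assert (INR (S k) ^ 2 <= s ^ 2) by nra.
    assert (0 <= s ^ 2) by nra.
    assert (2 * s ^ 2 <= 4 * Cmod (pfY n) * s ^ 2) by nra. lra. }
  assert (0 < INR (S k) ^ 2) by nra.
  rewrite Cmod_div by (apply Cmod_gt_0; lra).
  unfold Rdiv. apply Rmult_le_compat; [apply Cmod_ge_0|left; apply Rinv_0_lt_compat; lra|lra|].
  apply Rinv_le_contravar; lra.
Qed.

(** The finite identity is used with n = 2q(l + 1) points and frequency m = 2r(l + 1): n is even, so
    the sum folds, and m/n = r/q for every l, so the exponentials do not move. Only the kernel terms
    vary with l, and dominated convergence applies to them. *)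
Lemma partial_fractions (r q : nat) : (1 <= r <= q)%nat ->
  is_Clim (Csum (fun k => RtoC (cos (2 * PI * INR (S k) * (INR r / INR q))) *
      (2 * z / (z * z + RtoC ((2 * PI * INR (S k)) ^ 2))))%C)
    ((Cexp (- (RtoC (INR r / INR q) * z)) + Cexp (- (RtoC (1 - INR r / INR q) * z))) / (2 * (1 - Cexp (- z))) - 1 / z)%C.
Proof.
  intros Hr. set (t := INR r / INR q).
  assert (Hq : 0 < INR q) by (apply lt_0_INR; lia).
  (* [pfY] is indexed so that n + 1 is the number of points, hence the shift by one. *)
  set (phi := fun l => (2 * (q * S l) - 1)%nat).
  assert (HS : forall l, S (phi l) = (2 * (q * S l))%nat) by (intros l; unfold phi; lia).
  assert (Hphi : filterlim phi eventually eventually).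
  { apply eventually_subseq. intros l. unfold phi. nia. }
  assert (Hz0 : z <> 0%C) by (intros E; rewrite E in Hz; simpl in Hz; lra).
  destruct pf_dominated as (C & k0 & HC & n0 & Hdom).
  destruct (dominated_Csum
    (fun l k => RtoC (cos (2 * PI * INR (S k) * t)) *
        (pfB (phi l) / pfD (phi l) (INR (S (phi l)) * sin (2 * PI * INR (S k) / INR (S (phi l)) / 2))))%C
    (fun l => (q * S l - 1)%nat)
    (fun k => RtoC (cos (2 * PI * INR (S k) * t)) * (2 * z / (z * z + RtoC ((2 * PI * INR (S k)) ^ 2))))%C
    (fun k => C * / INR (S k) ^ 2) k0) as (S0 & L1 & L2).
  - intros k. apply Rmult_le_pos; [exact HC|]. left. apply Rinv_0_lt_compat. apply pow_lt. apply lt_0_INR; lia.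
  - apply ex_series_scal_inv_sqr.
  - intros K. exists K. intros n Hn. nia.
  - exists n0. intros l Hl k Hk. rewrite Cmod_mult, Cmod_R.
    assert (Rabs (cos (2 * PI * INR (S k) * t)) <= 1) by (apply Rabs_le; apply COS_bound).
    pose proof (Hdom (phi l) ltac:(unfold phi; nia) k ltac:(lia) ltac:(rewrite HS; lia)).
    set (w := (pfB _ / _)%C) in *. pose proof (Cmod_ge_0 w).
    pose proof (Rabs_pos (cos (2 * PI * INR (S k) * t))). nra.
  - intros k. apply is_Clim_mult; [apply is_Clim_const|].
    apply (is_Clim_subseq (fun n => pfB n / pfD n (INR (S n) * sin (2 * PI * INR (S k) / INR (S n) / 2)))%C _ phi Hphi).
    replace (2 * PI * INR (S k)) with (2 * (PI * INR (S k))) by ring.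
    apply pf_term_lim. eapply is_lim_seq_ext; [|apply lim_n_sin].
    intros n. simpl. do 2 f_equal. field. apply (not_0_INR (S n)). lia.
  - replace (_ - 1 / z)%C with S0; [exact L1|].
    apply (is_Clim_unique _ _ _ L2).
    assert (Hid : forall l,
      ((Cexp (- (RtoC t * z)) + Cexp (- (RtoC (1 - t) * z))) / (2 * (1 - Cexp (- z))) -
        / 2 * (pfB (phi l) / pfD (phi l) (INR (S (phi l)) * 0) +
          cis (2 * PI * INR (2 * (r * S l)) * INR (q * S l) / INR (2 * (q * S l))) * (RtoC (/ INR (S (phi l))) * poisson (pfY (phi l)) PI)))%C =
      Csum (fun k => RtoC (cos (2 * PI * INR (S k) * t)) *
        (pfB (phi l) / pfD (phi l) (INR (S (phi l)) * sin (2 * PI * INR (S k) / INR (S (phi l)) / 2))))%C (q * S l - 1)).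
    { intros l.
      assert (Hl : 0 < INR (S l)) by (apply lt_0_INR; lia).
      pose proof (poisson_half_sum (pfY (phi l)) (q * S l) (2 * (r * S l)) ltac:(nia) ltac:(nia) (pfY_lt _)) as P.
      assert (H2q : 0 < INR (S (phi l))) by (apply lt_0_INR; lia).
      assert (Ht : INR (2 * (r * S l)) / INR (S (phi l)) = t).
      { rewrite HS, !mult_INR. unfold t. simpl (INR 2). field. lra. }
      assert (Ht' : INR (2 * (q * S l) - 2 * (r * S l)) / INR (S (phi l)) = 1 - t).
      { rewrite <- Ht, minus_INR by nia. rewrite <- HS. field. lra. }
      rewrite <- HS in P. rewrite !pfY_pow in P.
      replace (S (phi l) - 2 * (r * S l))%nat with (2 * (q * S l) - 2 * (r * S l))%nat in P by (rewrite HS; lia).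
      rewrite Ht, Ht' in P.
      replace (INR (S (phi l)) / INR (S (phi l))) with 1 in P by (field; lra).
      replace (1 * z)%C with z in P by ring.
      set (Sm := Csum _ _) in P. set (Sm' := Csum _ _).
      assert (ES : Sm = (2 * Sm')%C).
      { unfold Sm, Sm'. rewrite <- Csum_scal. apply Csum_ext. intros k _.
        rewrite RtoC_mult, poisson_scaled. ring. }
      rewrite ES in P.
      rewrite Cmult_plus_distr_l, poisson_scaled in P.
      replace (0 / 2) with 0 in P by field. rewrite sin_0 in P.
      assert (HE : (1 - Cexp (- z))%C <> 0%C).
      { apply Cmod_1_minus. rewrite Cmod_Cexp, <- exp_0. apply exp_increasing. simpl. lra. }
      assert (H2 : RtoC 2 <> 0%C) by (apply RtoC_neq_0; lra).
      transitivity (/ 2 * ((Cexp (- (RtoC (1 - t) * z)) + Cexp (- (RtoC t * z))) / (1 - Cexp (- z)) -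
         (pfB (phi l) / pfD (phi l) (INR (S (phi l)) * 0) +
           cis (2 * PI * INR (2 * (r * S l)) * INR (q * S l) / INR (2 * (q * S l))) *
           (RtoC (/ INR (S (phi l))) * poisson (pfY (phi l)) PI))))%C.
      { set (D0 := pfD _ _). unfold Cdiv.
        replace (/ (2 * (1 - Cexp (- z))))%C with (/ 2 * / (1 - Cexp (- z)))%C by (field; auto). ring. }
      rewrite P, HS. set (w0 := (pfB (phi l) / pfD _ _)%C).
      field. }
    apply (is_Clim_ext _ _ _ Hid).
    apply is_Clim_minus; [apply is_Clim_const|].
    (* The unpaired terms: the one at k = 0 tends to 2z/z^2 and, halved, produces 1/z; the middle
       one tends to 0. *)
    replace (1 / z)%C with (/ 2 * (2 * z / (z * z + RtoC ((2 * 0) ^ 2)) + 0))%C.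
    2: { replace ((2 * 0) ^ 2) with 0 by ring. field. exact Hz0. }
    apply is_Clim_mult; [apply is_Clim_const|]. apply is_Clim_plus.
    + apply (is_Clim_subseq (fun n => pfB n / pfD n (INR (S n) * 0))%C _ phi Hphi).
      apply pf_term_lim. eapply is_lim_seq_ext; [|apply is_lim_seq_const]. intros; simpl; ring.
    + set (w := fun n => (RtoC (/ INR (S n)) * poisson (pfY n) PI)%C).
      assert (Hw : is_Clim w 0%C).
      { apply (is_Clim_ext (fun n => pfB n * RtoC ((/ INR (S n)) ^ 2) / ((1 - pfY n) * (1 - pfY n) + 4 * pfY n))%C).
        - intros n. unfold w. rewrite poisson_closed by apply pfY_lt. rewrite sin_PI2.
          assert (Hn : INR (S n) <> 0) by (apply not_0_INR; lia).
          unfold pfB, pfA. replace (1 ^ 2) with 1 by ring. rewrite RtoC_pow, RtoC_inv by exact Hn.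
          replace (4 * pfY n * 1)%C with (4 * pfY n)%C by ring.
          unfold Cdiv. set (i := (/ (_ + _))%C). field. now apply RtoC_neq_0.
        - replace (RtoC 0) with (2 * z * RtoC (0 ^ 2) / ((1 - 1) * (1 - 1) + 4 * 1))%C.
          + apply is_Clim_div.
            * replace ((1 - 1) * (1 - 1) + 4 * 1)%C with (RtoC 4) by ring. apply RtoC_neq_0; lra.
            * apply is_Clim_mult; [exact pfB_lim|]. apply is_Clim_RtoC.
              assert (L : is_lim_seq (fun n => / INR (S n)) 0) by (apply (is_lim_seq_incr_1 (fun n => / INR n)), is_lim_seq_inv_INR).
              simpl. repeat apply is_lim_seq_mult'; auto. apply is_lim_seq_const.
            * assert (Hm : is_Clim (fun n => 1 - pfY n)%C (1 - 1)%C) by (apply is_Clim_minus; [apply is_Clim_const|apply pfY_lim]).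
              apply is_Clim_plus; apply is_Clim_mult; auto; [apply is_Clim_const|apply pfY_lim].
          + replace (0 ^ 2) with 0 by ring. replace (2 * z * 0)%C with (RtoC 0) by ring. unfold Cdiv. ring. }
      apply is_Clim_squeeze with (fun l => Cmod (w (phi l) - 0)%C).
      * intros l. replace (cis _ * _ - 0)%C with (cis (2 * PI * INR (2 * (r * S l)) * INR (q * S l) / INR (2 * (q * S l))) * (w (phi l) - 0))%C
          by (unfold w; ring).
        rewrite Cmod_mult, Cmod_cis. lra.
      * exact (is_lim_seq_subseq _ _ phi Hphi (is_Clim_Cmod _ _ Hw)).
Qed.
End PartialFractions.

(** * Goursat's theorem on rectangles *)

Section Goursat.
Variables (P Q : R -> R -> R) (rho : R).
(** The common value [k] of dP/dy and dQ/dx says that P dx + Q dy is closed at every point of the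
    half-plane. The partial derivatives need not be continuous, which is why the proof bisects
    instead of applying Green's formula. *)
Hypothesis Hdiff : forall x y, x <= rho -> exists px k qy,
  differentiable_pt_lim P x y px k /\ differentiable_pt_lim Q x y k qy.

Lemma cont_section_x (f : R -> R -> R) x y l1 l2 :
  differentiable_pt_lim f x y l1 l2 -> continuous (fun t => f t y) x.
Proof.
  intros H. apply continuity_pt_filterlim, derivable_continuous_pt.
  exists (l1 * 1 + l2 * 0).
  apply (derivable_pt_lim_comp_2d f (fun t => t) (fun _ => y)); auto.
  - apply derivable_pt_lim_id.
  - apply derivable_pt_lim_const.
Qed.

Lemma cont_section_y (f : R -> R -> R) x y l1 l2 :
  differentiable_pt_lim f x y l1 l2 -> continuous (fun t => f x t) y.
Proof.
  intros H. apply continuity_pt_filterlim, derivable_continuous_pt.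
  exists (l1 * 0 + l2 * 1).
  apply (derivable_pt_lim_comp_2d f (fun _ => x) (fun t => t)); auto.
  - apply derivable_pt_lim_const.
  - apply derivable_pt_lim_id.
Qed.

Lemma ex_RInt_P c a b : a <= b -> b <= rho -> ex_RInt (fun x => P x c) a b.
Proof.
  intros Hab Hb. apply (@ex_RInt_continuous R_CompleteNormedModule).
  intros x Hx. rewrite Rmax_right in Hx by lra.
  destruct (Hdiff x c ltac:(lra)) as (px & k & qy & H & _).
  eapply cont_section_x; exact H.
Qed.

Lemma ex_RInt_Q x c d : x <= rho -> ex_RInt (fun y => Q x y) c d.
Proof.
  intros Hx. apply (@ex_RInt_continuous R_CompleteNormedModule).
  intros y _. destruct (Hdiff x y Hx) as (px & k & qy & _ & H).
  eapply cont_section_y; exact H.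
Qed.

(** Circulation of P dx + Q dy, counterclockwise, round the rectangle with lower left corner (a, c),
    width w and height v. *)
Definition circ (a c w v : R) : R :=
  (RInt (fun x => P x c) a (a + w) - RInt (fun x => P x (c + v)) a (a + w)) +
  (RInt (fun y => Q (a + w) y) c (c + v) - RInt (fun y => Q a y) c (c + v)).

Lemma circ_split a c w v : 0 <= w -> 0 <= v -> a + w <= rho ->
  circ a c w v = circ a c (w / 2) (v / 2) + circ (a + w / 2) c (w / 2) (v / 2) +
    (circ a (c + v / 2) (w / 2) (v / 2) + circ (a + w / 2) (c + v / 2) (w / 2) (v / 2)).
Proof.
  intros Hw Hv Ha. unfold circ.
  replace (a + w / 2 + w / 2) with (a + w) by field.
  replace (c + v / 2 + v / 2) with (c + v) by field.
  assert (CP : forall y, RInt (fun x => P x y) a (a + w) = RInt (fun x => P x y) a (a + w / 2) + RInt (fun x => P x y) (a + w / 2) (a + w)).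
  { intros y. symmetry. apply (@RInt_Chasles R_CompleteNormedModule); apply ex_RInt_P; lra. }
  assert (CQ : forall x, x <= rho -> RInt (fun y => Q x y) c (c + v) = RInt (fun y => Q x y) c (c + v / 2) + RInt (fun y => Q x y) (c + v / 2) (c + v)).
  { intros x Hx. symmetry. apply (@RInt_Chasles R_CompleteNormedModule); apply ex_RInt_Q; lra. }
  rewrite !CP, !CQ by lra. ring.
Qed.

Lemma abs_RInt_sub_const (f : R -> R) a w k M : 0 <= w -> ex_RInt f a (a + w) ->
  (forall x, a <= x <= a + w -> Rabs (f x - k) <= M) -> Rabs (RInt f a (a + w) - k * w) <= w * M.
Proof.
  intros Hw Hf HM.
  replace (RInt f a (a + w) - k * w) with (RInt (fun x => f x - k) a (a + w)).
  - eapply Rle_trans; [apply (abs_RInt_le_const _ a (a + w) M)|]; [lra| |exact HM|right; ring].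
    apply (@ex_RInt_minus R_NormedModule); [exact Hf|apply ex_RInt_const].
  - rewrite (RInt_minus f (fun _ => k)) by (exact Hf || apply ex_RInt_const).
    rewrite RInt_const. unfold minus, plus, opp, scal; simpl; unfold mult; simpl. ring.
Qed.

(** The affine part of the form has circulation zero, its contributions - k v w and k w v
    cancelling. The remainder is at most eps h at each point of the boundary, and each pair of
    opposite sides is estimated together over a length of at most h. *)
Lemma circ_small x0 y0 (eps : posreal) : x0 <= rho -> exists del : posreal,
  forall a c w v h, 0 <= w <= h -> 0 <= v <= h -> h < del -> a + w <= rho ->
    a <= x0 <= a + w -> c <= y0 <= c + v -> Rabs (circ a c w v) <= 4 * eps * (h * h).
Proof.
  intros Hx0. destruct (Hdiff x0 y0 Hx0) as (px & k & qy & HP & HQ).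
  destruct (HP eps) as [d1 H1]. destruct (HQ eps) as [d2 H2].
  assert (Hd : 0 < Rmin d1 d2) by (apply Rmin_glb_lt; apply cond_pos).
  exists (mkposreal _ Hd). simpl. intros a c w v h Hw Hv Hh Hr Ha Hc.
  assert (Hh1 : h < d1) by (eapply Rlt_le_trans; [exact Hh|apply Rmin_l]).
  assert (Hh2 : h < d2) by (eapply Rlt_le_trans; [exact Hh|apply Rmin_r]).
  pose proof (cond_pos eps) as He.
  assert (HPc : forall x y, a <= x <= a + w -> c <= y <= c + v ->
    Rabs (P x y - P x0 y0 - (px * (x - x0) + k * (y - y0))) <= eps * h).
  { intros x y Hx Hy. eapply Rle_trans; [apply H1|].
    - apply Rabs_def1; lra.
    - apply Rabs_def1; lra.
    - apply Rmult_le_compat_l; [lra|]. apply Rmax_lub; apply Rabs_le; lra. }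
  assert (HQc : forall x y, a <= x <= a + w -> c <= y <= c + v ->
    Rabs (Q x y - Q x0 y0 - (k * (x - x0) + qy * (y - y0))) <= eps * h).
  { intros x y Hx Hy. eapply Rle_trans; [apply H2|].
    - apply Rabs_def1; lra.
    - apply Rabs_def1; lra.
    - apply Rmult_le_compat_l; [lra|]. apply Rmax_lub; apply Rabs_le; lra. }
  unfold circ.
  pose proof (abs_RInt_sub_const (fun x => P x c - P x (c + v)) a w (- (k * v)) (2 * (eps * h))) as I1.
  pose proof (abs_RInt_sub_const (fun y => Q (a + w) y - Q a y) c v (k * w) (2 * (eps * h))) as I2.
  rewrite (RInt_minus (fun x => P x c) (fun x => P x (c + v))) in I1 by (apply ex_RInt_P; lra).
  rewrite (RInt_minus (fun y => Q (a + w) y) (fun y => Q a y)) in I2 by (apply ex_RInt_Q; lra).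
  unfold minus, plus, opp in I1, I2; simpl in I1, I2.
  assert (J1 : Rabs (RInt (fun x => P x c) a (a + w) + - RInt (fun x => P x (c + v)) a (a + w) - - (k * v) * w) <= w * (2 * (eps * h))).
  { apply I1; [lra| |].
    - apply (@ex_RInt_minus R_NormedModule); apply ex_RInt_P; lra.
    - intros x Hx. pose proof (HPc x c Hx ltac:(lra)) as A. pose proof (HPc x (c + v) Hx ltac:(lra)) as B.
      apply Rabs_le_between in A, B. apply Rabs_le. lra. }
  assert (J2 : Rabs (RInt (fun y => Q (a + w) y) c (c + v) + - RInt (fun y => Q a y) c (c + v) - (k * w) * v) <= v * (2 * (eps * h))).
  { apply I2; [lra| |].
    - apply (@ex_RInt_minus R_NormedModule); apply ex_RInt_Q; lra.
    - intros y Hy. pose proof (HQc (a + w) y ltac:(lra) Hy) as A. pose proof (HQc a y ltac:(lra) Hy) as B.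
      apply Rabs_le_between in A, B. apply Rabs_le. lra. }
  assert (0 <= eps * h) by nra.
  assert (w * (2 * (eps * h)) <= h * (2 * (eps * h))) by (apply Rmult_le_compat_r; lra).
  assert (v * (2 * (eps * h)) <= h * (2 * (eps * h))) by (apply Rmult_le_compat_r; lra).
  apply Rabs_le_between in J1, J2. apply Rabs_le. lra.
Qed.

Section Bisection.
Variables (a c w v : R).
Hypothesis Hw : 0 <= w.
Hypothesis Hv : 0 <= v.
Hypothesis Ha : a + w <= rho.

(** Successive lower left corners, always of a quarter carrying at least a quarter of the
    circulation. The last branch is unconditional: if the first three quarters fall short, the
    fourth cannot. *)
Fixpoint corner (n : nat) : R * R :=
  match n with
  | O => (a, c)
  | S m =>
    let x := fst (corner m) in let y := snd (corner m) in
    let w' := w / 2 ^ S m in let v' := v / 2 ^ S m in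
    let J := Rabs (circ x y (w / 2 ^ m) (v / 2 ^ m)) / 4 in
    if Rle_dec J (Rabs (circ x y w' v')) then (x, y)
    else if Rle_dec J (Rabs (circ (x + w') y w' v')) then (x + w', y)
    else if Rle_dec J (Rabs (circ x (y + v') w' v')) then (x, y + v')
    else (x + w', y + v')
  end.

Lemma half_pow u n : u / 2 ^ S n = u / 2 ^ n / 2.
Proof. simpl. field. apply pow_nonzero; lra. Qed.

Lemma div_pow_nonneg u n : 0 <= u -> 0 <= u / 2 ^ n.
Proof. intros H. apply Rmult_le_pos; [exact H|]. left; apply Rinv_0_lt_compat, pow_lt; lra. Qed.

Lemma corner_step n :
  (fst (corner n) <= fst (corner (S n)) /\ fst (corner (S n)) + w / 2 ^ S n <= fst (corner n) + w / 2 ^ n) /\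
  (snd (corner n) <= snd (corner (S n)) /\ snd (corner (S n)) + v / 2 ^ S n <= snd (corner n) + v / 2 ^ n).
Proof.
  pose proof (div_pow_nonneg w (S n) Hw). pose proof (div_pow_nonneg v (S n) Hv).
  pose proof (half_pow w n). pose proof (half_pow v n).
  cbn [corner]. cbv zeta. set (w1 := w / 2 ^ S n) in *. set (v1 := v / 2 ^ S n) in *.
  set (w0 := w / 2 ^ n) in *. set (v0 := v / 2 ^ n) in *. set (x := fst (corner n)) in *. set (y := snd (corner n)) in *. cbv zeta.
  destruct (Rle_dec _ _); [simpl fst; simpl snd; lra|].
  destruct (Rle_dec _ _); [simpl fst; simpl snd; lra|].
  destruct (Rle_dec _ _); simpl fst; simpl snd; lra.
Qed.

Lemma corner_right n : fst (corner n) + w / 2 ^ n <= rho.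
Proof.
  induction n as [|n IH]; [simpl; lra|]. destruct (corner_step n) as [[_ H] _]. lra.
Qed.

Lemma corner_circ n :
  Rabs (circ a c w v) <= 4 ^ n * Rabs (circ (fst (corner n)) (snd (corner n)) (w / 2 ^ n) (v / 2 ^ n)).
Proof.
  induction n as [|n IH].
  - simpl. rewrite !Rdiv_1_r. lra.
  - eapply Rle_trans; [exact IH|]. clear IH.
    replace (4 ^ S n) with (4 ^ n * 4) by (simpl; ring). rewrite Rmult_assoc.
    apply Rmult_le_compat_l; [left; apply pow_lt; lra|].
    pose proof (corner_right n) as Hr.
    pose proof (div_pow_nonneg w n Hw). pose proof (div_pow_nonneg v n Hv).
    pose proof (circ_split (fst (corner n)) (snd (corner n)) (w / 2 ^ n) (v / 2 ^ n) ltac:(lra) ltac:(lra) Hr) as E.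
    rewrite <- !half_pow in E.
    cbn [corner]. set (x := fst (corner n)) in *. set (y := snd (corner n)) in *. cbv zeta.
    set (w' := w / 2 ^ S n) in *. set (v' := v / 2 ^ S n) in *.
    pose proof (Rabs_triang (circ x y w' v' + circ (x + w') y w' v') (circ x (y + v') w' v' + circ (x + w') (y + v') w' v')).
    pose proof (Rabs_triang (circ x y w' v') (circ (x + w') y w' v')).
    pose proof (Rabs_triang (circ x (y + v') w' v') (circ (x + w') (y + v') w' v')).
    rewrite E.
    destruct (Rle_dec _ _); [simpl fst; simpl snd; lra|].
    destruct (Rle_dec _ _); [simpl fst; simpl snd; lra|].
    destruct (Rle_dec _ _); simpl fst; simpl snd; lra.
Qed.
End Bisection.

Lemma nested_point (x l : nat -> R) :
  (forall n, 0 <= l n) -> (forall n, x n <= x (S n) /\ x (S n) + l (S n) <= x n + l n) ->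
  exists p, forall n, x n <= p <= x n + l n.
Proof.
  intros Hl H.
  assert (Hmono : forall n k, x n <= x (n + k)%nat /\ x (n + k)%nat + l (n + k)%nat <= x n + l n).
  { intros n k. induction k as [|k IH]; [rewrite Nat.add_0_r; lra|].
    rewrite Nat.add_succ_r. specialize (H (n + k)%nat). lra. }
  assert (Hub : forall n m, x m <= x n + l n).
  { intros n m. pose proof (Hmono m n) as A. pose proof (Hmono n m) as B.
    rewrite Nat.add_comm in B. pose proof (Hl (m + n)%nat). lra. }
  destruct (completeness (fun r => exists n, r = x n)) as [p [Hp1 Hp2]].
  - exists (x O + l O). intros r [n ->]. apply Hub.
  - now exists (x O), O.
  - exists p. intros n. split; [apply Hp1; now exists n|]. apply Hp2. intros r [m ->]. apply Hub.
Qed.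

(** The n-th rectangle has circulation at most 4 eps (h/2^n)^2, and the factor 4^n accumulated by
    bisection cancels the powers of 2 exactly, leaving 4 eps h^2. *)
Lemma goursat a c w v : 0 <= w -> 0 <= v -> a + w <= rho -> circ a c w v = 0.
Proof.
  intros Hw Hv Ha.
  destruct (nested_point (fun n => fst (corner a c w v n)) (fun n => w / 2 ^ n)) as [x0 Hx].
  { intros n. now apply div_pow_nonneg. }
  { intros n. apply (corner_step a c w v Hw Hv n). }
  destruct (nested_point (fun n => snd (corner a c w v n)) (fun n => v / 2 ^ n)) as [y0 Hy].
  { intros n. now apply div_pow_nonneg. }
  { intros n. apply (corner_step a c w v Hw Hv n). }
  assert (Hx0 : x0 <= rho).
  { specialize (Hx O). pose proof (corner_right a c w v Hw Hv Ha O). lra. }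
  set (h := w + v).
  apply Rabs_eq_0. apply Rle_antisym; [|apply Rabs_pos].
  apply le_epsilon. intros e He. rewrite Rplus_0_l.
  assert (Hh : 0 <= h) by (unfold h; lra).
  (* The + 1 keeps the denominator positive for a degenerate rectangle. *)
  assert (Hden : 0 < 4 * (h * h) + 1) by nra.
  assert (Heps : 0 < e / (4 * (h * h) + 1)) by (apply Rdiv_lt_0_compat; lra).
  destruct (circ_small x0 y0 (mkposreal _ Heps) Hx0) as [del Hdel]. simpl in Hdel.
  assert (Hn : exists n, h / 2 ^ n < del).
  { assert (L : is_lim_seq (fun n => h * (/ 2) ^ n) 0).
    { replace (Finite 0) with (Rbar_mult h 0) by (simpl; f_equal; ring).
      apply is_lim_seq_scal_l. apply is_lim_seq_geom. rewrite Rabs_pos_eq; lra. }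
    apply is_lim_seq_spec in L. destruct (L del) as [n Hn]. exists n.
    specialize (Hn n (Nat.le_refl n)). rewrite Rminus_0_r in Hn.
    eapply Rle_lt_trans; [|exact Hn]. eapply Rle_trans; [|apply Rle_abs].
    right. unfold Rdiv. now rewrite pow_inv. }
  destruct Hn as [n Hn].
  eapply Rle_trans; [apply (corner_circ a c w v Hw Hv Ha n)|].
  assert (Hsmall : Rabs (circ (fst (corner a c w v n)) (snd (corner a c w v n)) (w / 2 ^ n) (v / 2 ^ n))
     <= 4 * (e / (4 * (h * h) + 1)) * (h / 2 ^ n * (h / 2 ^ n))).
  { pose proof (div_pow_nonneg w n Hw). pose proof (div_pow_nonneg v n Hv).
    assert (h / 2 ^ n = w / 2 ^ n + v / 2 ^ n) by (unfold h; field; apply pow_nonzero; lra).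
    apply Hdel; try lra.
    - apply (corner_right a c w v Hw Hv Ha n).
    - apply Hx.
    - apply Hy. }
  assert (H4 : 0 < 4 ^ n) by (apply pow_lt; lra).
  apply Rle_trans with (4 ^ n * (4 * (e / (4 * (h * h) + 1)) * (h / 2 ^ n * (h / 2 ^ n)))).
  - apply Rmult_le_compat_l; lra.
  - assert (E4 : 4 ^ n = 2 ^ n * 2 ^ n) by (rewrite <- Rpow_mult_distr; f_equal; ring).
    rewrite E4. pose proof (pow_nonzero 2 n ltac:(lra)).
    replace (_ * _) with (e * (4 * (h * h)) / (4 * (h * h) + 1)) by (field; split; lra).
    apply Rmult_le_reg_r with (4 * (h * h) + 1); [lra|].
    replace (e * (4 * (h * h)) / (4 * (h * h) + 1) * (4 * (h * h) + 1)) with (e * (4 * (h * h))) by (field; lra).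
    nra.
Qed.
End Goursat.

(** * Complex differentiability and the mean value property *)

(** Differentiability over the absolute ring of complex numbers, the form to which the library rules
    for sums, products and compositions apply. *)
Definition Cdiff (F : CC -> CC) (s : CC) : Prop :=
  exists l : CC, @is_derive C_AbsRing (AbsRing_NormedModule C_AbsRing) F s l.

Lemma is_derive_C_iff (F : CC -> CC) (s l : CC) :
  @is_derive C_AbsRing (AbsRing_NormedModule C_AbsRing) F s l <->
  forall eps : posreal, exists del : posreal, forall z : CC, Cmod (z - s)%C < del ->
    Cmod (F z - F s - (z - s) * l)%C <= eps * Cmod (z - s)%C.
Proof.
  split.
  - intros [_ H] eps. specialize (H s (fun P HP => HP) eps). exact H.
  - intros H. split; [apply is_linear_scal_l|].
    intros x Hx eps. apply (@is_filter_lim_locally_unique C_AbsRing (AbsRing_NormedModule C_AbsRing)) in Hx.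
    rewrite <- Hx. exact (H eps).
Qed.

Lemma Cdiff_of_C_differentiable_at F s : C_differentiable_at F s -> Cdiff F s.
Proof.
  intros [l H]. exists l. apply is_derive_C_iff. intros eps.
  destruct (H eps (cond_pos eps)) as (d & Hd & Hl).
  exists (mkposreal d Hd). simpl. intros z Hz.
  destruct (Ceq_dec (z - s)%C 0) as [E|E].
  - replace z with s by (replace z with (z - s + s)%C by ring; rewrite E; ring).
    replace (F s - F s - (s - s) * l)%C with (RtoC 0) by ring.
    rewrite Cmod_0. apply Rmult_le_pos; [left; apply cond_pos|apply Cmod_ge_0].
  - specialize (Hl (z - s)%C).
    replace (s + (z - s))%C with z in Hl by ring.
    assert (Hp : 0 < Cmod (z - s)%C) by now apply Cmod_gt_0.
    replace (F z - F s - (z - s) * l)%C with (((F z - F s) / (z - s) - l) * (z - s))%C by (field; auto).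
    rewrite Cmod_mult. apply Rmult_le_compat_r; [lra|]. left; apply Hl. lra.
Qed.

Lemma Cdiff_ext F G s : (forall z, F z = G z) -> Cdiff F s -> Cdiff G s.
Proof. intros E [l H]. exists l. exact (@is_derive_ext C_AbsRing (AbsRing_NormedModule C_AbsRing) F G s l E H). Qed.

Lemma Cdiff_const c s : Cdiff (fun _ => c) s.
Proof. eexists. apply (@is_derive_const C_AbsRing (AbsRing_NormedModule C_AbsRing)). Qed.

Lemma Cdiff_id s : Cdiff (fun z => z) s.
Proof. eexists. apply (@is_derive_id C_AbsRing). Qed.

Lemma Cdiff_plus F G s : Cdiff F s -> Cdiff G s -> Cdiff (fun z => F z + G z)%C s.
Proof. intros [a HF] [b HG]. eexists. exact (@is_derive_plus C_AbsRing (AbsRing_NormedModule C_AbsRing) F G s a b HF HG). Qed.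

Lemma Cdiff_mult F G s : Cdiff F s -> Cdiff G s -> Cdiff (fun z => F z * G z)%C s.
Proof. intros [a HF] [b HG]. eexists. apply (@is_derive_mult C_AbsRing F G s a b HF HG Cmult_comm). Qed.

Lemma Cdiff_opp F s : Cdiff F s -> Cdiff (fun z => - F z)%C s.
Proof.
  intros H. apply Cdiff_ext with (fun z => RtoC (-1) * F z)%C; [intros; ring|].
  apply Cdiff_mult; [apply Cdiff_const|exact H].
Qed.

Lemma Cdiff_minus F G s : Cdiff F s -> Cdiff G s -> Cdiff (fun z => F z - G z)%C s.
Proof. intros; apply Cdiff_plus; [|apply Cdiff_opp]; assumption. Qed.

Lemma Cdiff_comp F G s : Cdiff F (G s) -> Cdiff G s -> Cdiff (fun z => F (G z)) s.
Proof. intros [a HF] [b HG]. eexists. exact (@is_derive_comp C_AbsRing (AbsRing_NormedModule C_AbsRing) F G s a b HF HG). Qed.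

Lemma Cdiff_Csum (F : nat -> CC -> CC) n s :
  (forall k, (k < n)%nat -> Cdiff (F k) s) -> Cdiff (fun z => Csum (fun k => F k z) n) s.
Proof.
  induction n as [|n IH]; intros H; simpl; [apply Cdiff_const|].
  apply Cdiff_plus; [apply IH; intros; apply H; lia|apply H; lia].
Qed.

Lemma Cdiff_Cexp s : Cdiff Cexp s.
Proof.
  exists (Cexp s). apply is_derive_C_iff. intros eps.
  assert (Hc : 0 < Cmod (Cexp s) * exp 1) by (rewrite Cmod_Cexp; apply Rmult_lt_0_compat; apply exp_pos).
  assert (Hd : 0 < Rmin 1 (eps / (Cmod (Cexp s) * exp 1))).
  { apply Rmin_glb_lt; [lra|]. apply Rdiv_lt_0_compat; [apply cond_pos|exact Hc]. }
  exists (mkposreal _ Hd). simpl. intros z Hz. set (h := (z - s)%C) in *.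
  replace (Cexp z) with (Cexp s * Cexp h)%C by (rewrite <- Cexp_plus; f_equal; unfold h; ring).
  replace (Cexp s * Cexp h - Cexp s - h * Cexp s)%C with (Cexp s * (Cexp h - 1 - h))%C by ring.
  rewrite Cmod_mult. pose proof (Cexp_sub_1_sub h) as E. pose proof (Cmod_ge_0 h).
  assert (H1 : Cmod h < 1) by (eapply Rlt_le_trans; [exact Hz|apply Rmin_l]).
  assert (H2 : Cmod h < eps / (Cmod (Cexp s) * exp 1)) by (eapply Rlt_le_trans; [exact Hz|apply Rmin_r]).
  assert (exp (Cmod h) <= exp 1) by (apply exp_le; lra).
  apply Rle_trans with (Cmod (Cexp s) * (Cmod h ^ 2 * exp 1)).
  - apply Rmult_le_compat_l; [apply Cmod_ge_0|]. eapply Rle_trans; [exact E|].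
    apply Rmult_le_compat_l; [apply pow2_ge_0|assumption].
  - replace (Cmod (Cexp s) * (Cmod h ^ 2 * exp 1)) with ((Cmod (Cexp s) * exp 1 * Cmod h) * Cmod h) by ring.
    apply Rmult_le_compat_r; [lra|].
    apply Rmult_lt_compat_l with (r := Cmod (Cexp s) * exp 1) in H2; [|exact Hc].
    replace (Cmod (Cexp s) * exp 1 * (eps / (Cmod (Cexp s) * exp 1))) with (pos eps) in H2 by (field; split; [apply Rgt_not_eq, exp_pos|intros Z; rewrite Z in Hc; lra]).
    lra.
Qed.

Lemma Cdiff_inv (s : CC) : s <> 0%C -> Cdiff Cinv s.
Proof.
  intros Hs. exists (- / (s * s))%C. apply is_derive_C_iff. intros eps.
  assert (Hp : 0 < Cmod s) by now apply Cmod_gt_0.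
  set (m := Cmod s) in *.
  assert (Hd : 0 < Rmin (m / 2) (eps * (m * m * m) / 2)).
  { pose proof (cond_pos eps). apply Rmin_glb_lt; [lra|]. assert (0 < m * m * m) by (repeat apply Rmult_lt_0_compat; lra). nra. }
  exists (mkposreal _ Hd). simpl. intros z Hz. set (h := (z - s)%C) in *.
  assert (H1 : Cmod h < m / 2) by (eapply Rlt_le_trans; [exact Hz|apply Rmin_l]).
  assert (H2 : Cmod h < eps * (m * m * m) / 2) by (eapply Rlt_le_trans; [exact Hz|apply Rmin_r]).
  assert (Hzm : m / 2 <= Cmod z).
  { pose proof (Cmod_triangle z (- h)%C) as T. rewrite Cmod_opp in T.
    replace (z + - h)%C with s in T by (unfold h; ring). fold m in T. lra. }
  assert (Hz0 : z <> 0%C) by (apply Cmod_gt_0; lra).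
  replace (/ z - / s - h * - / (s * s))%C with (h * h / (z * (s * s)))%C by (unfold h; field; auto).
  assert (Hnz : (z * (s * s))%C <> 0%C) by (repeat apply Cmult_neq_0; auto).
  rewrite Cmod_div by exact Hnz. rewrite !Cmod_mult. fold m.
  pose proof (Cmod_ge_0 h).
  assert (Hden : m * m * m / 2 <= Cmod z * (m * m)) by nra.
  assert (Hm3 : 0 < m * m * m) by (repeat apply Rmult_lt_0_compat; lra).
  apply Rmult_le_reg_r with (Cmod z * (m * m)); [lra|].
  unfold Rdiv. rewrite Rmult_assoc, Rinv_l by lra.
  pose proof (cond_pos eps).
  assert (Cmod h <= eps * (Cmod z * (m * m))) by nra. nra.
Qed.

Lemma Cdiff_continuous F s : Cdiff F s -> forall eps : R, 0 < eps ->
  exists del : R, 0 < del /\ forall z, Cmod (z - s)%C < del -> Cmod (F z - F s)%C < eps.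
Proof.
  intros [l H] eps He. rewrite is_derive_C_iff in H.
  destruct (H (mkposreal 1 Rlt_0_1)) as [d Hd]. simpl in Hd. pose proof (Cmod_ge_0 l).
  exists (Rmin d (eps / (2 + Cmod l))). split.
  - apply Rmin_glb_lt; [apply cond_pos|]. apply Rdiv_lt_0_compat; lra.
  - intros z Hz. set (h := (z - s)%C) in *.
    assert (H1 : Cmod h < d) by (eapply Rlt_le_trans; [exact Hz|apply Rmin_l]).
    assert (H2 : Cmod h < eps / (2 + Cmod l)) by (eapply Rlt_le_trans; [exact Hz|apply Rmin_r]).
    specialize (Hd z H1).
    replace (F z - F s)%C with (F z - F s - h * l + h * l)%C by ring.
    eapply Rle_lt_trans; [apply Cmod_triangle|]. fold h in Hd. rewrite Cmod_mult.
    apply Rmult_lt_compat_l with (r := 2 + Cmod l) in H2; [|lra].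
    replace ((2 + Cmod l) * (eps / (2 + Cmod l))) with eps in H2 by (field; lra).
    pose proof (Cmod_ge_0 h). nra.
Qed.

(** The Cauchy-Riemann equations: both components are governed by the same complex derivative,
    whence the pairs (l1, - l2) and (l2, l1). Half of eps is taken because the modulus is at most
    twice the maximum norm. *)
Lemma Cdiff_real_parts g x y : Cdiff g (x, y) -> exists l1 l2,
  differentiable_pt_lim (fun u v => fst (g (u, v))) x y l1 (- l2) /\
  differentiable_pt_lim (fun u v => snd (g (u, v))) x y l2 l1.
Proof.
  intros [l H]. rewrite is_derive_C_iff in H. exists (fst l), (snd l).
  assert (G : forall eps : posreal, exists del : posreal, forall u v, Rabs (u - x) < del -> Rabs (v - y) < del ->
    Cmod (g (u, v) - g (x, y) - ((u, v) - (x, y)) * l)%C <= eps * Rmax (Rabs (u - x)) (Rabs (v - y))).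
  { intros eps. destruct (H (pos_div_2 eps)) as [d Hd]. exists (pos_div_2 d). intros u v Hu Hv. simpl in *.
    assert (Hm : Cmod ((u, v) - (x, y))%C <= Rabs (u - x) + Rabs (v - y)) by apply Cmod_le_sum.
    eapply Rle_trans; [apply Hd; lra|].
    pose proof (Rmax_l (Rabs (u - x)) (Rabs (v - y))). pose proof (Rmax_r (Rabs (u - x)) (Rabs (v - y))).
    pose proof (cond_pos eps). nra. }
  split; intros eps; destruct (G eps) as [d Hd]; exists d; intros u v Hu Hv;
    (eapply Rle_trans; [|apply (Hd u v Hu Hv)]).
  - eapply Rle_trans; [|apply Rabs_fst_le]. right. f_equal. simpl. ring.
  - eapply Rle_trans; [|apply Rabs_snd_le]. right. f_equal. simpl. ring.
Qed.

(* In the logarithmic coordinate w = log (z - a), the discs around a are the half-planes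
   Re w <= rho and the mean value property is Cauchy's theorem on a rectangle of height 2 PI. *)
Lemma mean_value_bound (g : CC -> CC) (rho M : R) (c : CC) :
  (forall w, fst w <= rho -> Cdiff g w) ->
  (forall x y, g (x, y + 2 * PI) = g (x, y)) ->
  (forall y, Cmod (g (rho, y)) <= M) ->
  (forall eps, 0 < eps -> exists s0, forall x y, x <= s0 -> Cmod (g (x, y) - c)%C <= eps) ->
  Cmod c <= M.
Proof.
  intros Hg Hper HM Hlim.
  destruct (Ceq_dec c 0) as [->|Hc].
  { rewrite Cmod_0. eapply Rle_trans; [apply Cmod_ge_0|apply (HM 0)]. }
  assert (Hc0 : 0 < Cmod c) by now apply Cmod_gt_0.
  apply le_epsilon. intros eps Heps.
  destruct (Hlim eps Heps) as [s0 Hs0]. set (s := Rmin s0 rho).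
  assert (Hs : s <= rho) by apply Rmin_r.
  assert (Hss : s <= s0) by apply Rmin_l.
  (* After multiplication by the conjugate of c it suffices to compare real parts: where g is close
     to c the real part is close to |c|^2, and on the edge Re w = rho it is at most |c| M. *)
  set (h := fun w => (Cconj c * g w)%C).
  set (U := fun x y => fst (h (x, y))). set (V := fun x y => snd (h (x, y))).
  assert (Hd : forall x y, x <= rho -> exists px k qy, differentiable_pt_lim V x y px k /\ differentiable_pt_lim U x y k qy).
  { intros x y Hx. destruct (Cdiff_real_parts h x y) as (l1 & l2 & A & B).
    - apply Cdiff_mult; [apply Cdiff_const|now apply Hg].
    - exists l2, l1, (- l2). split; assumption. }
  (* V dx + U dy is the imaginary part of h dw. The horizontal edges cancel by periodicity, so the
     integrals of U over the two vertical edges agree. *)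
  pose proof (goursat V U rho Hd s 0 (rho - s) (2 * PI) ltac:(lra) ltac:(pose proof PI_RGT_0; lra) ltac:(lra)) as G.
  unfold circ in G. replace (s + (rho - s)) with rho in G by ring.
  rewrite (RInt_ext (fun x => V x (0 + 2 * PI)) (fun x => V x 0)) in G.
  2: { intros x _. unfold V, h. now rewrite Hper. }
  replace (0 + 2 * PI) with (2 * PI) in G by ring.
  pose proof PI_RGT_0 as HPI.
  assert (L1 : RInt (fun y => U rho y) 0 (2 * PI) <= RInt (fun _ => Cmod c * M) 0 (2 * PI)).
  { apply RInt_le; [lra| |apply ex_RInt_const|].
    - apply (ex_RInt_Q V U rho Hd); lra.
    - intros y _. eapply Rle_trans; [apply Rle_abs|]. unfold U, h.
      eapply Rle_trans; [apply Rabs_fst_le|]. rewrite Cmod_mult, Cmod_conj.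
      apply Rmult_le_compat_l; [lra|apply HM]. }
  assert (L2 : RInt (fun _ => Cmod c * (Cmod c - eps)) 0 (2 * PI) <= RInt (fun y => U s y) 0 (2 * PI)).
  { apply RInt_le; [lra|apply ex_RInt_const| |].
    - apply (ex_RInt_Q V U rho Hd); lra.
    - intros y _. unfold U, h. specialize (Hs0 s y Hss).
      replace (Cconj c * g (s, y))%C with (c * Cconj c + Cconj c * (g (s, y) - c))%C by ring.
      rewrite <- Cmod2_conj.
      assert (A : Rabs (fst (Cconj c * (g (s, y) - c))%C) <= Cmod c * eps).
      { eapply Rle_trans; [apply Rabs_fst_le|]. rewrite Cmod_mult, Cmod_conj. apply Rmult_le_compat_l; lra. }
      apply Rabs_le_between in A.
      change (fst (RtoC (Cmod c ^ 2) + Cconj c * (g (s, y) - c))%C) with (Cmod c ^ 2 + fst (Cconj c * (g (s, y) - c))%C).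
      lra. }
  rewrite RInt_const in L1, L2. unfold scal in L1, L2; simpl in L1, L2; unfold mult in L1, L2; simpl in L1, L2.
  assert (2 * PI * (Cmod c * (Cmod c - eps)) <= 2 * PI * (Cmod c * M)) by lra.
  apply Rmult_le_reg_l in H; [|lra]. apply Rmult_le_reg_l in H; lra.
Qed.

(** * Products of rotates of a function about a point *)

Fixpoint Cprod (f : nat -> CC) (n : nat) : CC :=
  match n with O => 1%C | S m => (Cprod f m * f m)%C end.

Lemma Cmod_Cprod_le f n B : (forall k, (k < n)%nat -> Cmod (f k) <= B) -> Cmod (Cprod f n) <= B ^ n.
Proof.
  induction n as [|n IH]; intros H; simpl; [rewrite Cmod_1; lra|].
  rewrite Cmod_mult, Rmult_comm.
  apply Rmult_le_compat; try apply Cmod_ge_0; [apply H; lia|apply IH; intros; apply H; lia].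
Qed.

Lemma Cmod_Cprod_le_one f n k0 B e : (k0 < n)%nat -> (forall k, (k < n)%nat -> Cmod (f k) <= B) ->
  Cmod (f k0) <= e -> Cmod (Cprod f n) <= e * B ^ (n - 1).
Proof.
  induction n as [|n IH]; intros Hk HB He; [lia|].
  simpl Cprod. rewrite Cmod_mult. replace (S n - 1)%nat with n by lia.
  destruct (Nat.eq_dec k0 n) as [->|Hne].
  - rewrite Rmult_comm. apply Rmult_le_compat; try apply Cmod_ge_0; auto.
    apply Cmod_Cprod_le. intros; apply HB; lia.
  - replace (e * B ^ n) with (e * B ^ (n - 1) * B).
    + apply Rmult_le_compat; try apply Cmod_ge_0; [|apply HB; lia].
      apply IH; auto; lia.
    + replace n with (S (n - 1)) at 2 by lia. simpl. ring.
Qed.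

Lemma Cdiff_Cprod (F : nat -> CC -> CC) n s :
  (forall k, (k < n)%nat -> Cdiff (F k) s) -> Cdiff (fun z => Cprod (fun k => F k z) n) s.
Proof.
  induction n as [|n IH]; intros H; simpl; [apply Cdiff_const|].
  apply Cdiff_mult; [apply IH; intros; apply H; lia|apply H; lia].
Qed.

Lemma Cprod_ext f g n : (forall k, f k = g k) -> Cprod f n = Cprod g n.
Proof. intros H. induction n as [|n IH]; simpl; [easy|now rewrite IH, H]. Qed.

(* The product of the n rotates of h about a is small on the whole circle as soon as
   h is bounded on the circle and small on one arc of length 2 PI / n. *)
Lemma arc_bound (h : CC -> CC) (a : CC) (R0 B e : R) (n : nat) :
  0 < R0 -> (1 <= n)%nat ->
  (forall z, Cmod (z - a)%C <= R0 -> Cdiff h z) ->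
  (forall th, Cmod (h (a + RtoC R0 * cis th)%C) <= B) ->
  (forall th, 0 <= th <= 2 * PI / INR n -> Cmod (h (a + RtoC R0 * cis th)%C) <= e) ->
  Cmod (h a) ^ n <= e * B ^ (n - 1).
Proof.
  intros HR Hn Hd HB He.
  assert (HN : 0 < INR n) by (apply lt_0_INR; lia).
  pose proof PI_RGT_0 as HPI.
  set (arg := fun k (w : CC) => (a + Cexp (w + (0%R, (2 * PI * INR k / INR n)%R)))%C).
  set (g := fun w => Cprod (fun k => h (arg k w)) n).
  assert (Harg : forall k x y, arg k (x, y) = (a + RtoC (exp x) * cis (y + 2 * PI * INR k / INR n))%C).
  { intros. unfold arg. f_equal. unfold cis. rewrite <- Cexp_RtoC, <- Cexp_plus. f_equal.
    apply injective_projections; simpl; ring. }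
  rewrite <- Cmod_pow. apply mean_value_bound with (g := g) (rho := ln R0).
  - intros [x y] Hx. simpl in Hx. apply Cdiff_Cprod. intros k _.
    apply (Cdiff_comp h (arg k)).
    + apply Hd. rewrite Harg.
      replace (a + RtoC (exp x) * cis (y + 2 * PI * INR k / INR n) - a)%C with (RtoC (exp x) * cis (y + 2 * PI * INR k / INR n))%C by ring.
      rewrite Cmod_mult, Cmod_cis, Cmod_R, Rabs_pos_eq by (left; apply exp_pos).
      rewrite Rmult_1_r. rewrite <- (exp_ln R0) by exact HR. now apply exp_le.
    + unfold arg. apply Cdiff_plus; [apply Cdiff_const|].
      apply (Cdiff_comp Cexp); [apply Cdiff_Cexp|].
      apply Cdiff_plus; [apply Cdiff_id|apply Cdiff_const].
  - intros x y. unfold g. apply Cprod_ext. intros k. f_equal. rewrite !Harg. do 2 f_equal.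
    replace (y + 2 * PI + 2 * PI * INR k / INR n) with (y + 2 * PI * INR k / INR n + 2 * PI * IZR 1) by ring.
    rewrite cis_plus, cis_2PI_Z. ring.
  - intros y. unfold g.
    (* The angle y lies in the arc number j; the rotate of index -j modulo n carries it back to the
       arc starting at 0. *)
    set (u := INR n * y / (2 * PI)). set (j := Int_part u).
    destruct (base_Int_part u) as [Hj1 Hj2]. fold j in Hj1, Hj2.
    set (k0 := Z.to_nat ((- j) mod Z.of_nat n)).
    pose proof (Z.mod_pos_bound (- j) (Z.of_nat n) ltac:(lia)) as Hb.
    apply Cmod_Cprod_le_one with k0.
    + unfold k0. lia.
    + intros k _. rewrite Harg, exp_ln by exact HR. apply HB.
    + rewrite Harg, exp_ln by exact HR.
      pose proof (Z.div_mod (- j) (Z.of_nat n) ltac:(lia)) as E.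
      set (d := (- j / Z.of_nat n)%Z) in *.
      assert (Ek : INR k0 = - IZR j - INR n * IZR d).
      { unfold k0. rewrite (INR_IZR_INZ (Z.to_nat _)), Z2Nat.id, (INR_IZR_INZ n), <- mult_IZR, <- opp_IZR, <- minus_IZR by lia.
        f_equal. lia. }
      replace (y + 2 * PI * INR k0 / INR n) with ((y - 2 * PI * IZR j / INR n) + 2 * PI * IZR (- d))
        by (rewrite Ek, opp_IZR; field; lra).
      rewrite cis_plus, cis_2PI_Z. replace (RtoC R0 * (cis (y - 2 * PI * IZR j / INR n) * 1))%C with (RtoC R0 * cis (y - 2 * PI * IZR j / INR n))%C by ring.
      apply He.
      replace (y - 2 * PI * IZR j / INR n) with (2 * PI / INR n * (u - IZR j)) by (unfold u; field; lra).
      assert (0 < 2 * PI / INR n) by (apply Rdiv_lt_0_compat; lra).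
      split; nra.
  (* As Re w tends to minus infinity every rotate tends to h a, so the product tends to the n-th
     power of h a. *)
  - assert (Hk : forall k eps, 0 < eps -> exists s0, forall x y, x <= s0 -> Cmod (h (arg k (x, y)) - h a)%C <= eps).
    { intros k eps Heps. destruct (Cdiff_continuous h a) with (eps := eps) as (d & Hd0 & Hd1); auto.
      - apply Hd. replace (a - a)%C with (RtoC 0) by ring. rewrite Cmod_0. lra.
      - exists (ln (d / 2)). intros x y Hx. left. apply Hd1. rewrite Harg.
        replace (a + RtoC (exp x) * cis (y + 2 * PI * INR k / INR n) - a)%C with (RtoC (exp x) * cis (y + 2 * PI * INR k / INR n))%C by ring.
        rewrite Cmod_mult, Cmod_cis, Cmod_R, Rabs_pos_eq by (left; apply exp_pos).
        apply exp_le in Hx. rewrite exp_ln in Hx by lra. lra. }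
    unfold g. clear - Hk. clearbody arg. induction n as [|n IH].
    + intros eps Heps. exists 0. intros x y _. simpl. replace (1 - 1)%C with (RtoC 0) by ring. rewrite Cmod_0; lra.
    + intros eps Heps. simpl Cprod. simpl Cpow.
      set (A := Cmod (h a ^ n)%C). set (b := Cmod (h a)).
      assert (HA : 0 <= A) by apply Cmod_ge_0. assert (Hb : 0 <= b) by apply Cmod_ge_0.
      destruct (IH (eps / (2 * (b + 1)))) as [s1 H1]; [apply Rdiv_lt_0_compat; lra|].
      assert (He1 : 0 < Rmin 1 (eps / (2 * (A + 1)))) by (apply Rmin_glb_lt; [lra|apply Rdiv_lt_0_compat; lra]).
      destruct (Hk n _ He1) as [s2 H2].
      exists (Rmin s1 s2). intros x y Hx.
      specialize (H1 x y ltac:(eapply Rle_trans; [exact Hx|apply Rmin_l])).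
      specialize (H2 x y ltac:(eapply Rle_trans; [exact Hx|apply Rmin_r])).
      set (p := Cprod _ n) in *. set (v := h (arg n (x, y))) in *.
      replace (p * v - h a * h a ^ n)%C with ((p - h a ^ n) * v + h a ^ n * (v - h a))%C by ring.
      eapply Rle_trans; [apply Cmod_triangle|]. rewrite !Cmod_mult. fold A.
      assert (Hv : Cmod v <= b + 1).
      { replace v with (v - h a + h a)%C by ring. eapply Rle_trans; [apply Cmod_triangle|].
        pose proof (Rmin_l 1 (eps / (2 * (A + 1)))). unfold b. lra. }
      assert (H3 : Cmod (v - h a)%C <= eps / (2 * (A + 1))) by (eapply Rle_trans; [exact H2|apply Rmin_r]).
      assert (I1 : Cmod (p - h a ^ n)%C * Cmod v <= eps / (2 * (b + 1)) * (b + 1)).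
      { apply Rmult_le_compat; try apply Cmod_ge_0; assumption. }
      assert (I2 : A * Cmod (v - h a)%C <= A * (eps / (2 * (A + 1)))) by (apply Rmult_le_compat_l; assumption).
      replace (eps / (2 * (b + 1)) * (b + 1)) with (eps / 2) in I1 by (field; lra).
      assert (I3 : A * (eps / (2 * (A + 1))) <= eps / 2).
      { apply Rmult_le_reg_r with (2 * (A + 1)); [lra|].
        replace (A * (eps / (2 * (A + 1))) * (2 * (A + 1))) with (A * eps) by (field; lra). nra. }
      lra.
Qed.

(** * Euler-Maclaurin summation of Dirichlet series *)

Lemma C_minus_1_neq_0 (s : CC) : s <> 1%C -> (s - 1)%C <> 0%C.
Proof. intros Hs E. apply Hs. replace s with (s - 1 + 1)%C by ring. rewrite E. ring. Qed.

(** The power u^(-s), with a negative exponent. *)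
Definition npow (u : R) (s : CC) : CC := Cexp (- s * RtoC (ln u)).

(* Bernoulli polynomials divided by factorials; bern6 is shifted to vanish at 0 and 1. *)
Definition bern1 (v : R) := v - 1 / 2.
Definition bern2 (v : R) := (v ^ 2 - v + 1 / 6) / 2.
Definition bern3 (v : R) := (v ^ 3 - 3 / 2 * v ^ 2 + v / 2) / 6.
Definition bern4 (v : R) := (v ^ 4 - 2 * v ^ 3 + v ^ 2 - 1 / 30) / 24.
Definition bern5 (v : R) := (v ^ 5 - 5 / 2 * v ^ 4 + 5 / 3 * v ^ 3 - v / 6) / 120.
Definition bern6 (v : R) := (v ^ 6 - 3 * v ^ 5 + 5 / 2 * v ^ 4 - v ^ 2 / 2) / 720.

(** Euler-Maclaurin value of the sum over k >= 0 of (u + k)^(-s), with the Bernoulli corrections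
    B_2/2! = 1/12 and B_4/4! = -1/720. *)
Definition em_tail (s : CC) (u : R) : CC :=
  (npow u s * (RtoC u / (s - 1) + / 2 + s * RtoC (/ 12) * RtoC (/ u)
    - s * (s + 1) * (s + 2) * RtoC (/ 720) * RtoC (/ u) ^ 3))%C.

(** An exact tail would satisfy tail(u) = u^(-s) + tail(u + 1); this is the defect of that
    relation. *)
Definition em_err (s : CC) (u : R) : CC := (npow u s - em_tail s u + em_tail s (u + 1))%C.

(** The coefficient of u^(-s-6) in the sixth derivative of u^(-s). *)
Definition rising6 (s : CC) : CC := (s * (s + 1) * (s + 2) * (s + 3) * (s + 4) * (s + 5))%C.

(** A primitive in v of [bern6 v] times the sixth derivative of (u + v)^(-s): the boundary terms of
    repeated integration by parts, down to the primitive (u + v)^(1-s)/(1-s). Between v = 0 and v =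
    1 they assemble into the defect of [em_tail]. *)
Definition em_prim (s : CC) (u v : R) : CC :=
  let i := RtoC (/ (u + v)) in
  (npow (u + v) s *
   (RtoC (u + v) * (- / (s - 1)) + (- (1)) * RtoC (bern1 v) + (- s) * (RtoC (bern2 v) * i)
    + (- (s * (s + 1))) * (RtoC (bern3 v) * (i * i))
    + (- (s * (s + 1) * (s + 2))) * (RtoC (bern4 v) * (i * i * i))
    + (- (s * (s + 1) * (s + 2) * (s + 3))) * (RtoC (bern5 v) * (i * i * i * i))
    + (- (s * (s + 1) * (s + 2) * (s + 3) * (s + 4))) * (RtoC (bern6 v) * (i * i * i * i * i))))%C.

Lemma is_Cderive_npow s u v : 0 < u + v ->
  is_Cderive (fun v => npow (u + v) s) v (- s * RtoC (/ (u + v)) * npow (u + v) s)%C.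
Proof.
  intros H. unfold npow. eapply is_Cderive_eq.
  - apply is_Cderive_Cexp. apply is_Cderive_mult; [apply is_Cderive_const|].
    apply is_Cderive_RtoC with (l := / (u + v)). auto_derive; [exact H|field; lra].
  - cbv beta. ring.
Qed.

Lemma em_prim_derive (s : CC) u v : s <> 1%C -> 0 < u + v ->
  is_Cderive (em_prim s u) v (- rising6 s * (RtoC (bern6 v) * (- (1)) * RtoC (/ (u + v)) ^ 6 * npow (u + v) s))%C.
Proof.
  intros Hs H.
  pose proof (C_minus_1_neq_0 s Hs) as Hs1.
  assert (D1 : is_Cderive (fun v => RtoC (bern1 v)) v 1%C).
  { apply is_Cderive_RtoC. unfold bern1. auto_derive; [easy|ring]. }
  assert (D2 : is_Cderive (fun v => RtoC (bern2 v)) v (RtoC (bern1 v))).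
  { apply is_Cderive_RtoC. unfold bern2, bern1. auto_derive; [easy|field]. }
  assert (D3 : is_Cderive (fun v => RtoC (bern3 v)) v (RtoC (bern2 v))).
  { apply is_Cderive_RtoC. unfold bern3, bern2. auto_derive; [easy|field]. }
  assert (D4 : is_Cderive (fun v => RtoC (bern4 v)) v (RtoC (bern3 v))).
  { apply is_Cderive_RtoC. unfold bern4, bern3. auto_derive; [easy|field]. }
  assert (D5 : is_Cderive (fun v => RtoC (bern5 v)) v (RtoC (bern4 v))).
  { apply is_Cderive_RtoC. unfold bern5, bern4. auto_derive; [easy|field]. }
  assert (D6 : is_Cderive (fun v => RtoC (bern6 v)) v (RtoC (bern5 v))).
  { apply is_Cderive_RtoC. unfold bern6, bern5. auto_derive; [easy|field]. }
  assert (Di : is_Cderive (fun v => RtoC (/ (u + v))) v (- (RtoC (/ (u + v)) * RtoC (/ (u + v))))%C).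
  { rewrite <- RtoC_mult, <- RtoC_opp. apply is_Cderive_RtoC. auto_derive; [lra|field; lra]. }
  assert (Dt : is_Cderive (fun v => RtoC (u + v)) v 1%C).
  { apply is_Cderive_RtoC. auto_derive; [easy|ring]. }
  pose proof (is_Cderive_npow s u v H) as Dn.
  assert (Et : RtoC (u + v) = (/ RtoC (/ (u + v)))%C).
  { rewrite <- RtoC_inv by (apply Rinv_neq_0_compat; lra). f_equal. field. lra. }
  assert (Hi : RtoC (/ (u + v)) <> 0%C) by (apply RtoC_neq_0, Rinv_neq_0_compat; lra).
  unfold em_prim. cbv zeta.
  eapply is_Cderive_eq.
  (* The derivative is read off the syntactic shape of [em_prim]; consecutive terms then telescope
     because each of the polynomials has the preceding one as its derivative. *)
  - repeat match goal with
    | |- is_Cderive (fun v => (@?f v * @?g v)%C) _ _ => apply (is_Cderive_mult f g)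
    | |- is_Cderive (fun v => (@?f v + @?g v)%C) _ _ => apply (is_Cderive_plus f g)
    | |- is_Cderive (fun v => RtoC (bern1 v)) _ _ => exact D1
    | |- is_Cderive (fun v => RtoC (bern2 v)) _ _ => exact D2
    | |- is_Cderive (fun v => RtoC (bern3 v)) _ _ => exact D3
    | |- is_Cderive (fun v => RtoC (bern4 v)) _ _ => exact D4
    | |- is_Cderive (fun v => RtoC (bern5 v)) _ _ => exact D5
    | |- is_Cderive (fun v => RtoC (bern6 v)) _ _ => exact D6
    | |- is_Cderive (fun v => RtoC (/ (u + v))) _ _ => exact Di
    | |- is_Cderive (fun v => RtoC (u + v)) _ _ => exact Dt
    | |- is_Cderive (fun v => npow (u + v) s) _ _ => exact Dn
    | |- is_Cderive (fun v => ?c) _ _ => apply (is_Cderive_const c)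
    end.
  - cbv beta. rewrite Et. unfold rising6.
    set (i := RtoC (/ (u + v))) in *. set (e := npow (u + v) s).
    generalize (RtoC (bern1 v)) (RtoC (bern2 v)) (RtoC (bern3 v)) (RtoC (bern4 v)) (RtoC (bern5 v)) (RtoC (bern6 v)).
    intros b1 b2 b3 b4 b5 b6. field. auto.
Qed.

Lemma em_err_prim s u : 0 < u -> em_err s u = (- (em_prim s u 1 - em_prim s u 0))%C.
Proof.
  intros Hu. unfold em_err, em_prim, em_tail. cbv zeta. rewrite Rplus_0_r.
  assert (B : (bern1 0 = - / 2 /\ bern1 1 = / 2) /\ (bern2 0 = / 12 /\ bern2 1 = / 12) /\
    (bern3 0 = 0 /\ bern3 1 = 0) /\ (bern4 0 = - / 720 /\ bern4 1 = - / 720) /\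
    (bern5 0 = 0 /\ bern5 1 = 0) /\ (bern6 0 = 0 /\ bern6 1 = 0)).
  { unfold bern1, bern2, bern3, bern4, bern5, bern6. repeat split; field. }
  destruct B as ((-> & ->) & (-> & ->) & (-> & ->) & (-> & ->) & (-> & ->) & (-> & ->)).
  rewrite !RtoC_opp.
  replace (/ RtoC 2)%C with (RtoC (/ 2)) by (rewrite RtoC_inv; [reflexivity|lra]).
  assert (E : RtoC 1 = (RtoC (/ 2) + RtoC (/ 2))%C) by (rewrite <- RtoC_plus; f_equal; field).
  generalize dependent (npow (u + 1) s). intros e1. generalize (npow u s). intros e0.
  generalize (RtoC u) (RtoC (u + 1)) (RtoC (/ u)) (RtoC (/ (u + 1))) (RtoC (/ 12)) (RtoC (/ 720)).
  intros t0 t1 i0 i1 c1 c2. unfold Cdiv.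
  generalize ((/ (s - 1))%C). intros k.
  transitivity (e0 * (RtoC (/ 2) + RtoC (/ 2)) -
      e0 * (t0 * k + RtoC (/ 2) + s * c1 * i0 - s * (s + 1) * (s + 2) * c2 * i0 ^ 3) +
      e1 * (t1 * k + RtoC (/ 2) + s * c1 * i1 - s * (s + 1) * (s + 2) * c2 * i1 ^ 3))%C.
  { rewrite <- E. ring. }
  ring.
Qed.

Lemma bern6_bound v : 0 <= v <= 1 -> Rabs (bern6 v) <= 1.
Proof.
  intros Hv. unfold bern6.
  assert (H : forall n, 0 <= v ^ n <= 1).
  { intros n. split; [apply pow_le; lra|]. rewrite <- (pow1 n). apply pow_incr. lra. }
  pose proof (H 2%nat). pose proof (H 4%nat). pose proof (H 5%nat). pose proof (H 6%nat).
  apply Rabs_le. lra.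
Qed.

Lemma Cmod_npow u s : Cmod (npow u s) = exp (- fst s * ln u).
Proof. unfold npow. rewrite Cmod_Cexp. f_equal. simpl. ring. Qed.

(** The integrand is of size (u + v)^(-Re s - 6), so Re s >= -4 leaves the summable u^(-2). Six
    orders of summation are chosen so that this half-plane contains discs of radius below 3 about
    points of real part -1. *)
Lemma em_err_bound (s : CC) u : s <> 1%C -> -4 <= fst s -> 1 <= u ->
  Cmod (em_err s u) <= Cmod (rising6 s) / u ^ 2.
Proof.
  intros Hs Hre Hu. rewrite em_err_prim by lra. rewrite Cmod_opp.
  eapply Rle_trans; [apply (C_mean_value (em_prim s u)
    (fun v => - rising6 s * (RtoC (bern6 v) * (- (1)) * RtoC (/ (u + v)) ^ 6 * npow (u + v) s))%C 0 1 (Cmod (rising6 s) / u ^ 2) ltac:(lra))|right; ring].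
  - intros v Hv. apply em_prim_derive; [exact Hs|lra].
  - intros v Hv. rewrite !Cmod_mult, !Cmod_opp, Cmod_1, Cmod_pow, !Cmod_R, Cmod_npow.
    pose proof (bern6_bound v Hv) as Hb. pose proof (Rabs_pos (bern6 v)).
    set (t := u + v). assert (Ht : u <= t) by (unfold t; lra).
    assert (Hti : 0 < / t <= / u) by (split; [apply Rinv_0_lt_compat|apply Rinv_le_contravar]; lra).
    rewrite (Rabs_pos_eq (/ t)) by lra.
    assert (He : exp (- fst s * ln t) <= t ^ 4).
    { replace (t ^ 4) with (exp (4 * ln t)).
      - apply exp_le. apply Rmult_le_compat_r; [|lra].
        rewrite <- ln_1. apply ln_le; lra.
      - replace (4 * ln t) with (INR 4 * ln t) by (simpl; ring).
        rewrite <- ln_pow by lra. apply exp_ln. apply pow_lt; lra. }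
    pose proof (exp_pos (- fst s * ln t)).
    unfold Rdiv. apply Rmult_le_compat_l; [apply Cmod_ge_0|].
    apply Rle_trans with (1 * 1 * (/ t) ^ 6 * t ^ 4).
    + assert (0 <= (/ t) ^ 6) by (apply pow_le; lra).
      apply Rmult_le_compat; [|lra| |exact He].
      * apply Rmult_le_pos; [lra|assumption].
      * apply Rmult_le_compat_r; [assumption|lra].
    + replace (1 * 1 * (/ t) ^ 6 * t ^ 4) with (/ t * / t) by (field; lra).
      replace (/ u ^ 2) with (/ u * / u) by (field; lra). nra.
Qed.

(** Comparison with the integral: the primitive y^(1 - sigma)/(1 - sigma) is negative, so the
    partial sums are bounded by minus its value at 1. *)
Lemma ex_series_npow (sigma : R) : 1 < sigma -> ex_series (fun k => exp (- sigma * ln (INR (k + 1)))).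
Proof.
  intros Hs. apply ex_series_incr_1.
  set (a := fun k => exp (- sigma * ln (INR (S k + 1)))).
  set (F := fun y => exp ((1 - sigma) * ln y) / (1 - sigma)).
  assert (Ha : forall n, Rsum a n <= F (INR (n + 1)) - F 1).
  { induction n as [|n IH]; [simpl; unfold F; lra|]. simpl Rsum.
    assert (Hp : 0 < INR (n + 1)) by (apply lt_0_INR; lia).
    assert (Hn : INR (S n + 1) = INR (n + 1) + 1) by (rewrite <- S_INR; f_equal).
    destruct (MVT_gen F (INR (n + 1)) (INR (S n + 1)) (fun y => exp (- sigma * ln y))) as (c & Hc & E).
    - rewrite Hn, Rmin_left, Rmax_right by lra. intros y Hy. unfold F. auto_derive; [lra|].
      replace (- sigma * ln y) with ((1 - sigma) * ln y + - ln y) by ring.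
      rewrite exp_plus, exp_Ropp, exp_ln by lra. field. lra.
    - rewrite Hn, Rmin_left, Rmax_right by lra. intros y Hy.
      apply continuity_pt_filterlim. apply (ex_derive_continuous F). unfold F. auto_derive. lra.
    - rewrite Hn, Rmin_left, Rmax_right in Hc by lra. rewrite Hn in E at 2.
      assert (a n <= exp (- sigma * ln c)).
      { unfold a. apply exp_le. rewrite Hn. assert (ln c <= ln (INR (n + 1) + 1)) by (apply ln_le; lra). nra. }
      lra. }
  assert (HF : forall y, F y <= 0).
  { intros y. unfold F. pose proof (exp_pos ((1 - sigma) * ln y)).
    assert (/ (1 - sigma) < 0) by (apply Rinv_lt_0_compat; lra). unfold Rdiv. nra. }
  destruct (ex_finite_lim_seq_incr (Rsum a) (- F 1)) as [l Hl].
  - intros n. simpl. pose proof (exp_pos (- sigma * ln (INR (S n + 1)))). unfold a at 3. lra.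
  - intros n. specialize (Ha n). specialize (HF (INR (n + 1))). lra.
  - exists l. now apply is_series_Rsum.
Qed.

Lemma em_tail_lim s (w : R) : 1 < fst s -> 0 <= w -> is_Clim (fun M => em_tail s (INR M + w)) 0%C.
Proof.
  intros Hs Hw.
  assert (Hs1 : (s - 1)%C <> 0%C) by (intros E; apply (f_equal fst) in E; simpl in E; lra).
  assert (L : forall b : R, b < 0 -> is_lim_seq (fun M => exp (b * ln (INR M + w))) 0).
  { intros b Hb. apply (is_lim_comp_seq exp (fun M => b * ln (INR M + w)) m_infty 0); [apply is_lim_exp_m|now exists O|].
    replace m_infty with (Rbar_mult b p_infty).
    - apply is_lim_seq_scal_l. apply (is_lim_comp_seq ln (fun M => INR M + w) p_infty p_infty); [apply is_lim_ln_p|now exists O|].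
      apply is_lim_seq_plus with p_infty w; [apply is_lim_seq_INR|apply is_lim_seq_const|reflexivity].
    - apply is_Rbar_mult_unique. apply is_Rbar_mult_sym. now apply is_Rbar_mult_p_infty_neg. }
  set (A := Cmod (/ (s - 1))%C). set (B := 1 + Cmod s + Cmod (s * (s + 1) * (s + 2))%C).
  assert (HA : 0 <= A) by apply Cmod_ge_0.
  assert (HB : 1 <= B) by (unfold B; pose proof (Cmod_ge_0 s); pose proof (Cmod_ge_0 (s * (s + 1) * (s + 2))%C); lra).
  apply is_Clim_eq with (0 + 0)%C; [|ring].
  assert (Hv : is_lim_seq (fun M => A * exp ((1 - fst s) * ln (INR M + w)) + B * exp (- fst s * ln (INR M + w))) 0).
  { replace (Finite 0) with (Finite (A * 0 + B * 0)) by (f_equal; ring).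
    apply is_lim_seq_plus'; apply is_lim_seq_mult'; try apply is_lim_seq_const; apply L; lra. }
  assert (Hb : forall M, (1 <= M)%nat -> Cmod (em_tail s (INR M + w)) <=
     A * exp ((1 - fst s) * ln (INR M + w)) + B * exp (- fst s * ln (INR M + w))).
  { intros M HM. set (u := INR M + w).
    assert (Hu : 1 <= u) by (unfold u; apply le_INR in HM; simpl in HM; lra).
    unfold em_tail. rewrite Cmod_mult, Cmod_npow.
    replace ((1 - fst s) * ln u) with (- fst s * ln u + ln u) by ring.
    rewrite exp_plus, exp_ln by lra.
    pose proof (exp_pos (- fst s * ln u)) as He.
    assert (Hi : 0 < / u <= 1) by (split; [apply Rinv_0_lt_compat; lra|rewrite <- Rinv_1; apply Rinv_le_contravar; lra]).
    apply Rle_trans with (exp (- fst s * ln u) * (u * A + B)); [|right; ring].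
    apply Rmult_le_compat_l; [lra|].
    unfold Cminus.
    eapply Rle_trans; [apply Cmod_triangle|].
    eapply Rle_trans; [apply Rplus_le_compat_r, Cmod_triangle|].
    eapply Rle_trans; [apply Rplus_le_compat_r, Rplus_le_compat_r, Cmod_triangle|].
    rewrite Cmod_opp. unfold Cdiv. rewrite !(Cmod_mult _ (RtoC _)), !(Cmod_mult (RtoC u)), (Cmod_mult _ (_ ^ 3)), Cmod_pow, !(Cmod_mult _ (RtoC _)), !Cmod_R.
    rewrite (Rabs_pos_eq u), (Rabs_pos_eq (/ u)), (Rabs_pos_eq (/ 12)), (Rabs_pos_eq (/ 720)) by lra.
    replace (/ 2)%C with (RtoC (/ 2)) by (rewrite RtoC_inv; [reflexivity|lra]).
    rewrite Cmod_R, (Rabs_pos_eq (/ 2)) by lra.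
    change (Cmod (/ (s + - (1)))%C) with A. unfold B.
    pose proof (Cmod_ge_0 s). pose proof (Cmod_ge_0 (s * (s + 1) * (s + 2))%C).
    assert (0 < (/ u) ^ 3 <= 1) by (split; [apply pow_lt; lra|rewrite <- (pow1 3); apply pow_incr; lra]).
    nra. }
  replace (0 + 0)%C with (RtoC 0) by ring.
  (* The estimate asks for an argument of at least 1, hence for M >= 1; the sequence is reindexed
     accordingly. *)
  apply (is_Clim_ext_loc (fun M => em_tail s (INR (M - 1 + 1) + w))).
  { exists 1%nat. intros n Hn. do 3 f_equal. lia. }
  apply is_Clim_subseq with (phi := fun M => (M - 1)%nat) (u := fun M => em_tail s (INR (M + 1) + w)).
  { intros P [n0 H0]. exists (n0 + 1)%nat. intros n Hn. apply H0. lia. }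
  apply is_Clim_squeeze with (fun M => A * exp ((1 - fst s) * ln (INR (M + 1) + w)) + B * exp (- fst s * ln (INR (M + 1) + w))).
  - intros n. replace (em_tail s (INR (n + 1) + w) - 0)%C with (em_tail s (INR (n + 1) + w)) by ring. apply Hb. lia.
  - apply (is_lim_seq_subseq (fun M => A * exp ((1 - fst s) * ln (INR M + w)) + B * exp (- fst s * ln (INR M + w))) 0 (fun M => (M + 1)%nat)).
    + intros P [n0 H0]. exists n0. intros n Hn. apply H0. lia.
    + exact Hv.
Qed.

(** * The value L(-1, chi) *)

Ltac cdiff :=
  repeat match goal with
  | |- Cdiff (fun z => z) _ => apply Cdiff_id
  | |- Cdiff (fun z => ?c) _ => apply (Cdiff_const c)
  | |- Cdiff (fun z => (@?f z * @?g z)%C) _ => apply (Cdiff_mult f g)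
  | |- Cdiff (fun z => (@?f z + @?g z)%C) _ => apply (Cdiff_plus f g)
  | |- Cdiff (fun z => (@?f z - @?g z)%C) _ => apply (Cdiff_minus f g)
  | |- Cdiff (fun z => (- @?f z)%C) _ => apply (Cdiff_opp f)
  end.

Lemma Cdiff_npow u s : Cdiff (npow u) s.
Proof.
  unfold npow. apply (Cdiff_comp Cexp); [apply Cdiff_Cexp|cdiff].
Qed.

Lemma Cdiff_em_tail u (s : CC) : s <> 1%C -> Cdiff (fun s => em_tail s u) s.
Proof.
  intros Hs. unfold em_tail, Cdiv. apply Cdiff_mult; [apply Cdiff_npow|]. cdiff.
  apply (Cdiff_comp Cinv (fun s => s - 1)%C); [apply Cdiff_inv, C_minus_1_neq_0, Hs|cdiff].
Qed.

Lemma sum_inv_sqr_le M n : (2 <= M)%nat -> Rsum (fun k => / INR (M + k) ^ 2) n <= / INR (M - 1).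
Proof.
  intros HM.
  assert (H : Rsum (fun k => / INR (M + k) ^ 2) n <= / INR (M - 1) - / INR (M - 1 + n)).
  { induction n as [|n IH]; [rewrite Nat.add_0_r; simpl; lra|]. cbn [Rsum].
    assert (0 < INR (M - 1 + n)) by (apply lt_0_INR; lia).
    assert (E : INR (M + n) = INR (M - 1 + n) + 1) by (rewrite <- S_INR; f_equal; lia).
    assert (E' : INR (M - 1 + S n) = INR (M + n)) by (f_equal; lia).
    rewrite E', E.
    set (y := INR (M - 1 + n)) in *.
    assert (/ (y + 1) ^ 2 <= / y - / (y + 1)).
    { apply Rminus_le_0. replace (_ - _) with (/ (y * (y + 1) ^ 2)) by (field; lra).
      left. apply Rinv_0_lt_compat. nra. }
    lra. }
  assert (0 < / INR (M - 1 + n)).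
  { apply Rinv_0_lt_compat, lt_0_INR. lia. }
  lra.
Qed.

Section LValue.
Variables (q : nat) (chi : Z -> CC) (L : CC -> CC).
Hypothesis Hq : (1 <= q)%nat.
Hypothesis Hper : forall n : Z, chi (n + Z.of_nat q)%Z = chi n.
Hypothesis Hbound : forall n : Z, Cmod (chi n) <= 1.
Hypothesis HL : L_continuation chi L.

Let chin (n : nat) : CC := chi (Z.of_nat (n + 1)).

Lemma chin_shift M r : chin (q * M + r) = chin r.
Proof.
  induction M as [|M IH]; [now rewrite Nat.mul_0_r|].
  rewrite <- IH. unfold chin. rewrite <- (Hper (Z.of_nat (q * M + r + 1))), Nat.mul_succ_r. f_equal. lia.
Qed.

(** What is left of L after the first q M terms and the Euler-Maclaurin tails of the q residue
    classes. Writing n = q (m + (r + 1)/q) turns each class into q^(-s) times a tail starting at M +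
    (r + 1)/q. *)
Definition em_rem (M : nat) (s : CC) : CC :=
  (L s - Csum (fun n => chin n * npow (INR (n + 1)) s) (q * M)
     - npow (INR q) s * Csum (fun r => chin r * em_tail s (INR M + INR (r + 1) / INR q)) q)%C.

Lemma INR_q_pos : 0 < INR q.
Proof. apply lt_0_INR; lia. Qed.

(** The q terms added to the partial sum are those that exact tails would lose, so only the defects
    [em_err] remain and [L] drops out of the difference. Bounds on the dependence on M therefore
    hold also where [L] is known only as a continuation. *)
Lemma em_rem_step M s :
  em_rem (S M) s = (em_rem M s - npow (INR q) s * Csum (fun r => chin r * em_err s (INR M + INR (r + 1) / INR q)) q)%C.
Proof.
  pose proof INR_q_pos as Hq0.
  unfold em_rem. replace (q * S M)%nat with (q * M + q)%nat by lia. rewrite Csum_app.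
  rewrite (Csum_ext (fun k => chin (q * M + k) * npow (INR (q * M + k + 1)) s)%C
     (fun r => npow (INR q) s * (chin r * npow (INR M + INR (r + 1) / INR q) s))%C).
  - rewrite Csum_scal.
    rewrite (Csum_ext (fun r => chin r * em_err s (INR M + INR (r + 1) / INR q))%C
      (fun r => chin r * npow (INR M + INR (r + 1) / INR q) s +
        ((- (1)) * (chin r * em_tail s (INR M + INR (r + 1) / INR q)) +
         chin r * em_tail s (INR (S M) + INR (r + 1) / INR q)))%C).
    + rewrite !Csum_plus, Csum_scal. ring.
    + intros r _. unfold em_err. rewrite S_INR.
      replace (INR M + 1 + INR (r + 1) / INR q) with (INR M + INR (r + 1) / INR q + 1) by ring. ring.
  - intros r _. rewrite chin_shift.
    assert (Hr : 0 < INR M + INR (r + 1) / INR q).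
    { pose proof (pos_INR M). assert (0 < INR (r + 1) / INR q) by (apply Rdiv_lt_0_compat; [apply lt_0_INR; lia|exact Hq0]). lra. }
    replace (INR (q * M + r + 1)) with (INR q * (INR M + INR (r + 1) / INR q)).
    + unfold npow at 1. rewrite ln_mult by assumption. rewrite RtoC_plus, Cmult_plus_distr_l, Cexp_plus.
      fold (npow (INR q) s). fold (npow (INR M + INR (r + 1) / INR q) s). ring.
    + rewrite <- Nat.add_assoc, (plus_INR (q * M)), mult_INR. field. lra.
Qed.

Definition rem_scale (s : CC) : R := INR q * Cmod (npow (INR q) s) * Cmod (rising6 s).

Lemma rem_scale_nonneg s : 0 <= rem_scale s.
Proof.
  unfold rem_scale. pose proof INR_q_pos.
  repeat apply Rmult_le_pos; try apply Cmod_ge_0; lra.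
Qed.

Lemma em_rem_diff M n (s : CC) : (1 <= M)%nat -> s <> 1%C -> -4 <= fst s ->
  Cmod (em_rem (M + n) s - em_rem M s)%C <= rem_scale s * Rsum (fun k => / INR (M + k) ^ 2) n.
Proof.
  intros HM Hs Hre. induction n as [|n IH].
  - rewrite Nat.add_0_r. replace (em_rem M s - em_rem M s)%C with (RtoC 0) by ring. rewrite Cmod_0. simpl. lra.
  - rewrite Nat.add_succ_r, em_rem_step. cbn [Rsum].
    set (d := (npow (INR q) s * _)%C).
    replace (em_rem (M + n) s - d - em_rem M s)%C with ((em_rem (M + n) s - em_rem M s) + - d)%C by ring.
    eapply Rle_trans; [apply Cmod_triangle|]. rewrite Cmod_opp, Rmult_plus_distr_l.
    apply Rplus_le_compat; [exact IH|].
    unfold d. rewrite Cmod_mult. unfold rem_scale.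
    assert (HMn : 0 < INR (M + n)) by (apply lt_0_INR; lia).
    apply Rle_trans with (Cmod (npow (INR q) s) * (INR q * (Cmod (rising6 s) * / INR (M + n) ^ 2))); [|right; ring].
    apply Rmult_le_compat_l; [apply Cmod_ge_0|].
    eapply Rle_trans; [apply Cmod_Csum|].
    replace (INR q * (Cmod (rising6 s) * / INR (M + n) ^ 2)) with (Rsum (fun _ => Cmod (rising6 s) * / INR (M + n) ^ 2) q).
    + apply Rsum_le. intros r _. rewrite Cmod_mult.
      assert (Hp : 0 < INR (r + 1) / INR q) by (apply Rdiv_lt_0_compat; [apply lt_0_INR; lia|apply INR_q_pos]).
      assert (H1 : 1 <= INR (M + n)) by (apply (le_INR 1); lia).
      eapply Rle_trans; [apply Rmult_le_compat; [apply Cmod_ge_0|apply Cmod_ge_0|apply Hbound|apply em_err_bound; auto; lra]|].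
      rewrite Rmult_1_l. unfold Rdiv at 1. apply Rmult_le_compat_l; [apply Cmod_ge_0|].
      apply Rinv_le_contravar; [apply pow_lt; lra|]. apply pow_incr. lra.
    + clear. induction q as [|m IHm]; [simpl; ring|]. rewrite S_INR. cbn [Rsum]. rewrite IHm. ring.
Qed.

Lemma em_rem_diff_1 M (s : CC) : (1 <= M)%nat -> s <> 1%C -> -4 <= fst s ->
  Cmod (em_rem M s - em_rem 1 s)%C <= 2 * rem_scale s.
Proof.
  intros HM Hs Hre. replace M with (1 + (M - 1))%nat at 1 by lia.
  eapply Rle_trans; [apply em_rem_diff; auto|]. rewrite Rmult_comm.
  apply Rmult_le_compat_r; [apply rem_scale_nonneg|].
  destruct (M - 1)%nat as [|n]; [simpl; lra|]. rewrite Rsum_shift.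
  rewrite (Rsum_ext _ (fun k => / INR (2 + k) ^ 2)) by (intros; do 3 f_equal; lia).
  pose proof (sum_inv_sqr_le 2 n ltac:(lia)) as H. simpl (2 - 1)%nat in H. simpl (INR 1) in *.
  simpl (1 + 0)%nat. simpl (INR 1). lra.
Qed.

Lemma em_rem_lim (s : CC) : 1 < fst s -> is_Clim (fun M => em_rem M s) 0%C.
Proof.
  intros Hs. destruct HL as [_ HLs]. pose proof INR_q_pos as Hq0.
  unfold em_rem. apply is_Clim_eq with (L s - L s - npow (INR q) s * Csum (fun _ => 0%C) q)%C;
    [|rewrite Csum_0; ring].
  apply is_Clim_minus; [apply is_Clim_minus; [apply is_Clim_const|]|].
  - assert (Hterm : forall n, Cmod (chin n * npow (INR (n + 1)) s)%C <= exp (- fst s * ln (INR (n + 1)))).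
    { intros n. rewrite Cmod_mult, Cmod_npow.
      rewrite <- Rmult_1_l. apply Rmult_le_compat_r; [left; apply exp_pos|apply Hbound]. }
    pose proof (ex_series_npow (fst s) Hs) as Hex.
    assert (E1 : ex_series (fun n => fst (chin n * npow (INR (n + 1)) s)%C)).
    { eapply ex_series_dominated; [|exact Hex]. intros n. eapply Rle_trans; [apply Rabs_fst_le|apply Hterm]. }
    assert (E2 : ex_series (fun n => snd (chin n * npow (INR (n + 1)) s)%C)).
    { eapply ex_series_dominated; [|exact Hex]. intros n. eapply Rle_trans; [apply Rabs_snd_le|apply Hterm]. }
    apply Series_correct, is_series_Rsum in E1. apply Series_correct, is_series_Rsum in E2.
    rewrite (HLs s Hs).
    apply (is_Clim_subseq (Csum (fun n => chin n * npow (INR (n + 1)) s)%C) _ (fun M => (q * M)%nat)).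
    + intros P [n0 H0]. exists n0. intros n Hn. apply H0. nia.
    + split; simpl.
      * eapply is_lim_seq_ext; [|exact E1]. intros n. now rewrite fst_Csum.
      * eapply is_lim_seq_ext; [|exact E2]. intros n. now rewrite snd_Csum.
  - apply is_Clim_mult; [apply is_Clim_const|].
    apply (is_Clim_Csum (fun M r => chin r * em_tail s (INR M + INR (r + 1) / INR q))%C).
    intros r _. apply is_Clim_eq with (chin r * 0)%C; [|ring].
    apply is_Clim_mult; [apply is_Clim_const|]. apply em_tail_lim; [exact Hs|].
    left. apply Rdiv_lt_0_compat; [apply lt_0_INR; lia|exact Hq0].
Qed.

(** For Re s > 1 the remainder tends to 0 as the cut-off grows, so it is controlled by the sum of
    all later steps. *)
Lemma em_rem_right M (s : CC) : (2 <= M)%nat -> 1 < fst s -> Cmod (em_rem M s) <= rem_scale s / INR (M - 1).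
Proof.
  intros HM Hs.
  assert (Hs1 : s <> 1%C) by (intros E; rewrite E in Hs; simpl in Hs; lra).
  assert (Hlim : is_Clim (fun n => em_rem M s - em_rem (M + n) s)%C (em_rem M s - 0)%C).
  { apply is_Clim_minus; [apply is_Clim_const|].
    apply (is_Clim_subseq (fun n => em_rem n s) _ (fun n => (M + n)%nat)); [|now apply em_rem_lim].
    intros P [n0 H0]. exists n0. intros n Hn. apply H0. lia. }
  replace (em_rem M s) with (em_rem M s - 0)%C by ring.
  apply (is_Clim_bound _ _ _ Hlim). exists O. intros n _.
  replace (em_rem M s - em_rem (M + n) s)%C with (- (em_rem (M + n) s - em_rem M s))%C by ring.
  rewrite Cmod_opp. eapply Rle_trans; [apply em_rem_diff; auto; [lia|lra]|].
  apply Rmult_le_compat_l; [apply rem_scale_nonneg|]. now apply sum_inv_sqr_le.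
Qed.

Lemma Cdiff_em_rem M (s : CC) : s <> 1%C -> Cdiff (em_rem M) s.
Proof.
  intros Hs. unfold em_rem. destruct HL as [HLd _].
  apply Cdiff_minus; [apply Cdiff_minus|].
  - apply Cdiff_of_C_differentiable_at, HLd, Hs.
  - apply (Cdiff_Csum (fun n s => chin n * npow (INR (n + 1)) s)%C). intros n _.
    apply Cdiff_mult; [apply Cdiff_const|apply Cdiff_npow].
  - apply Cdiff_mult; [apply Cdiff_npow|].
    apply (Cdiff_Csum (fun r s => chin r * em_tail s (INR M + INR (r + 1) / INR q))%C). intros r _.
    apply Cdiff_mult; [apply Cdiff_const|now apply Cdiff_em_tail].
Qed.

Definition scale_const : R := INR q * exp (4 * ln (INR q)) * 11 ^ 5.

(** The factor s + 1 of [rising6] is kept apart, since it makes the bound vanish at -1. The other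
    five factors are at most 11 for |s| <= 6, and q^(-Re s) is at most q^4. *)
Lemma rem_scale_le (s : CC) : Cmod s <= 6 -> -4 <= fst s -> rem_scale s <= scale_const * Cmod (s + 1)%C.
Proof.
  intros Hs Hre. unfold rem_scale, scale_const, rising6. pose proof INR_q_pos as Hq0.
  rewrite Cmod_npow, !Cmod_mult.
  assert (He : exp (- fst s * ln (INR q)) <= exp (4 * ln (INR q))).
  { apply exp_le. apply Rmult_le_compat_r; [|lra]. rewrite <- ln_1. apply ln_le; [lra|]. apply (le_INR 1); lia. }
  pose proof (exp_pos (- fst s * ln (INR q))).
  assert (T : forall k, 0 <= k <= 5 -> Cmod (s + RtoC k)%C <= 11).
  { intros k Hk. eapply Rle_trans; [apply Cmod_triangle|]. rewrite Cmod_R, Rabs_pos_eq; lra. }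
  pose proof (T 2 ltac:(lra)). pose proof (T 3 ltac:(lra)). pose proof (T 4 ltac:(lra)). pose proof (T 5 ltac:(lra)).
  pose proof (Cmod_ge_0 s). pose proof (Cmod_ge_0 (s + 1)%C). pose proof (Cmod_ge_0 (s + 2)%C).
  pose proof (Cmod_ge_0 (s + 3)%C). pose proof (Cmod_ge_0 (s + 4)%C). pose proof (Cmod_ge_0 (s + 5)%C).
  apply Rle_trans with ((INR q * exp (- fst s * ln (INR q))) *
    ((Cmod s * Cmod (s + 2)%C * Cmod (s + 3)%C * Cmod (s + 4)%C * Cmod (s + 5)%C) * Cmod (s + 1)%C)); [right; ring|].
  replace (INR q * exp (4 * ln (INR q)) * 11 ^ 5 * Cmod (s + 1)%C) with
    ((INR q * exp (4 * ln (INR q))) * ((11 * 11 * 11 * 11 * 11) * Cmod (s + 1)%C)) by ring.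
  repeat (apply Rmult_le_compat; try lra; repeat apply Rmult_le_pos; try lra).
Qed.

Lemma scale_const_nonneg : 0 <= scale_const.
Proof.
  unfold scale_const. pose proof INR_q_pos. pose proof (exp_pos (4 * ln (INR q))).
  repeat apply Rmult_le_pos; lra.
Qed.

Lemma circle_bounded (F : CC -> CC) (a : CC) (R0 : R) :
  (forall th, Cdiff F (a + RtoC R0 * cis th)%C) ->
  exists B, forall th, Cmod (F (a + RtoC R0 * cis th)%C) <= B.
Proof.
  intros HF. set (f := fun th => Cmod (F (a + RtoC R0 * cis th)%C)).
  pose proof PI_RGT_0 as HPI.
  assert (Hc : forall th, continuity_pt f th).
  { intros th0. apply continuity_pt_filterlim. apply filterlim_locally. intros eps.
    destruct (Cdiff_continuous F _ (HF th0) eps (cond_pos eps)) as (d & Hd & HFd).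
    assert (Hcs : continuous cos th0) by apply continuous_cos.
    assert (Hsn : continuous sin th0) by apply continuous_sin.
    assert (Hd' : 0 < d / (2 * (Rabs R0 + 1))) by (pose proof (Rabs_pos R0); apply Rdiv_lt_0_compat; lra).
    apply filterlim_locally with (eps := mkposreal _ Hd') in Hcs.
    apply filterlim_locally with (eps := mkposreal _ Hd') in Hsn.
    generalize (filter_and _ _ Hcs Hsn). apply filter_imp. intros th [H1 H2].
    unfold ball in H1, H2 |- *; simpl in H1, H2 |- *; unfold AbsRing_ball, abs, minus, plus, opp in H1, H2 |- *; simpl in H1, H2 |- *.
    unfold f.
    assert (Hz : Cmod (a + RtoC R0 * cis th - (a + RtoC R0 * cis th0))%C < d).
    { replace (a + RtoC R0 * cis th - (a + RtoC R0 * cis th0))%C with (RtoC R0 * (cis th - cis th0))%C by ring.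
      rewrite Cmod_mult, Cmod_R.
      assert (Hcis : Cmod (cis th - cis th0)%C <= Rabs (cos th + - cos th0) + Rabs (sin th + - sin th0)).
      { rewrite !cis_eq. apply Cmod_le_sum. }
      pose proof (Rabs_pos R0).
      apply Rle_lt_trans with (Rabs R0 * (2 * (d / (2 * (Rabs R0 + 1))))).
      - apply Rmult_le_compat_l; [lra|]. lra.
      - replace (Rabs R0 * (2 * (d / (2 * (Rabs R0 + 1))))) with (d * Rabs R0 / (Rabs R0 + 1)) by (field; lra).
        apply Rmult_lt_reg_r with (Rabs R0 + 1); [lra|].
        replace (d * Rabs R0 / (Rabs R0 + 1) * (Rabs R0 + 1)) with (d * Rabs R0) by (field; lra). lra. }
    specialize (HFd _ Hz).
    set (z1 := F (a + RtoC R0 * cis th)%C) in *. set (z0 := F (a + RtoC R0 * cis th0)%C) in *.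
    pose proof (Cmod_triangle (z1 - z0)%C z0) as T1. replace (z1 - z0 + z0)%C with z1 in T1 by ring.
    pose proof (Cmod_triangle (- (z1 - z0))%C z1) as T2. replace (- (z1 - z0) + z1)%C with z0 in T2 by ring.
    rewrite Cmod_opp in T2. apply Rabs_def1; lra. }
  destruct (continuity_ab_maj f 0 (2 * PI)) as (m & Hm & _); [lra|intros; apply Hc|].
  exists (f m). intros th.
  set (d := Int_part (th / (2 * PI))). destruct (base_Int_part (th / (2 * PI))) as [H1 H2]. fold d in H1, H2.
  assert (E : th = (th - 2 * PI * IZR d) + 2 * PI * IZR d) by ring.
  rewrite E, cis_plus, cis_2PI_Z. replace (RtoC R0 * (cis (th - 2 * PI * IZR d) * 1))%C with (RtoC R0 * cis (th - 2 * PI * IZR d))%C by ring.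
  apply (Hm (th - 2 * PI * IZR d)).
  replace (th - 2 * PI * IZR d) with (2 * PI * (th / (2 * PI) - IZR d)) by (field; lra).
  split; nra.
Qed.

(** For fixed delta, the remainder with cut-off M tends to 0 at the centre as M grows, by
    [arc_bound]. Returning to cut-off 1 costs at most twice [rem_scale], which at this point is of
    order delta. *)
Lemma em_rem_near (delta : R) : 0 < delta <= 1 ->
  Cmod (em_rem 1 (-1, delta)) <= 2 * scale_const * delta.
Proof.
  intros Hd. pose proof PI_RGT_0 as HPI. pose proof scale_const_nonneg as HK.
  (* The distance from the centre to 1 has square 4 + delta^2, so 1 lies outside the disc; R0 > 2
     puts the rightmost point of the circle into Re s > 1. *)
  set (a := (-1, delta) : CC). set (R0 := sqrt (4 + delta * delta / 2)).
  assert (HR2 : R0 * R0 = 4 + delta * delta / 2) by (apply sqrt_sqrt; nra).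
  assert (HRpos : 0 <= R0) by apply sqrt_pos.
  assert (HR : 2 < R0 < 3) by (split; nra).
  assert (Hsq : forall z : CC, Cmod z * Cmod z = fst z * fst z + snd z * snd z).
  { intros z. pose proof (Cmod2_alt z) as E. unfold Re, Im in E. nra. }
  assert (Hdisc : forall z, Cmod (z - a)%C <= R0 -> z <> 1%C /\ -4 <= fst z /\ Cmod z <= 6).
  { intros z Hz. pose proof (Cmod_ge_0 (z - a)%C) as Hp. pose proof (Hsq (z - a)%C) as E.
    assert (Hle : Cmod (z - a)%C * Cmod (z - a)%C <= R0 * R0) by nra.
    simpl in E. repeat split.
    - intros ->. simpl in E. nra.
    - assert (0 <= (snd z + - delta) * (snd z + - delta)) by apply Rle_0_sqr.
      assert (H9 : (fst z + 1) * (fst z + 1) <= 9) by nra. nra.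
    - replace z with (z - a + a)%C by ring. eapply Rle_trans; [apply Cmod_triangle|].
      assert (Cmod a <= 2).
      { pose proof (Cmod_le_sum a) as Ha. simpl in Ha. rewrite (Rabs_pos_eq delta), (Rabs_left (-1)) in Ha by lra. lra. }
      lra. }
  assert (Hcirc : forall th, Cmod (a + RtoC R0 * cis th - a)%C <= R0).
  { intros th. replace (a + RtoC R0 * cis th - a)%C with (RtoC R0 * cis th)%C by ring.
    rewrite Cmod_mult, Cmod_cis, Cmod_R, Rabs_pos_eq; lra. }
  assert (Hdist1 : forall z, Cmod z <= 6 -> Cmod (z + 1)%C <= 7).
  { intros z Hz. eapply Rle_trans; [apply Cmod_triangle|]. rewrite Cmod_1. lra. }
  assert (Hscale : forall z, Cmod (z - a)%C <= R0 -> rem_scale z <= 7 * scale_const).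
  { intros z Hz. destruct (Hdisc z Hz) as (_ & H2 & H3). specialize (Hdist1 z H3).
    eapply Rle_trans; [apply rem_scale_le; assumption|]. nra. }
  destruct (circle_bounded (em_rem 1) a R0) as [B1 HB1].
  { intros th. apply Cdiff_em_rem. apply (Hdisc _ (Hcirc th)). }
  assert (HB1p : 0 <= B1) by (eapply Rle_trans; [apply Cmod_ge_0|apply (HB1 0)]).
  (* A bound independent of the cut-off: the one for cut-off 1, plus twice the bound 7 [scale_const]
     on [rem_scale]. *)
  set (B := B1 + 14 * scale_const).
  assert (HBM : forall M th, (1 <= M)%nat -> Cmod (em_rem M (a + RtoC R0 * cis th)%C) <= B).
  { intros M th HM. set (z := (a + RtoC R0 * cis th)%C).
    destruct (Hdisc z (Hcirc th)) as (H1 & H2 & H3).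
    replace (em_rem M z) with (em_rem M z - em_rem 1 z + em_rem 1 z)%C by ring.
    eapply Rle_trans; [apply Cmod_triangle|].
    pose proof (em_rem_diff_1 M z HM H1 H2). pose proof (Hscale z (Hcirc th)). pose proof (HB1 th) as HBt. fold z in HBt.
    unfold B. lra. }
  (* The condition cos th > 2/R0 says that the point of the circle has real part above 1, where
     [em_rem_right] gives decay in M. *)
  assert (Harc : exists n, (1 <= n)%nat /\ forall th, 0 <= th <= 2 * PI / INR n -> 2 / R0 < cos th).
  { assert (Hlt : 2 / R0 < 1) by (apply Rmult_lt_reg_r with R0; [lra|]; unfold Rdiv; rewrite Rmult_assoc, Rinv_l; lra).
    assert (Hc : continuous cos 0) by apply continuous_cos.
    apply filterlim_locally with (eps := mkposreal (1 - 2 / R0) ltac:(lra)) in Hc.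
    destruct Hc as [eta Heta].
    destruct (nfloor_ex (2 * PI / eta)) as [n0 Hn0].
    { left. apply Rdiv_lt_0_compat; [lra|apply cond_pos]. }
    exists (S n0). split; [lia|]. intros th Hth.
    assert (Hb : Rabs (th - 0) < eta).
    { rewrite Rminus_0_r, Rabs_pos_eq by lra. eapply Rle_lt_trans; [apply Hth|].
      assert (0 < INR (S n0)) by (apply lt_0_INR; lia). pose proof (cond_pos eta).
      apply Rmult_lt_reg_r with (INR (S n0)); [lra|].
      unfold Rdiv. rewrite Rmult_assoc, Rinv_l by lra. rewrite S_INR.
      destruct Hn0 as [_ Hn0]. apply Rmult_lt_compat_l with (r := eta) in Hn0; [|lra].
      replace (eta * (2 * PI / eta)) with (2 * PI) in Hn0 by (field; lra). lra. }
    specialize (Heta th Hb). unfold ball in Heta; simpl in Heta; unfold AbsRing_ball, abs, minus, plus, opp in Heta; simpl in Heta.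
    rewrite cos_0 in Heta. apply Rabs_def2 in Heta. lra. }
  destruct Harc as (n & Hn & Harc).
  assert (Hmain : forall M, (2 <= M)%nat -> Cmod (em_rem M a) ^ n <= 7 * scale_const / INR (M - 1) * B ^ (n - 1)).
  { intros M HM. apply (arc_bound (em_rem M) a R0 B _ n); [lra|exact Hn| | |].
    - intros z Hz. apply Cdiff_em_rem. apply (Hdisc z Hz).
    - intros th. apply HBM. lia.
    - intros th Hth. specialize (Harc th Hth). set (z := (a + RtoC R0 * cis th)%C).
      assert (HM1 : 0 < INR (M - 1)) by (apply lt_0_INR; lia).
      eapply Rle_trans; [apply em_rem_right; [exact HM|]|].
      + unfold z. rewrite cis_eq. simpl.
        apply Rmult_lt_compat_l with (r := R0) in Harc; [|lra].
        replace (R0 * (2 / R0)) with 2 in Harc by (field; lra). lra.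
      + apply Rmult_le_compat_r; [left; now apply Rinv_0_lt_compat|]. apply Hscale, Hcirc. }
  assert (Hlim : is_lim_seq (fun M => Cmod (em_rem (M + 2) a) ^ n) 0).
  { apply is_lim_seq_squeeze_0 with (fun M => 7 * scale_const * B ^ (n - 1) * / INR (M + 1)).
    - intros M. rewrite Rabs_pos_eq by (apply pow_le, Cmod_ge_0).
      eapply Rle_trans; [apply Hmain; lia|]. replace (M + 2 - 1)%nat with (M + 1)%nat by lia. right. unfold Rdiv. ring.
    - replace (Finite 0) with (Rbar_mult (7 * scale_const * B ^ (n - 1)) 0) by (simpl; f_equal; ring).
      apply is_lim_seq_scal_l. apply (is_lim_seq_ext (fun M => / INR (S M))); [intros; do 2 f_equal; lia|].
      apply (is_lim_seq_incr_1 (fun n => / INR n)), is_lim_seq_inv_INR. }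
  apply le_epsilon. intros e He.
  apply is_lim_seq_spec in Hlim. destruct (Hlim (mkposreal (e ^ n) (pow_lt e n He))) as [M HM].
  specialize (HM M (Nat.le_refl M)). simpl in HM. rewrite Rminus_0_r, Rabs_pos_eq in HM by (apply pow_le, Cmod_ge_0).
  assert (Hsm : Cmod (em_rem (M + 2) a) < e).
  { destruct (Rlt_le_dec (Cmod (em_rem (M + 2) a)) e) as [H|H]; [exact H|].
    pose proof (pow_incr e (Cmod (em_rem (M + 2) a)) n ltac:(lra)). lra. }
  assert (Ha : a <> 1%C /\ -4 <= fst a /\ Cmod a <= 6).
  { apply Hdisc. replace (a - a)%C with (RtoC 0) by ring. rewrite Cmod_0. lra. }
  destruct Ha as (Ha1 & Ha2 & Ha3).
  pose proof (em_rem_diff_1 (M + 2) a ltac:(lia) Ha1 Ha2) as D.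
  pose proof (rem_scale_le a Ha3 Ha2) as S1.
  assert (E1 : Cmod (a + 1)%C = delta).
  { replace (a + 1)%C with (Ci * RtoC delta)%C by (apply injective_projections; simpl; ring).
    rewrite Cmod_mult, Cmod_Ci, Cmod_R, Rabs_pos_eq; lra. }
  rewrite E1 in S1.
  replace (em_rem 1 a) with (- (em_rem (M + 2) a - em_rem 1 a) + em_rem (M + 2) a)%C by ring.
  eapply Rle_trans; [apply Cmod_triangle|]. rewrite Cmod_opp. lra.
Qed.

(** Continuity of the remainder at -1 lets delta tend to 0 in the preceding bound. *)
Lemma em_rem_minus_1 : em_rem 1 (RtoC (-1)) = 0%C.
Proof.
  apply Cmod_eq_0. apply Rle_antisym; [|apply Cmod_ge_0].
  apply le_epsilon. intros e He. rewrite Rplus_0_l.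
  pose proof scale_const_nonneg as HK.
  assert (Hm1 : RtoC (-1) <> 1%C) by (intros E; apply (f_equal fst) in E; simpl in E; lra).
  destruct (Cdiff_continuous (em_rem 1) (RtoC (-1)) (Cdiff_em_rem 1 _ Hm1) (e / 2) ltac:(lra)) as (d & Hd & HF).
  set (x := Rmin 1 (Rmin (d / 2) (e / (4 * (scale_const + 1))))).
  assert (Hx : 0 < x) by (repeat apply Rmin_glb_lt; try lra; apply Rdiv_lt_0_compat; lra).
  assert (Hx1 : x <= 1) by apply Rmin_l.
  assert (Hx2 : x <= d / 2) by (eapply Rle_trans; [apply Rmin_r|apply Rmin_l]).
  assert (Hx3 : x <= e / (4 * (scale_const + 1))) by (eapply Rle_trans; [apply Rmin_r|apply Rmin_r]).
  pose proof (em_rem_near x ltac:(lra)) as N.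
  specialize (HF (-1, x)).
  replace ((-1, x) - RtoC (-1))%C with (Ci * RtoC x)%C in HF by (apply injective_projections; simpl; ring).
  rewrite Cmod_mult, Cmod_Ci, Cmod_R, Rabs_pos_eq in HF by lra. specialize (HF ltac:(lra)).
  replace (em_rem 1 (RtoC (-1))) with (- (em_rem 1 (-1, x) - em_rem 1 (RtoC (-1))) + em_rem 1 (-1, x))%C by ring.
  eapply Rle_trans; [apply Cmod_triangle|]. rewrite Cmod_opp.
  assert (2 * scale_const * x <= e / 2).
  { apply Rle_trans with (2 * scale_const * (e / (4 * (scale_const + 1)))); [apply Rmult_le_compat_l; lra|].
    apply Rmult_le_reg_r with (4 * (scale_const + 1)); [lra|].
    replace (2 * scale_const * (e / (4 * (scale_const + 1))) * (4 * (scale_const + 1))) with (2 * scale_const * e) by (field; lra).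
    nra. }
  lra.
Qed.

Lemma npow_minus_1 u : 0 < u -> npow u (RtoC (-1)) = RtoC u.
Proof.
  intros Hu. unfold npow. replace (- RtoC (-1) * RtoC (ln u))%C with (RtoC (ln u)).
  - rewrite Cexp_RtoC, exp_ln; auto.
  - rewrite <- RtoC_opp, <- RtoC_mult. f_equal. ring.
Qed.

(** The factor s + 1 removes the cubic correction, and what remains is -B_2(u)/2, the value at -1 of
    the Hurwitz zeta function. *)
Lemma em_tail_minus_1 u : 0 < u -> em_tail (RtoC (-1)) u = RtoC (- (u ^ 2 - u + 1 / 6) / 2).
Proof.
  intros Hu. unfold em_tail. rewrite npow_minus_1 by exact Hu.
  replace (RtoC (-1) + 1)%C with (RtoC 0) by (rewrite <- RtoC_plus; f_equal; ring).
  replace (/ RtoC 2)%C with (RtoC (/ 2)) by (rewrite RtoC_inv; [reflexivity|lra]).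
  replace (RtoC u / (RtoC (-1) - 1))%C with (RtoC (- u / 2)).
  - transitivity (RtoC u * (RtoC (- u / 2) + RtoC (/ 2) + RtoC (-1) * RtoC (/ 12) * RtoC (/ u)))%C; [ring|].
    rewrite <- !RtoC_mult, <- !RtoC_plus, <- RtoC_mult. f_equal. field. lra.
  - rewrite <- RtoC_minus, <- RtoC_div by lra. f_equal. field.
Qed.

Lemma L_minus_1 :
  L (RtoC (-1)) = (- RtoC (INR q / 2) *
    Csum (fun r => chi (Z.of_nat (r + 1)) * RtoC ((INR (r + 1) / INR q) ^ 2 - INR (r + 1) / INR q + 1 / 6)) q)%C.
Proof.
  pose proof em_rem_minus_1 as E. unfold em_rem in E. pose proof INR_q_pos as Hq0.
  rewrite Nat.mul_1_r, npow_minus_1 in E by exact Hq0.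
  assert (E' : L (RtoC (-1)) = (Csum (fun n => chin n * npow (INR (n + 1)) (RtoC (-1))) q +
     RtoC (INR q) * Csum (fun r => chin r * em_tail (RtoC (-1)) (INR 1 + INR (r + 1) / INR q)) q)%C).
  { set (A := Csum _ _) in *. set (B := (RtoC (INR q) * Csum _ _)%C) in *.
    replace (L (RtoC (-1))) with (L (RtoC (-1)) - A - B + (A + B))%C by ring. rewrite E. ring. }
  rewrite E', <- !Csum_scal, <- Csum_plus. apply Csum_ext. intros r _. unfold chin.
  assert (Hr : 0 < INR (r + 1)) by (apply lt_0_INR; lia).
  assert (Hrq : 0 < INR (r + 1) / INR q) by now apply Rdiv_lt_0_compat.
  rewrite npow_minus_1, em_tail_minus_1 by (simpl; lra).
  set (c := chi _). rewrite <- RtoC_opp.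
  transitivity (c * (RtoC (INR (r + 1)) + RtoC (INR q) * RtoC (- ((INR 1 + INR (r + 1) / INR q) ^ 2 - (INR 1 + INR (r + 1) / INR q) + 1 / 6) / 2)))%C; [ring|].
  transitivity (c * (RtoC (- (INR q / 2)) * RtoC ((INR (r + 1) / INR q) ^ 2 - INR (r + 1) / INR q + 1 / 6)))%C; [|ring].
  (* The identity B_2(t + 1) = B_2(t) + 2t absorbs the first q terms, which precede the tails at
     cut-off 1. *)
  rewrite <- !RtoC_mult, <- RtoC_plus. do 2 f_equal. simpl (INR 1). field. lra.
Qed.
End LValue.

(** * Trigonometric series *)

Lemma exp_neg_lt_1 y : 0 < y -> exp (- y) < 1.
Proof. intros H. rewrite <- exp_0. apply exp_increasing. lra. Qed.

Lemma partial_fractions_real y (r q : nat) : 0 < y -> (1 <= r <= q)%nat ->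
  is_lim_seq (Rsum (fun k => cos (2 * PI * INR (S k) * (INR r / INR q)) * (2 * y / (y ^ 2 + (2 * PI * INR (S k)) ^ 2))))
    ((exp (- (INR r / INR q * y)) + exp (- ((1 - INR r / INR q) * y))) / (2 * (1 - exp (- y))) - 1 / y).
Proof.
  intros Hy Hr. pose proof (exp_neg_lt_1 y Hy) as He.
  pose proof (partial_fractions (RtoC y) Hy r q Hr) as H.
  set (t := INR r / INR q) in *.
  set (l := (exp (- (t * y)) + exp (- ((1 - t) * y))) / (2 * (1 - exp (- y))) - 1 / y).
  assert (E : is_Clim (fun n => RtoC (Rsum (fun k => cos (2 * PI * INR (S k) * t) * (2 * y / (y ^ 2 + (2 * PI * INR (S k)) ^ 2))) n)) (RtoC l)).
  { eapply is_Clim_eq; [eapply is_Clim_ext; [|exact H]|].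
    - intros n. rewrite <- Csum_RtoC. apply Csum_ext. intros k _.
      rewrite RtoC_mult, RtoC_div by (assert (0 < y ^ 2) by (apply pow_lt; lra); pose proof (pow2_ge_0 (2 * PI * INR (S k))); lra).
      rewrite (RtoC_plus (y ^ 2)), (RtoC_pow y), (RtoC_mult 2 y). do 3 f_equal. ring.
    - rewrite <- !RtoC_mult, <- !RtoC_opp, !Cexp_RtoC, <- RtoC_plus, <- RtoC_minus, <- RtoC_mult.
      unfold l. rewrite <- !RtoC_div, <- RtoC_minus by lra. reflexivity. }
  exact (proj1 E).
Qed.

Lemma summation_by_parts (c g : nat -> R) K :
  Rsum (fun k => c k * g k) K = Rsum c K * g K + Rsum (fun k => Rsum c (S k) * (g k - g (S k))) K.
Proof. induction K as [|K IH]; cbn [Rsum]; [ring|]. rewrite IH. cbn [Rsum]. ring. Qed.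

Lemma dirichlet_test_bound (c g : nat -> R) (C : R) K :
  (forall n, Rabs (Rsum c n) <= C) -> (forall n, 0 <= g n) -> (forall n, g (S n) <= g n) ->
  Rabs (Rsum (fun k => c k * g k) K) <= C * g O.
Proof.
  intros HC Hg Hd. rewrite summation_by_parts.
  eapply Rle_trans; [apply Rabs_triang|].
  assert (Rabs (Rsum c K * g K) <= C * g K).
  { rewrite Rabs_mult, (Rabs_pos_eq (g K)) by apply Hg. apply Rmult_le_compat_r; [apply Hg|apply HC]. }
  assert (Rabs (Rsum (fun k => Rsum c (S k) * (g k - g (S k))) K) <= C * (g O - g K)).
  { eapply Rle_trans; [apply Rabs_Rsum|]. rewrite <- (Rsum_telescope g), <- Rsum_scal.
    apply Rsum_le. intros k _. specialize (Hd k).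
    rewrite Rabs_mult, (Rabs_pos_eq (g k - g (S k))) by lra. apply Rmult_le_compat_r; [lra|apply HC]. }
  lra.
Qed.

Lemma dirichlet_cos a K :
  2 * sin (a / 2) * Rsum (fun k => cos (INR (S k) * a)) K = sin ((INR K + 1 / 2) * a) - sin (a / 2).
Proof.
  induction K as [|K IH]; [simpl; replace ((0 + 1 / 2) * a) with (a / 2) by field; ring|].
  cbn [Rsum]. rewrite Rmult_plus_distr_l, IH, S_INR.
  replace ((INR K + 1 / 2) * a) with ((INR K + 1) * a - a / 2) by field.
  replace ((INR K + 1 + 1 / 2) * a) with ((INR K + 1) * a + a / 2) by field.
  rewrite sin_minus, sin_plus. ring.
Qed.

Lemma dirichlet_sin a K :
  2 * sin (a / 2) * Rsum (fun k => sin (INR (S k) * a)) K = cos (a / 2) - cos ((INR K + 1 / 2) * a).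
Proof.
  induction K as [|K IH]; [simpl; replace ((0 + 1 / 2) * a) with (a / 2) by field; ring|].
  cbn [Rsum]. rewrite Rmult_plus_distr_l, IH, S_INR.
  replace ((INR K + 1 / 2) * a) with ((INR K + 1) * a - a / 2) by field.
  replace ((INR K + 1 + 1 / 2) * a) with ((INR K + 1) * a + a / 2) by field.
  rewrite cos_minus, cos_plus. ring.
Qed.

Lemma dirichlet_cos_bound a K : 0 < a < 2 * PI ->
  Rabs (Rsum (fun k => cos (INR (S k) * a)) K) <= / sin (a / 2).
Proof.
  intros Ha. assert (Hs : 0 < sin (a / 2)) by (apply sin_gt_0; lra).
  pose proof (dirichlet_cos a K) as E.
  pose proof (SIN_bound ((INR K + 1 / 2) * a)). pose proof (SIN_bound (a / 2)).
  set (X := Rsum _ K) in *. set (s := sin (a / 2)) in *.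
  assert (-1 <= s * X <= 1) by lra.
  replace X with (/ s * (s * X)) by (field; lra).
  assert (0 < / s) by now apply Rinv_0_lt_compat.
  apply Rabs_le. split; nra.
Qed.

(* Differentiating in the angle turns the sum into a Dirichlet kernel, and the
   oscillating term is removed by one integration by parts. *)
Lemma log_sine_deriv (K : nat) u : 0 < sin (u / 2) ->
  is_derive (fun u => Rsum (fun k => cos (INR (S k) * u) / INR (S k)) K + ln (sin (u / 2))
     - sin ((INR K + 1 / 2) * u) / ((2 * INR K + 1) * sin (u / 2))) u
   (sin ((INR K + 1 / 2) * u) * cos (u / 2) / (2 * (2 * INR K + 1) * sin (u / 2) ^ 2)).
Proof.
  intros Hs. pose proof (pos_INR K) as HK.
  assert (D1 : is_derive (fun u => Rsum (fun k => cos (INR (S k) * u) / INR (S k)) K) u (- Rsum (fun k => sin (INR (S k) * u)) K)).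
  { clear HK. induction K as [|K IH]; cbn [Rsum].
    - rewrite Ropp_0. apply (@is_derive_const R_AbsRing R_NormedModule).
    - rewrite Ropp_plus_distr. apply (@is_derive_plus R_AbsRing R_NormedModule); [exact IH|].
      assert (INR (S K) <> 0) by (apply not_0_INR; lia).
      set (c := INR (S K)) in *. auto_derive; [easy|]. field. auto. }
  assert (D2 : is_derive (fun u => ln (sin (u / 2)) - sin ((INR K + 1 / 2) * u) / ((2 * INR K + 1) * sin (u / 2))) u
     (cos (u / 2) / (2 * sin (u / 2)) - (cos ((INR K + 1 / 2) * u) / (2 * sin (u / 2)) - sin ((INR K + 1 / 2) * u) * cos (u / 2) / (2 * (2 * INR K + 1) * sin (u / 2) ^ 2)))).
  { assert ((2 * INR K + 1) * sin (u / 2) <> 0) by (apply Rmult_integral_contrapositive; split; lra).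
    auto_derive; [split; [exact Hs|split; [assumption|easy]]|]. unfold Rdiv. field. split; lra. }
  pose proof (@is_derive_plus R_AbsRing R_NormedModule _ _ _ _ _ D1 D2) as D. unfold plus in D; simpl in D.
  eapply is_derive_ext; [|evar_last; [exact D|]].
  - intros v. simpl. ring.
  - pose proof (dirichlet_sin u K) as E. set (X := Rsum _ K) in *.
    set (s := sin (u / 2)) in *.
    replace (cos ((INR K + 1 / 2) * u)) with (cos (u / 2) - 2 * s * X) by lra. field. split; lra.
Qed.

Lemma sin_half_ge a u : 0 < a < 2 * PI -> Rmin a PI <= u <= Rmax a PI -> sin (a / 2) <= sin (u / 2).
Proof.
  intros Ha Hu. destruct (Rle_dec a PI) as [H|H].
  - rewrite Rmin_left, Rmax_right in Hu by lra. apply sin_incr_1; lra.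
  - rewrite Rmin_right, Rmax_left in Hu by lra. apply sin_decr_1; lra.
Qed.

Lemma lim_inv_odd C : is_lim_seq (fun K => C / (2 * INR K + 1)) 0.
Proof.
  apply (is_lim_seq_ext (fun K => C * / INR (S (2 * K)))).
  - intros K. rewrite S_INR, mult_INR. reflexivity.
  - replace (Finite 0) with (Rbar_mult C 0) by (simpl; f_equal; ring).
    apply is_lim_seq_scal_l.
    apply (is_lim_seq_subseq (fun n => / INR n) 0 (fun K => S (2 * K))); [|apply is_lim_seq_inv_INR].
    apply eventually_subseq. intros; lia.
Qed.

(** Integrating from pi to a makes the sum at pi the constant of integration, with ln(sin(pi/2)) =
    0; its value is never computed, as it does not depend on a. The three terms of the constant [C]
    bound the integrated derivative and the oscillating boundary terms at a and at pi. *)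
Lemma log_sine_sum a : 0 < a < 2 * PI ->
  is_lim_seq (fun K => Rsum (fun k => cos (INR (S k) * a) / INR (S k)) K -
    Rsum (fun k => cos (INR (S k) * PI) / INR (S k)) K) (- ln (sin (a / 2))).
Proof.
  intros Ha. assert (Hs : 0 < sin (a / 2)) by (apply sin_gt_0; lra). pose proof PI_RGT_0 as HPI.
  set (s := sin (a / 2)) in *.
  set (C := PI / (2 * s ^ 2) + 1 / s + 1).
  assert (HC : forall K, Rabs (Rsum (fun k => cos (INR (S k) * a) / INR (S k)) K -
     Rsum (fun k => cos (INR (S k) * PI) / INR (S k)) K + ln s) <= C / (2 * INR K + 1)).
  { intros K. pose proof (pos_INR K) as HK.
    set (F := fun u => Rsum (fun k => cos (INR (S k) * u) / INR (S k)) K + ln (sin (u / 2))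
     - sin ((INR K + 1 / 2) * u) / ((2 * INR K + 1) * sin (u / 2))).
    assert (Hsu : forall u, Rmin PI a <= u <= Rmax PI a -> s <= sin (u / 2)).
    { intros u Hu. apply sin_half_ge; [exact Ha|]. now rewrite Rmin_comm, Rmax_comm. }
    destruct (MVT_gen F PI a (fun u => sin ((INR K + 1 / 2) * u) * cos (u / 2) / (2 * (2 * INR K + 1) * sin (u / 2) ^ 2))) as (c & Hc & E).
    - intros u Hu. apply log_sine_deriv. specialize (Hsu u ltac:(lra)). lra.
    - intros u Hu. apply continuity_pt_filterlim. apply (ex_derive_continuous F). eexists.
      apply log_sine_deriv. specialize (Hsu u ltac:(lra)). lra.
    - specialize (Hsu c Hc).
      unfold F in E. rewrite sin_PI2, ln_1 in E. fold s in E.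
      set (SA := Rsum (fun k => cos (INR (S k) * a) / INR (S k)) K) in *.
      set (SP := Rsum (fun k => cos (INR (S k) * PI) / INR (S k)) K) in *.
      set (m := 2 * INR K + 1) in *. assert (Hm : 1 <= m) by (unfold m; lra).
      set (sa := sin ((INR K + 1 / 2) * a)) in *. set (sp := sin ((INR K + 1 / 2) * PI)) in *.
      set (D := sin ((INR K + 1 / 2) * c) * cos (c / 2) / (2 * m * sin (c / 2) ^ 2)) in *.
      replace (SA - SP + ln s) with (D * (a - PI) + sa / (m * s) - sp / (m * 1)) by lra.
      assert (BD : Rabs D <= / (2 * m * s ^ 2)).
      { unfold D, Rdiv. rewrite !Rabs_mult.
        assert (Hp2 : 0 < 2 * m * s ^ 2) by (apply Rmult_lt_0_compat; [lra|apply pow_lt; lra]).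
        assert (Hle : 2 * m * s ^ 2 <= 2 * m * sin (c / 2) ^ 2) by (apply Rmult_le_compat_l; [lra|apply pow_incr; lra]).
        rewrite (Rabs_pos_eq (/ _)) by (left; apply Rinv_0_lt_compat; lra).
        assert (Rabs (sin ((INR K + 1 / 2) * c)) <= 1) by (apply Rabs_le, SIN_bound).
        assert (Rabs (cos (c / 2)) <= 1) by (apply Rabs_le, COS_bound).
        pose proof (Rabs_pos (sin ((INR K + 1 / 2) * c))). pose proof (Rabs_pos (cos (c / 2))).
        rewrite <- (Rmult_1_l (/ (2 * m * s ^ 2))).
        apply Rmult_le_compat; [apply Rmult_le_pos; assumption|left; apply Rinv_0_lt_compat; lra|nra|].
        apply Rinv_le_contravar; lra. }
      assert (B1 : Rabs (D * (a - PI)) <= PI / (2 * s ^ 2) / m).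
      { rewrite Rabs_mult. apply Rle_trans with (/ (2 * m * s ^ 2) * PI).
        - apply Rmult_le_compat; try apply Rabs_pos; [exact BD|apply Rabs_le; lra].
        - right. field. lra. }
      assert (B2 : Rabs (sa / (m * s)) <= 1 / s / m).
      { unfold Rdiv. rewrite Rabs_mult, (Rabs_pos_eq (/ (m * s))) by (left; apply Rinv_0_lt_compat; nra).
        replace (1 * / s * / m) with (1 * / (m * s)) by (field; lra).
        apply Rmult_le_compat_r; [left; apply Rinv_0_lt_compat; nra|apply Rabs_le, SIN_bound]. }
      assert (B3 : Rabs (sp / (m * 1)) <= 1 / m).
      { unfold Rdiv. rewrite Rmult_1_r, Rabs_mult, (Rabs_pos_eq (/ m)) by (left; apply Rinv_0_lt_compat; lra).
        apply Rmult_le_compat_r; [left; apply Rinv_0_lt_compat; lra|apply Rabs_le, SIN_bound]. }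
      unfold C. replace ((PI / (2 * s ^ 2) + 1 / s + 1) / m) with (PI / (2 * s ^ 2) / m + 1 / s / m + 1 / m) by (field; lra).
      unfold Rminus at 1. eapply Rle_trans; [apply Rabs_triang|]. rewrite Rabs_Ropp.
      pose proof (Rabs_triang (D * (a - PI)) (sa / (m * s))). lra. }
  apply (is_lim_seq_ext (fun K => (Rsum (fun k => cos (INR (S k) * a) / INR (S k)) K -
    Rsum (fun k => cos (INR (S k) * PI) / INR (S k)) K + ln s) - ln s)); [intros; ring|].
  replace (Finite (- ln s)) with (Finite (0 - ln s)) by (f_equal; ring).
  apply is_lim_seq_minus'; [|apply is_lim_seq_const].
  apply is_lim_seq_squeeze_0 with (fun K => C / (2 * INR K + 1)); [exact HC|apply lim_inv_odd].
Qed.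

(** * The Fourier series of the second Bernoulli polynomial *)

Lemma nonneg_of_derive (f df : R -> R) v :
  0 <= v -> f 0 = 0 -> (forall c, is_derive f c (df c)) -> (forall c, 0 <= c -> 0 <= df c) -> 0 <= f v.
Proof.
  intros Hv H0 Hd Hp.
  destruct (MVT_gen f 0 v df) as (c & Hc & E).
  - intros; apply Hd.
  - intros u _. apply continuity_pt_filterlim. apply (ex_derive_continuous f). eexists; apply Hd.
  - rewrite Rmin_left, Rmax_right in Hc by lra. specialize (Hp c ltac:(lra)). nra.
Qed.

(** Each inequality is the derivative of the next, all being equalities at 0; the chain starts from
    e^(-v) >= 1 - v. *)
Lemma exp_neg_bounds v : 0 <= v ->
  1 - v + v ^ 2 / 2 - v ^ 3 / 6 <= exp (- v) <= 1 - v + v ^ 2 / 2 - v ^ 3 / 6 + v ^ 4 / 24.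
Proof.
  assert (A1 : forall v, 0 <= v -> 0 <= exp (- v) - (1 - v)).
  { intros u _. pose proof (exp_ineq1_le (- u)). lra. }
  assert (A2 : forall v, 0 <= v -> 0 <= 1 - v + v ^ 2 / 2 - exp (- v)).
  { intros u Hu. apply (nonneg_of_derive (fun v => 1 - v + v ^ 2 / 2 - exp (- v)) (fun v => exp (- v) - (1 - v)) u Hu).
    - rewrite Ropp_0, exp_0. field.
    - intros c. auto_derive; [easy|]. field.
    - exact A1. }
  assert (A3 : forall v, 0 <= v -> 0 <= exp (- v) - (1 - v + v ^ 2 / 2 - v ^ 3 / 6)).
  { intros u Hu. apply (nonneg_of_derive (fun v => exp (- v) - (1 - v + v ^ 2 / 2 - v ^ 3 / 6)) (fun v => 1 - v + v ^ 2 / 2 - exp (- v)) u Hu).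
    - rewrite Ropp_0, exp_0. field.
    - intros c. auto_derive; [easy|]. field.
    - exact A2. }
  intros Hv. split; [specialize (A3 v Hv); lra|].
  assert (0 <= 1 - v + v ^ 2 / 2 - v ^ 3 / 6 + v ^ 4 / 24 - exp (- v)); [|lra].
  apply (nonneg_of_derive (fun v => 1 - v + v ^ 2 / 2 - v ^ 3 / 6 + v ^ 4 / 24 - exp (- v)) (fun v => exp (- v) - (1 - v + v ^ 2 / 2 - v ^ 3 / 6)) v Hv).
  - rewrite Ropp_0, exp_0. field.
  - intros c. auto_derive; [easy|]. field.
  - exact A3.
Qed.

(** Near y = 0 the symmetrised kernel is 1/y + y B_2(t)/2 plus higher terms, the constant term
    cancelling between t and 1 - t. Division by 2y thus leaves B_2(t)/4. *)
Lemma bern2_quotient_bound t y : 0 <= t <= 1 -> 0 < y <= 1 ->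
  Rabs (((exp (- (t * y)) + exp (- ((1 - t) * y))) / (2 * (1 - exp (- y))) - 1 / y) / (2 * y) - (t ^ 2 - t + 1 / 6) / 4) <= 2 * y.
Proof.
  intros Ht Hy.
  destruct (exp_neg_bounds (t * y)) as [a1 a2]; [nra|].
  destruct (exp_neg_bounds ((1 - t) * y)) as [b1 b2]; [nra|].
  destruct (exp_neg_bounds y) as [c1 c2]; [lra|].
  pose proof (exp_neg_lt_1 y ltac:(lra)) as He.
  set (ea := exp (- (t * y))) in *. set (eb := exp (- ((1 - t) * y))) in *. set (ec := exp (- y)) in *.
  set (D := 1 - ec).
  assert (Hy2 : 0 < y ^ 2) by (apply pow_lt; lra).
  assert (Hy3 : 0 < y ^ 3) by (apply pow_lt; lra).
  assert (Hy4 : 0 < y ^ 4) by (apply pow_lt; lra).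
  assert (Hy32 : y ^ 3 <= y ^ 2) by (simpl; nra).
  assert (Hy43 : y ^ 4 <= y ^ 3) by (simpl; nra).
  assert (HD : y / 3 <= D) by (unfold D; nra).
  assert (HD' : Rabs (D - y) <= y ^ 2) by (unfold D; apply Rabs_le; lra).
  set (ra := ea - (1 - t * y + (t * y) ^ 2 / 2)). set (rb := eb - (1 - (1 - t) * y + ((1 - t) * y) ^ 2 / 2)).
  set (rc := D - (y - y ^ 2 / 2 + y ^ 3 / 6)).
  assert (H3 : forall s, 0 <= s <= 1 -> 0 <= (s * y) ^ 3 <= y ^ 3 /\ 0 <= (s * y) ^ 4 <= y ^ 4).
  { intros s Hs. rewrite !Rpow_mult_distr.
    assert (Hp : forall n, 0 <= s ^ n <= 1).
    { intros n. split; [apply pow_le; lra|]. rewrite <- (pow1 n). apply pow_incr; lra. }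
    pose proof (Hp 3%nat). pose proof (Hp 4%nat). split; nra. }
  pose proof (H3 t Ht) as [T3 T4]. pose proof (H3 (1 - t) ltac:(lra)) as [U3 U4].
  assert (Ra : Rabs ra <= y ^ 3 / 4) by (unfold ra; apply Rabs_le; lra).
  assert (Rb : Rabs rb <= y ^ 3 / 4) by (unfold rb; apply Rabs_le; lra).
  assert (Rc : Rabs rc <= y ^ 4 / 24) by (unfold rc, D; apply Rabs_le; lra).
  set (B := t ^ 2 - t + 1 / 6). assert (HB : Rabs B <= 1) by (unfold B; apply Rabs_le; nra).
  (* Over the common denominator only the Taylor remainders and the term with y - D survive; all
     terms of lower order cancel. *)
  assert (E : ((ea + eb) / (2 * D) - 1 / y) / (2 * y) - B / 4 = (y * (ra + rb) - 2 * rc + y ^ 2 * B * (y - D)) / (4 * y ^ 2 * D)).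
  { unfold ra, rb, rc, B. field. split; lra. }
  rewrite E. unfold Rdiv. rewrite Rabs_mult.
  assert (HP : 0 < 4 * y ^ 2 * D) by (apply Rmult_lt_0_compat; lra).
  rewrite (Rabs_pos_eq (/ _)) by (left; apply Rinv_0_lt_compat; exact HP).
  apply Rmult_le_reg_r with (4 * y ^ 2 * D); [exact HP|].
  rewrite Rmult_assoc, Rinv_l, Rmult_1_r by lra.
  assert (Hyr : Rabs (y * (ra + rb)) <= y ^ 4 / 2).
  { rewrite Rabs_mult, (Rabs_pos_eq y) by lra.
    pose proof (Rabs_triang ra rb). replace (y ^ 4 / 2) with (y * (y ^ 3 / 4 + y ^ 3 / 4)) by field.
    apply Rmult_le_compat_l; lra. }
  assert (Hbd : Rabs (y ^ 2 * B * (y - D)) <= y ^ 4).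
  { rewrite !Rabs_mult, (Rabs_pos_eq (y ^ 2)), (Rabs_minus_sym y D) by lra.
    replace (y ^ 4) with (y ^ 2 * 1 * y ^ 2) by ring.
    apply Rmult_le_compat; try apply Rabs_pos; [apply Rmult_le_pos; [lra|apply Rabs_pos]| |exact HD'].
    apply Rmult_le_compat_l; lra. }
  apply Rle_trans with (2 * y ^ 4).
  - pose proof (Rabs_triang (y * (ra + rb) - 2 * rc) (y ^ 2 * B * (y - D))).
    pose proof (Rabs_triang (y * (ra + rb)) (- (2 * rc))) as T. rewrite Rabs_Ropp, (Rabs_mult 2 rc), (Rabs_pos_eq 2) in T by lra.
    unfold Rminus in *. lra.
  - replace (2 * y ^ 4) with (2 * y * (4 * y ^ 2) * (y / 4)) by field.
    replace (2 * y * (4 * y ^ 2 * D)) with (2 * y * (4 * y ^ 2) * D) by ring.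
    apply Rmult_le_compat_l; [|lra]. repeat apply Rmult_le_pos; lra.
Qed.

(** The partial fraction expansion is divided by 2y and evaluated at y = 1/(j + 1), which tends to
    0; the terms are dominated by 1/k^2, so the limit is the series at y = 0. *)
Lemma bern2_fourier (r q : nat) : (1 <= r <= q)%nat ->
  is_lim_seq (Rsum (fun k => cos (2 * PI * INR (S k) * (INR r / INR q)) / INR (S k) ^ 2))
    (PI ^ 2 * ((INR r / INR q) ^ 2 - INR r / INR q + 1 / 6)).
Proof.
  intros Hr. set (t := INR r / INR q). pose proof PI_RGT_0 as HPI.
  assert (Hq : 0 < INR q) by (apply lt_0_INR; lia).
  assert (Ht : 0 <= t <= 1).
  { unfold t. split; [apply Rmult_le_pos; [apply pos_INR|left; now apply Rinv_0_lt_compat]|].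
    apply Rmult_le_reg_r with (INR q); [exact Hq|]. unfold Rdiv. rewrite Rmult_assoc, Rinv_l by lra.
    destruct Hr as [_ Hr]. apply le_INR in Hr. lra. }
  assert (Hi : is_lim_seq (fun j => / INR (S j)) 0) by (apply (is_lim_seq_incr_1 (fun n => / INR n)), is_lim_seq_inv_INR).
  assert (Hyj : forall j, 0 < / INR (S j) <= 1).
  { intros j. assert (1 <= INR (S j)) by (apply (le_INR 1); lia).
    split; [apply Rinv_0_lt_compat; lra|]. rewrite <- Rinv_1. apply Rinv_le_contravar; lra. }
  set (b := fun k => cos (2 * PI * INR (S k) * t) / (2 * PI * INR (S k)) ^ 2).
  set (a := fun j k => cos (2 * PI * INR (S k) * t) / ((/ INR (S j)) ^ 2 + (2 * PI * INR (S k)) ^ 2)).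
  assert (HSk : forall k, 0 < (2 * PI * INR (S k)) ^ 2).
  { intros k. apply pow_lt. assert (0 < INR (S k)) by (apply lt_0_INR; lia). nra. }
  assert (Hab : forall j k, Rabs (a j k) <= 1 * / INR (S k) ^ 2).
  { intros j k. unfold a, Rdiv. rewrite Rabs_mult.
    assert (0 < INR (S k) ^ 2) by (apply pow_lt, lt_0_INR; lia).
    assert (Hle : INR (S k) ^ 2 <= (/ INR (S j)) ^ 2 + (2 * PI * INR (S k)) ^ 2).
    { pose proof (pow2_ge_0 (/ INR (S j))). rewrite Rpow_mult_distr.
      pose proof PI2_3_2. assert (1 <= (2 * PI) ^ 2) by nra. nra. }
    rewrite (Rabs_pos_eq (/ _)) by (left; apply Rinv_0_lt_compat; lra).
    apply Rmult_le_compat; [apply Rabs_pos|left; apply Rinv_0_lt_compat; lra|apply Rabs_le, COS_bound|].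
    apply Rinv_le_contravar; lra. }
  assert (Hden : forall c : R, is_lim_seq (fun j => (/ INR (S j)) ^ 2 + c) c).
  { intros c. assert (L : is_lim_seq (fun j => / INR (S j) * (/ INR (S j) * 1) + c) (0 * (0 * 1) + c)).
    { apply is_lim_seq_plus'; [|apply is_lim_seq_const].
      repeat apply is_lim_seq_mult'; try exact Hi; apply is_lim_seq_const. }
    replace (0 * (0 * 1) + c) with c in L by ring. exact L. }
  assert (Hlim : is_lim_seq (fun j => Series (a j)) (Series b)).
  { apply (dominated_Series a b (fun k => 1 * / INR (S k) ^ 2) Hab (ex_series_scal_inv_sqr 1)).
    intros k. unfold a, b. apply is_lim_seq_div'; [apply is_lim_seq_const|apply Hden|apply Rgt_not_eq, HSk]. }
  assert (Hval : forall j, Series (a j) =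
    ((exp (- (t * / INR (S j))) + exp (- ((1 - t) * / INR (S j)))) / (2 * (1 - exp (- / INR (S j)))) - 1 / / INR (S j)) / (2 * / INR (S j))).
  { intros j. specialize (Hyj j). set (y := / INR (S j)) in *.
    pose proof (partial_fractions_real y r q ltac:(lra) Hr) as P. fold t in P.
    apply Series_Rsum.
    apply (is_lim_seq_ext (fun K => / (2 * y) * Rsum (fun k => cos (2 * PI * INR (S k) * t) * (2 * y / (y ^ 2 + (2 * PI * INR (S k)) ^ 2))) K)).
    - intros K. rewrite <- Rsum_scal. apply Rsum_ext. intros k _. unfold a. fold y. field.
      specialize (HSk k). pose proof (pow2_ge_0 y). split; lra.
    - match goal with |- is_lim_seq _ (Finite (?u / ?v)) => replace (Finite (u / v)) with (Rbar_mult (/ v) u) by (simpl; f_equal; unfold Rdiv; ring) end.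
      apply is_lim_seq_scal_l. exact P. }
  assert (HB : Series b = (t ^ 2 - t + 1 / 6) / 4).
  { assert (L : is_lim_seq (fun j => Series (a j)) ((t ^ 2 - t + 1 / 6) / 4)).
    { apply (is_lim_seq_ext (fun j => (Series (a j) - (t ^ 2 - t + 1 / 6) / 4) + (t ^ 2 - t + 1 / 6) / 4)); [intros; ring|].
      replace (is_lim_seq _ _) with (is_lim_seq (fun j => (Series (a j) - (t ^ 2 - t + 1 / 6) / 4) + (t ^ 2 - t + 1 / 6) / 4) (0 + (t ^ 2 - t + 1 / 6) / 4)) by (do 2 f_equal; ring).
      apply is_lim_seq_plus'; [|apply is_lim_seq_const].
      apply is_lim_seq_squeeze_0 with (fun j => 2 * / INR (S j)).
      - intros j. rewrite Hval. apply bern2_quotient_bound; [exact Ht|apply Hyj].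
      - replace (Finite 0) with (Rbar_mult 2 0) by (simpl; f_equal; ring). now apply is_lim_seq_scal_l. }
    apply is_lim_seq_unique in L. apply is_lim_seq_unique in Hlim. rewrite L in Hlim. now injection Hlim. }
  assert (Hb : ex_series b).
  { apply ex_series_dominated with (fun k => 1 * / INR (S k) ^ 2); [|apply ex_series_scal_inv_sqr].
    intros k. apply (is_lim_seq_le (fun j => Rabs (a j k)) (fun _ => 1 * / INR (S k) ^ 2) (Rabs (b k)) (1 * / INR (S k) ^ 2)).
    - intros j. apply Hab.
    - apply (is_lim_seq_abs _ (b k)). unfold a, b. apply is_lim_seq_div'; [apply is_lim_seq_const|apply Hden|apply Rgt_not_eq, HSk].
    - apply is_lim_seq_const. }
  apply Series_correct, is_series_Rsum in Hb. rewrite HB in Hb.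
  apply (is_lim_seq_ext (fun K => 4 * PI ^ 2 * Rsum b K)).
  - intros K. rewrite <- Rsum_scal. apply Rsum_ext. intros k _. unfold b.
    assert (INR (S k) <> 0) by (apply not_0_INR; lia). field. split; lra.
  - replace (Finite (PI ^ 2 * (t ^ 2 - t + 1 / 6))) with (Rbar_mult (4 * PI ^ 2) ((t ^ 2 - t + 1 / 6) / 4)) by (simpl; f_equal; field).
    now apply is_lim_seq_scal_l.
Qed.

(** * The double series for 0 < r < q *)

Lemma Series_Rsum_swap (a : nat -> nat -> R) K :
  (forall k, (k < K)%nat -> ex_series (fun n => a n k)) ->
  ex_series (fun n => Rsum (a n) K) /\ Series (fun n => Rsum (a n) K) = Rsum (fun k => Series (fun n => a n k)) K.
Proof.
  induction K as [|K IH]; intros H; cbn [Rsum].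
  - split; [exists 0; apply is_series_Rsum|apply Series_Rsum];
      (eapply is_lim_seq_ext; [|apply is_lim_seq_const]; intros n; simpl;
       induction n as [|n IHn]; simpl; [reflexivity|lra]).
  - destruct IH as [I1 I2]; [intros; apply H; lia|].
    assert (HK : ex_series (fun n => a n K)) by (apply H; lia).
    split; [now apply (@ex_series_plus R_AbsRing R_NormedModule)|].
    rewrite Series_plus by assumption. now rewrite I2.
Qed.

Lemma INR_S_ge_1 n : 1 <= INR (S n).
Proof. apply (le_INR 1). lia. Qed.

Section Kernel.
Variables (x : R) (N : nat).
Hypothesis Hx : 0 < x.
Hypothesis HN : (1 <= N)%nat.

Definition ypt (n : nat) : R := INR (S n) ^ N * x.

Definition kern (n k : nat) : R :=
  / INR (S n) * (2 * ypt n / (ypt n ^ 2 + (2 * PI * INR (S k)) ^ 2)).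

(** The sum over n at fixed k is what the finite sum over j produces; summing over k first leads to
    [sym_term] instead. *)
Definition kern_sum (k : nat) : R := Series (fun n => kern n k).

Lemma ypt_pos n : 0 < ypt n.
Proof. unfold ypt. apply Rmult_lt_0_compat; [apply pow_lt, lt_0_INR; lia|exact Hx]. Qed.

Lemma ypt_ge n : INR (S n) * x <= ypt n.
Proof.
  unfold ypt. apply Rmult_le_compat_r; [lra|]. pose proof (INR_S_ge_1 n).
  rewrite <- (pow_1 (INR (S n))) at 1. apply Rle_pow; [lra|lia].
Qed.

Lemma kern_nonneg n k : 0 <= kern n k.
Proof.
  unfold kern. pose proof (ypt_pos n). pose proof (INR_S_ge_1 n).
  apply Rmult_le_pos; [left; apply Rinv_0_lt_compat; lra|].
  apply Rmult_le_pos; [lra|]. left. apply Rinv_0_lt_compat.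
  assert (0 < ypt n ^ 2) by (apply pow_lt; lra). pose proof (pow2_ge_0 (2 * PI * INR (S k))). lra.
Qed.

Lemma kern_decr n k : kern n (S k) <= kern n k.
Proof.
  unfold kern. pose proof (ypt_pos n). pose proof (INR_S_ge_1 n). pose proof PI_RGT_0.
  apply Rmult_le_compat_l; [left; apply Rinv_0_lt_compat; lra|].
  apply Rmult_le_compat_l; [lra|].
  assert (0 < ypt n ^ 2) by (apply pow_lt; lra). pose proof (pow2_ge_0 (2 * PI * INR (S k))).
  apply Rinv_le_contravar; [lra|]. apply Rplus_le_compat_l.
  pose proof (pos_INR (S k)). apply pow_incr. rewrite (S_INR (S k)). nra.
Qed.

Lemma inv_ypt_le n c : 0 <= c -> / INR (S n) * (c / ypt n) <= c / x * / INR (S n) ^ 2.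
Proof.
  intros Hc. pose proof (ypt_pos n). pose proof (ypt_ge n). pose proof (INR_S_ge_1 n).
  apply Rle_trans with (/ INR (S n) * (c / (INR (S n) * x))).
  - apply Rmult_le_compat_l; [left; apply Rinv_0_lt_compat; lra|].
    apply Rmult_le_compat_l; [lra|]. apply Rinv_le_contravar; [nra|assumption].
  - right. field. lra.
Qed.

Lemma kern_0_le n : kern n 0 <= 2 / x * / INR (S n) ^ 2.
Proof.
  eapply Rle_trans; [|apply inv_ypt_le; lra].
  unfold kern. pose proof (ypt_pos n). pose proof (INR_S_ge_1 n).
  apply Rmult_le_compat_l; [left; apply Rinv_0_lt_compat; lra|].
  assert (0 < ypt n ^ 2) by (apply pow_lt; lra). pose proof (pow2_ge_0 (2 * PI * INR 1)).
  replace (2 / ypt n) with (2 * ypt n / ypt n ^ 2) by (field; lra).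
  apply Rmult_le_compat_l; [lra|]. apply Rinv_le_contravar; lra.
Qed.

Lemma kern_le n k : kern n k <= 2 / x * / INR (S n) ^ 2.
Proof.
  eapply Rle_trans; [|apply kern_0_le].
  induction k as [|k IH]; [lra|]. pose proof (kern_decr n k). lra.
Qed.

Lemma ex_series_kern k : ex_series (fun n => kern n k).
Proof.
  apply ex_series_dominated with (fun n => 2 / x * / INR (S n) ^ 2); [|apply ex_series_scal_inv_sqr].
  intros n. rewrite Rabs_pos_eq by apply kern_nonneg. apply kern_le.
Qed.

Lemma ex_series_inv_ypt : ex_series (fun n => / INR (S n) * (1 / ypt n)).
Proof.
  apply ex_series_dominated with (fun n => 1 / x * / INR (S n) ^ 2); [|apply ex_series_scal_inv_sqr].
  intros n. pose proof (ypt_pos n). pose proof (INR_S_ge_1 n).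
  rewrite Rabs_pos_eq; [apply inv_ypt_le; lra|].
  apply Rmult_le_pos; [left; apply Rinv_0_lt_compat; lra|].
  apply Rmult_le_pos; [lra|]. left; apply Rinv_0_lt_compat; lra.
Qed.

Lemma Series_inv_ypt : Series (fun n => / INR (S n) * (1 / ypt n)) = zeta_real (INR N + 1) / x.
Proof.
  unfold zeta_real, Rdiv. rewrite <- Series_scal_r. apply Series_ext. intros n.
  replace (n + 1)%nat with (S n) by lia.
  pose proof (INR_S_ge_1 n). rewrite Rpower_plus, Rpower_1, Rpower_pow by lra.
  unfold ypt. field. split; [lra|split; [lra|]]. apply pow_nonzero; lra.
Qed.

(** The average of the terms of the left-hand side at t and 1 - t, the combination with a pure
    cosine expansion. *)
Definition sym_term (t : R) (n : nat) : R :=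
  / INR (S n) * ((exp (- (t * ypt n)) + exp (- ((1 - t) * ypt n))) / (2 * (1 - exp (- ypt n)))).

Lemma kern_fourier n (r q : nat) : (1 <= r <= q)%nat ->
  is_lim_seq (Rsum (fun k => cos (2 * PI * INR (S k) * (INR r / INR q)) * kern n k))
    (sym_term (INR r / INR q) n - / INR (S n) * (1 / ypt n)).
Proof.
  intros Hr. pose proof (partial_fractions_real (ypt n) r q (ypt_pos n) Hr) as H.
  apply (is_lim_seq_scal_l _ (/ INR (S n))) in H.
  match type of H with is_lim_seq ?u _ => apply (is_lim_seq_ext u) end.
  - intros K. rewrite <- Rsum_scal. apply Rsum_ext. intros k _. unfold kern. ring.
  - evar_last; [exact H|]. unfold sym_term. set (c := / INR (S n)). simpl. f_equal. unfold Rdiv. ring.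
Qed.

(** From e^u >= u the exponential is at most 1/(t n x), and 1 - e^(-y) is at least 1 - e^(-x);
    together with the factor 1/n this is of order n^(-2). *)
Lemma ex_series_exp_term t : 0 < t ->
  ex_series (fun n => / INR (S n) * (exp (- (t * ypt n)) / (1 - exp (- ypt n)))).
Proof.
  intros Ht.
  apply ex_series_dominated with (fun n => 1 / (t * (1 - exp (- x)) * x) * / INR (S n) ^ 2); [|apply ex_series_scal_inv_sqr].
  intros n. pose proof (ypt_pos n) as Hy. pose proof (ypt_ge n) as Hg. pose proof (INR_S_ge_1 n) as HS.
  pose proof (exp_neg_lt_1 x Hx) as E1.
  assert (E2 : exp (- ypt n) <= exp (- x)) by (apply exp_le; nra).
  assert (E3 : exp (- (t * ypt n)) <= 1 / (t * (INR (S n) * x))).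
  { assert (Hp : 0 < t * (INR (S n) * x)) by (repeat apply Rmult_lt_0_compat; lra).
    apply Rle_trans with (exp (- (t * (INR (S n) * x)))); [apply exp_le; nra|].
    rewrite exp_Ropp. unfold Rdiv. rewrite Rmult_1_l. apply Rinv_le_contravar; [exact Hp|].
    pose proof (exp_ineq1_le (t * (INR (S n) * x))). lra. }
  pose proof (exp_pos (- (t * ypt n))).
  rewrite Rabs_pos_eq.
  - apply Rle_trans with (/ INR (S n) * (1 / (t * (INR (S n) * x)) * / (1 - exp (- x)))).
    + apply Rmult_le_compat_l; [left; apply Rinv_0_lt_compat; lra|].
      apply Rmult_le_compat; [lra|left; apply Rinv_0_lt_compat; lra|exact E3|].
      apply Rinv_le_contravar; lra.
    + right. field. lra.
  - apply Rmult_le_pos; [left; apply Rinv_0_lt_compat; lra|].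
    apply Rmult_le_pos; [lra|left; apply Rinv_0_lt_compat; lra].
Qed.

Lemma sym_term_split t n : sym_term t n =
  / 2 * (/ INR (S n) * (exp (- (t * ypt n)) / (1 - exp (- ypt n))) +
         / INR (S n) * (exp (- ((1 - t) * ypt n)) / (1 - exp (- ypt n)))).
Proof.
  unfold sym_term. pose proof (exp_neg_lt_1 _ (ypt_pos n)). pose proof (INR_S_ge_1 n). field. lra.
Qed.

Lemma Series_sym_term t : 0 < t < 1 ->
  ex_series (sym_term t) /\ Series (sym_term t) =
  / 2 * (Series (fun n => / INR (S n) * (exp (- (t * ypt n)) / (1 - exp (- ypt n)))) +
         Series (fun n => / INR (S n) * (exp (- ((1 - t) * ypt n)) / (1 - exp (- ypt n))))).
Proof.
  intros Ht. pose proof (ex_series_exp_term t ltac:(lra)) as E1. pose proof (ex_series_exp_term (1 - t) ltac:(lra)) as E2.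
  split.
  - eapply ex_series_ext; [intros n; symmetry; apply sym_term_split|].
    apply (@ex_series_scal R_AbsRing R_NormedModule). now apply (@ex_series_plus R_AbsRing R_NormedModule).
  - rewrite (Series_ext _ _ (sym_term_split t)). rewrite Series_scal_l. f_equal.
    apply Series_plus; assumption.
Qed.

(** For fixed r with 0 < r < q the sums of cos(2 pi k r/q) are bounded by 1/sin(pi r/q), and [kern]
    decreases in k. Summation by parts bounds every partial sum over k by a constant times
    [kern n 0], which is of order n^(-2) uniformly in the number of terms; this justifies exchanging
    the two sums. *)
Lemma kern_sum_fourier (r q : nat) : (1 <= r < q)%nat ->
  is_lim_seq (Rsum (fun k => cos (2 * PI * INR (S k) * (INR r / INR q)) * kern_sum k))
    (Series (sym_term (INR r / INR q)) - zeta_real (INR N + 1) / x).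
Proof.
  intros Hr. set (t := INR r / INR q). pose proof PI_RGT_0 as HPI.
  assert (Hq : 0 < INR q) by (apply lt_0_INR; lia).
  assert (Ht : 0 < t < 1).
  { unfold t. split; [apply Rdiv_lt_0_compat; [apply lt_0_INR; lia|exact Hq]|].
    apply Rmult_lt_reg_r with (INR q); [exact Hq|]. unfold Rdiv. rewrite Rmult_assoc, Rinv_l by lra.
    destruct Hr as [_ Hr]. apply lt_INR in Hr. lra. }
  set (a := fun K n => Rsum (fun k => cos (2 * PI * INR (S k) * t) * kern n k) K).
  set (C := / sin (2 * PI * t / 2)).
  assert (Hlim : is_lim_seq (fun K => Series (a K)) (Series (fun n => sym_term t n - / INR (S n) * (1 / ypt n)))).
  { apply dominated_Series with (fun n => (C * (2 / x)) * / INR (S n) ^ 2).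
    - intros K n. unfold a.
      assert (HC : forall m, Rabs (Rsum (fun k => cos (2 * PI * INR (S k) * t)) m) <= C).
      { intros m. rewrite (Rsum_ext _ (fun k => cos (INR (S k) * (2 * PI * t)))) by (intros; f_equal; ring).
        apply dirichlet_cos_bound. nra. }
      eapply Rle_trans; [apply (dirichlet_test_bound _ (kern n) C); [exact HC|apply kern_nonneg|apply kern_decr]|].
      rewrite Rmult_assoc. apply Rmult_le_compat_l; [|apply kern_0_le].
      eapply Rle_trans; [apply Rabs_pos|apply (HC O)].
    - apply ex_series_scal_inv_sqr.
    - intros n. apply kern_fourier. lia. }
  rewrite Series_minus in Hlim by (apply Series_sym_term, Ht || apply ex_series_inv_ypt).
  rewrite Series_inv_ypt in Hlim.
  eapply is_lim_seq_ext; [|exact Hlim].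
  intros K. unfold a.
  destruct (Series_Rsum_swap (fun n k => cos (2 * PI * INR (S k) * t) * kern n k) K) as [_ E].
  { intros k _. apply (@ex_series_scal R_AbsRing R_NormedModule). apply ex_series_kern. }
  rewrite E. apply Rsum_ext. intros k _. apply Series_scal_l.
Qed.
End Kernel.

(** * The arctangent integral and Euler's constant *)

Definition atan_quot (s : R) : R := if Req_EM_T s 0 then 1 else atan s / s.

Lemma atan_quot_neq s : s <> 0 -> atan_quot s = atan s / s.
Proof. intros H. unfold atan_quot. destruct (Req_EM_T s 0); [contradiction|reflexivity]. Qed.

Lemma atan_quot_pos s : 0 < s -> 0 < atan_quot s <= 1.
Proof.
  intros Hs. rewrite atan_quot_neq by lra.
  destruct (MVT_gen atan 0 s (fun u => / (1 + u ^ 2))) as (c & Hc & E).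
  - intros u _. auto_derive; [easy|]. field. nra.
  - intros u _. apply derivable_continuous_pt, derivable_pt_atan.
  - rewrite atan_0 in E. replace (atan s / s) with (/ (1 + c ^ 2)) by (rewrite Rminus_0_r in E; rewrite E; field; split; [nra|lra]).
    assert (1 <= 1 + c ^ 2) by nra. split; [apply Rinv_0_lt_compat; lra|].
    rewrite <- Rinv_1. apply Rinv_le_contravar; lra.
Qed.

Lemma continuous_atan_quot s : continuous atan_quot s.
Proof.
  destruct (Req_EM_T s 0) as [->|Hs].
  - apply filterlim_locally. intros eps.
    pose proof (derivable_pt_lim_atan 0) as H.
    destruct (H eps (cond_pos eps)) as [d Hd]. exists d. intros u Hu.
    unfold ball in *; simpl in *; unfold AbsRing_ball, abs, minus, plus, opp in *; simpl in *.
    unfold atan_quot at 2. destruct (Req_EM_T 0 0) as [_|Z]; [|now elim Z].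
    unfold atan_quot. destruct (Req_EM_T u 0) as [_|Z].
    + rewrite Rplus_opp_r, Rabs_R0. apply cond_pos.
    + specialize (Hd u Z). replace (u + - 0) with u in Hu by ring. specialize (Hd Hu).
      rewrite Rplus_0_l, atan_0 in Hd.
      replace (atan u / u + - (1)) with ((atan u - 0) / u - / (1 + 0 * (0 * 1))) by (field; exact Z).
      exact Hd.
  - apply continuous_ext_loc with (fun u => atan u / u).
    + assert (Hp : 0 < Rabs s) by now apply Rabs_pos_lt.
      exists (mkposreal _ Hp). intros u Hu.
      unfold ball in Hu; simpl in Hu; unfold AbsRing_ball, abs, minus, plus, opp in Hu; simpl in Hu.
      symmetry. apply atan_quot_neq. intros ->. rewrite Rplus_0_l, Rabs_Ropp in Hu. lra.
    + apply (ex_derive_continuous (fun u => atan u / u)). auto_derive. exact Hs.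
Qed.

(** The inverse tangent integral. *)
Definition atan_int (u : R) : R := RInt atan_quot 0 u.

Lemma is_derive_atan_int u : is_derive atan_int u (atan_quot u).
Proof.
  unfold atan_int. apply (is_derive_RInt atan_quot (RInt atan_quot 0) 0 u).
  - exists (mkposreal 1 Rlt_0_1). intros v _. apply (@RInt_correct R_CompleteNormedModule).
    apply (@ex_RInt_continuous R_CompleteNormedModule). intros; apply continuous_atan_quot.
  - apply continuous_atan_quot.
Qed.

Lemma atan_int_bound u : 0 <= u -> Rabs (atan_int u) <= u.
Proof.
  intros Hu. destruct Hu as [Hu|<-].
  2: { unfold atan_int. rewrite RInt_point. unfold zero; simpl. rewrite Rabs_R0. lra. }
  destruct (MVT_cor2 atan_int atan_quot 0 u Hu) as (c & E & Hc).
  - intros c _. apply is_derive_Reals, is_derive_atan_int.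
  - assert (E0 : atan_int 0 = 0) by (unfold atan_int; rewrite RInt_point; reflexivity).
    rewrite E0 in E. replace (atan_int u) with (atan_quot c * u) by lra.
    destruct (atan_quot_pos c ltac:(lra)). rewrite Rabs_pos_eq; nra.
Qed.

(** The relation atan c + atan(1/c) = pi/2 makes the difference of the two sides constant. For large
    u the formula replaces the integral by a logarithm, up to at most 1/u; this is the origin of the
    logarithms in the case q = 1. *)
Lemma atan_int_inv u : 0 < u -> atan_int u = atan_int (/ u) + PI / 2 * ln u.
Proof.
  intros Hu. set (F := fun u => atan_int u - atan_int (/ u) - PI / 2 * ln u).
  assert (HD : forall c, 0 < c -> is_derive F c 0).
  { intros c Hc. unfold F.
    assert (D : is_derive (fun u => atan_int (/ u)) c (- / c ^ 2 * atan_quot (/ c))).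
    { apply (is_derive_comp atan_int (fun u => / u)); [apply is_derive_atan_int|].
      auto_derive; [lra|]. field. lra. }
    assert (D2 : is_derive (fun u => PI / 2 * ln u) c (PI / 2 * / c)).
    { auto_derive; [lra|]. field. lra. }
    pose proof (@is_derive_minus R_AbsRing R_NormedModule _ _ _ _ _
      (@is_derive_minus R_AbsRing R_NormedModule _ _ _ _ _ (is_derive_atan_int c) D) D2) as H.
    unfold minus, plus, opp in H; simpl in H.
    evar_last; [exact H|].
    assert (Hi : 0 < / c) by now apply Rinv_0_lt_compat.
    rewrite !atan_quot_neq by lra. rewrite atan_inv by exact Hc. field. lra. }
  assert (E : F u = F 1).
  { destruct (MVT_gen F 1 u (fun _ => 0)) as (c & _ & E).
    - intros v Hv. apply HD. pose proof (Rmin_glb_lt 1 u 0 ltac:(lra) Hu). lra.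
    - intros v Hv. apply continuity_pt_filterlim. apply (ex_derive_continuous F). exists 0. apply HD.
      pose proof (Rmin_glb_lt 1 u 0 ltac:(lra) Hu). lra.
    - lra. }
  unfold F in E. rewrite ln_1, Rinv_1 in E. lra.
Qed.

(** Difference between 1/(n+1) and the integral of 1/v over [n+1, n+2]; the sum over n is Euler's
    constant. *)
Definition gamma_term (n : nat) : R := / INR (S n) - (ln (INR (S (S n))) - ln (INR (S n))).

Section AtanSum.
Variable N : nat.
Hypothesis HN : (1 <= N)%nat.

Definition ats (B v : R) : R := atan (B / v ^ N) / v.
(** A primitive of [ats B], by the substitution s = B/v^N, normalised to vanish at infinity. *)
Definition ats_prim (B v : R) : R := - / INR N * atan_int (B / v ^ N).
Definition ats_err (B : R) (n : nat) : R :=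
  ats B (INR (S n)) - (ats_prim B (INR (S (S n))) - ats_prim B (INR (S n))).

Lemma is_derive_quot_pow B v : 0 < v -> is_derive (fun v => B / v ^ N) v (- INR N * (B / v ^ N) / v).
Proof.
  intros Hv. assert (Hp : v ^ N <> 0) by (apply pow_nonzero; lra).
  auto_derive; [exact Hp|].
  replace (v ^ N) with (v * v ^ pred N) by (destruct N; [lia|reflexivity]).
  assert (v ^ pred N <> 0) by (apply pow_nonzero; lra). field. split; lra || auto.
Qed.

Lemma is_derive_ats_prim B v : 0 < B -> 0 < v -> is_derive (ats_prim B) v (ats B v).
Proof.
  intros HB Hv. unfold ats_prim.
  assert (HNr : 0 < INR N) by (apply lt_0_INR; lia).
  assert (Hp : 0 < v ^ N) by now apply pow_lt.
  assert (Hw : 0 < B / v ^ N) by now apply Rdiv_lt_0_compat.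
  pose proof (is_derive_comp atan_int (fun v => B / v ^ N) v _ _ (is_derive_atan_int _) (is_derive_quot_pow B v Hv)) as D.
  apply (is_derive_scal _ _ (- / INR N)) in D.
  evar_last; [exact D|]. unfold scal; simpl; unfold mult; simpl.
  rewrite atan_quot_neq by lra. unfold ats. set (w := B / v ^ N) in *. field. lra.
Qed.

Lemma is_derive_ats B v : 0 < B -> 0 < v ->
  is_derive (ats B) v (- (INR N * (B / v ^ N) / (1 + (B / v ^ N) ^ 2) + atan (B / v ^ N)) / v ^ 2).
Proof.
  intros HB Hv. unfold ats.
  assert (D1 : is_derive (fun v => atan (B / v ^ N)) v (- INR N * (B / v ^ N) / v * / (1 + (B / v ^ N) ^ 2))).
  { apply (is_derive_comp atan (fun v => B / v ^ N)); [|now apply is_derive_quot_pow].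
    auto_derive; [easy|]. set (w := B / v ^ N). field. nra. }
  assert (D2 : is_derive (fun v => / v) v (- / v ^ 2)).
  { auto_derive; [lra|]. field. lra. }
  pose proof (is_derive_mult_R _ _ _ _ _ D1 D2) as D.
  evar_last; [exact D|]. cbv beta. set (w := B / v ^ N). field. repeat split; nra.
Qed.

(** The mean value theorem is applied twice: the integral over the unit interval is a value of
    [ats B], and the derivative of [ats B] is at most (N + pi/2)/v^2, since w/(1 + w^2) and atan w
    are bounded. The bound does not involve B, so B may later tend to infinity under the sum. *)
Lemma ats_err_bound B n : 0 < B -> Rabs (ats_err B n) <= (INR N + PI / 2) * / INR (S n) ^ 2.
Proof.
  intros HB. unfold ats_err.
  assert (Hn : 1 <= INR (S n)) by apply INR_S_ge_1.
  rewrite (S_INR (S n)). set (v := INR (S n)) in *.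
  destruct (MVT_gen (ats_prim B) v (v + 1) (ats B)) as (c & Hc & E).
  - rewrite Rmin_left, Rmax_right by lra. intros u Hu. apply is_derive_ats_prim; lra.
  - rewrite Rmin_left, Rmax_right by lra. intros u Hu. apply continuity_pt_filterlim.
    apply (ex_derive_continuous (ats_prim B)). eexists. apply is_derive_ats_prim; lra.
  - rewrite Rmin_left, Rmax_right in Hc by lra. rewrite E.
    destruct (MVT_gen (ats B) v c (fun v => - (INR N * (B / v ^ N) / (1 + (B / v ^ N) ^ 2) + atan (B / v ^ N)) / v ^ 2)) as (d & Hd & E2).
    + rewrite Rmin_left, Rmax_right by lra. intros u Hu. apply is_derive_ats; lra.
    + rewrite Rmin_left, Rmax_right by lra. intros u Hu. apply continuity_pt_filterlim.
      apply (ex_derive_continuous (ats B)). eexists. apply is_derive_ats; lra.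
    + rewrite Rmin_left, Rmax_right in Hd by lra.
      assert (Hw : 0 < B / d ^ N) by (apply Rdiv_lt_0_compat; [exact HB|apply pow_lt; lra]).
      set (w := B / d ^ N) in *.
      assert (Ha : 0 <= atan w <= PI / 2).
      { pose proof (atan_bound w). assert (atan 0 < atan w) by now apply atan_increasing. rewrite atan_0 in *. lra. }
      assert (Hq : 0 <= w / (1 + w ^ 2) <= 1).
      { assert (0 < 1 + w ^ 2) by nra. split; [apply Rmult_le_pos; [lra|left; now apply Rinv_0_lt_compat]|].
        apply Rmult_le_reg_r with (1 + w ^ 2); [assumption|]. unfold Rdiv. rewrite Rmult_assoc, Rinv_l by lra. nra. }
      replace (ats B v - ats B c * (v + 1 - v)) with ((INR N * (w / (1 + w ^ 2)) + atan w) * / d ^ 2 * (c - v)).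
      2: { replace (ats B v - ats B c * (v + 1 - v)) with (- (ats B c - ats B v)) by ring. rewrite E2. field. repeat split; nra. }
      pose proof (pos_INR N) as HNp.
      assert (Hd2 : 0 < / d ^ 2 <= / v ^ 2).
      { split; [apply Rinv_0_lt_compat, pow_lt; lra|]. apply Rinv_le_contravar; [apply pow_lt; lra|apply pow_incr; lra]. }
      assert (HM : 0 <= INR N * (w / (1 + w ^ 2)) + atan w <= INR N + PI / 2) by nra.
      set (m := INR N * (w / (1 + w ^ 2)) + atan w) in *.
      assert (Hm1 : 0 <= m * / d ^ 2 <= (INR N + PI / 2) * / v ^ 2).
      { split; [apply Rmult_le_pos; lra|apply Rmult_le_compat; lra]. }
      rewrite Rabs_pos_eq; [|apply Rmult_le_pos; lra].
      apply Rle_trans with (m * / d ^ 2 * 1); [apply Rmult_le_compat_l; lra|lra].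
Qed.

(** The integral over [1, infinity) is [atan_int B] divided by N, the primitive vanishing at
    infinity; the rest is the sum of the differences between terms and integrals. *)
Lemma ats_sum_eq B : 0 < B ->
  is_lim_seq (Rsum (fun n => ats B (INR (S n)))) (Series (ats_err B) + / INR N * atan_int B).
Proof.
  intros HB. assert (HNr : 0 < INR N) by (apply lt_0_INR; lia).
  assert (Hs : ex_series (ats_err B)).
  { apply ex_series_dominated with (fun n => (INR N + PI / 2) * / INR (S n) ^ 2); [|apply ex_series_scal_inv_sqr].
    intros n. now apply ats_err_bound. }
  apply Series_correct, is_series_Rsum in Hs.
  apply (is_lim_seq_ext (fun M => Rsum (ats_err B) M + (/ INR N * atan_int B + ats_prim B (INR (S M))))).
  - intros M. induction M as [|M IH].
    + simpl Rsum. unfold ats_prim. simpl INR. rewrite pow1, Rdiv_1_r. ring.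
    + cbn [Rsum]. rewrite <- IH. unfold ats_err. ring.
  - apply is_lim_seq_plus'; [exact Hs|].
    replace (Finite (/ INR N * atan_int B)) with (Finite (/ INR N * atan_int B + 0)) by (f_equal; ring).
    apply is_lim_seq_plus'; [apply is_lim_seq_const|].
    apply is_lim_seq_squeeze_0 with (fun M => / INR N * B * / INR (S M)).
    + intros M. assert (H1 : 1 <= INR (S M)) by apply INR_S_ge_1. unfold ats_prim.
      rewrite Rabs_mult, Rabs_Ropp, (Rabs_pos_eq (/ INR N)) by (left; now apply Rinv_0_lt_compat).
      rewrite Rmult_assoc. apply Rmult_le_compat_l; [left; now apply Rinv_0_lt_compat|].
      assert (Hp : 0 < INR (S M) ^ N) by (apply pow_lt; lra).
      eapply Rle_trans; [apply atan_int_bound; left; now apply Rdiv_lt_0_compat|].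
      apply Rmult_le_compat_l; [lra|]. apply Rinv_le_contravar; [lra|].
      rewrite <- (pow_1 (INR (S M))) at 1. apply Rle_pow; [lra|lia].
    + replace (Finite 0) with (Rbar_mult (/ INR N * B) 0) by (simpl; f_equal; ring).
      apply is_lim_seq_scal_l. apply (is_lim_seq_incr_1 (fun n => / INR n)), is_lim_seq_inv_INR.
Qed.

Lemma atan_int_inv_lim (B : nat -> R) : (forall K, 0 < B K) -> is_lim_seq B p_infty ->
  is_lim_seq (fun K => atan_int (/ B K)) 0.
Proof.
  intros HB HBi. apply is_lim_seq_squeeze_0 with (fun K => / B K).
  - intros K. apply atan_int_bound. left. now apply Rinv_0_lt_compat.
  - replace (Finite 0) with (Rbar_inv p_infty) by reflexivity. apply is_lim_seq_inv; [exact HBi|discriminate].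
Qed.

Lemma atan_lim (B : nat -> R) : is_lim_seq B p_infty -> (forall K, 0 < B K) -> is_lim_seq (fun K => atan (B K)) (PI / 2).
Proof.
  intros HBi HB. apply (is_lim_seq_ext (fun K => PI / 2 - atan (/ B K))).
  - intros K. rewrite atan_inv by apply HB. ring.
  - replace (Finite (PI / 2)) with (Finite (PI / 2 - atan 0)) by (f_equal; rewrite atan_0; ring).
    apply is_lim_seq_minus'; [apply is_lim_seq_const|].
    apply (is_lim_seq_continuous atan (fun K => / B K) 0).
    + apply derivable_continuous_pt, derivable_pt_atan.
    + replace (Finite 0) with (Rbar_inv p_infty) by reflexivity. apply is_lim_seq_inv; [exact HBi|discriminate].
Qed.

Lemma lim_div_p_infty (B : nat -> R) c : is_lim_seq B p_infty -> 0 < c -> is_lim_seq (fun K => B K / c) p_infty.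
Proof.
  intros HB Hc. assert (Hi : 0 < / c) by now apply Rinv_0_lt_compat.
  replace p_infty with (Rbar_mult p_infty (/ c)).
  - now apply is_lim_seq_scal_r.
  - apply is_Rbar_mult_unique. now apply is_Rbar_mult_p_infty_pos.
Qed.

(** After inversion the logarithms of B cancel between the two values of the primitive, and the N in
    ln(v^N) cancels the factor 1/N, so the limit is independent of N. *)
Lemma ats_err_lim (B : nat -> R) n : (forall K, 0 < B K) -> is_lim_seq B p_infty ->
  is_lim_seq (fun K => ats_err (B K) n) (PI / 2 * gamma_term n).
Proof.
  intros HB HBi. assert (HNr : 0 < INR N) by (apply lt_0_INR; lia).
  unfold gamma_term. set (u := INR (S n)). set (v := INR (S (S n))).
  assert (Hu : 0 < u) by (apply lt_0_INR; lia). assert (Hv : 0 < v) by (apply lt_0_INR; lia).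
  assert (Hup : 0 < u ^ N) by now apply pow_lt. assert (Hvp : 0 < v ^ N) by now apply pow_lt.
  apply (is_lim_seq_ext (fun K => atan (B K / u ^ N) * / u -
    (PI / 2 * (ln v - ln u) + / INR N * (atan_int (/ (B K / u ^ N)) - atan_int (/ (B K / v ^ N)))))).
  - intros K. unfold ats_err, ats, ats_prim. fold u v. specialize (HB K).
    rewrite (atan_int_inv (B K / u ^ N)), (atan_int_inv (B K / v ^ N)) by now apply Rdiv_lt_0_compat.
    assert (EL : forall c, 0 < c -> ln (B K / c ^ N) = ln (B K) - INR N * ln c).
    { intros c Hc. assert (0 < c ^ N) by now apply pow_lt.
      unfold Rdiv. rewrite ln_mult, ln_Rinv, ln_pow by (auto; now apply Rinv_0_lt_compat). ring. }
    rewrite !EL by assumption. field. lra.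
  - replace (PI / 2 * (/ u - (ln v - ln u))) with (PI / 2 * / u - (PI / 2 * (ln v - ln u) + / INR N * (0 - 0))) by ring.
    apply is_lim_seq_minus'.
    + apply is_lim_seq_mult'; [|apply is_lim_seq_const].
      apply atan_lim; [now apply lim_div_p_infty|intros; now apply Rdiv_lt_0_compat].
    + apply is_lim_seq_plus'; [apply is_lim_seq_const|].
      apply is_lim_seq_mult'; [apply is_lim_seq_const|].
      apply is_lim_seq_minus'; apply atan_int_inv_lim; (now apply lim_div_p_infty) || (intros; now apply Rdiv_lt_0_compat).
Qed.

(** The uniform bound on [ats_err] allows the limit under the sum, and also passes to the limit
    terms, which yields the summability of [gamma_term]. The logarithm of B comes from
    [atan_int_inv]. *)
Lemma ats_sum_asymp (B : nat -> R) : (forall K, 0 < B K) -> is_lim_seq B p_infty ->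
  ex_series gamma_term /\
  is_lim_seq (fun K => Series (fun n => ats (B K) (INR (S n))) - PI / 2 * / INR N * ln (B K)) (PI / 2 * Series gamma_term).
Proof.
  intros HB HBi. assert (HNr : 0 < INR N) by (apply lt_0_INR; lia). pose proof PI_RGT_0 as HPI.
  assert (Hb : forall K n, Rabs (ats_err (B K) n) <= (INR N + PI / 2) * / INR (S n) ^ 2) by (intros; now apply ats_err_bound).
  assert (Hl : forall n, is_lim_seq (fun K => ats_err (B K) n) (PI / 2 * gamma_term n)) by (intros; now apply ats_err_lim).
  assert (Hex : ex_series (fun n => PI / 2 * gamma_term n)).
  { apply ex_series_dominated with (fun n => (INR N + PI / 2) * / INR (S n) ^ 2); [|apply ex_series_scal_inv_sqr].
    intros n. apply (is_lim_seq_le (fun K => Rabs (ats_err (B K) n)) (fun _ => (INR N + PI / 2) * / INR (S n) ^ 2)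
      (Rabs (PI / 2 * gamma_term n)) ((INR N + PI / 2) * / INR (S n) ^ 2)).
    - intros K. apply Hb.
    - apply (is_lim_seq_abs _ (PI / 2 * gamma_term n)). apply Hl.
    - apply is_lim_seq_const. }
  split.
  - apply (ex_series_ext (fun n => scal (2 / PI) (PI / 2 * gamma_term n))).
    + intros n. unfold scal; simpl; unfold mult; simpl. field. lra.
    + now apply (@ex_series_scal R_AbsRing R_NormedModule).
  - rewrite <- Series_scal_l.
    apply (is_lim_seq_ext (fun K => Series (ats_err (B K)) + / INR N * atan_int (/ B K))).
    + intros K. rewrite (Series_Rsum _ _ (ats_sum_eq (B K) (HB K))).
      rewrite (atan_int_inv (B K) (HB K)). ring.
    + replace (Finite (Series (fun n => PI / 2 * gamma_term n))) with (Finite (Series (fun n => PI / 2 * gamma_term n) + / INR N * 0)) by (f_equal; ring).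
      apply is_lim_seq_plus'.
      * apply dominated_Series with (fun n => (INR N + PI / 2) * / INR (S n) ^ 2); auto. apply ex_series_scal_inv_sqr.
      * apply is_lim_seq_mult'; [apply is_lim_seq_const|]. now apply atan_int_inv_lim.
Qed.
End AtanSum.

Lemma harmonic_Rsum n : sum_n_m (fun k => / INR k) 1 n = Rsum (fun k => / INR (S k)) n.
Proof.
  induction n as [|n IH]; [now rewrite sum_n_m_zero by lia|].
  rewrite sum_n_Sm by lia. rewrite IH. reflexivity.
Qed.

(** The partial sums of [gamma_term] are H_K - ln(K + 1); passing to ln K adds ln(1 + 1/K), which
    tends to 0. *)
Lemma harmonic_lim : ex_series gamma_term ->
  is_lim_seq (fun K => Rsum (fun k => / INR (S k)) K - ln (INR K)) euler_gamma /\ Series gamma_term = euler_gamma.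
Proof.
  intros Hs. apply Series_correct, is_series_Rsum in Hs.
  assert (H : is_lim_seq (fun K => Rsum (fun k => / INR (S k)) K - ln (INR K)) (Series gamma_term)).
  { apply (is_lim_seq_ext_loc (fun K => Rsum gamma_term K + ln (1 + / INR K))).
    - exists 1%nat. intros K HK.
      assert (E : Rsum gamma_term K = Rsum (fun k => / INR (S k)) K - ln (INR (S K))).
      { clear HK. induction K as [|K IH]; [simpl; rewrite ln_1; ring|]. cbn [Rsum]. rewrite IH. unfold gamma_term. ring. }
      assert (0 < INR K) by (apply lt_0_INR; lia).
      assert (0 < / INR K) by now apply Rinv_0_lt_compat.
      rewrite E, S_INR. replace (INR K + 1) with (INR K * (1 + / INR K)) by (field; lra).
      rewrite ln_mult by lra. ring.
    - replace (Finite (Series gamma_term)) with (Finite (Series gamma_term + ln (1 + 0))) by (f_equal; rewrite Rplus_0_r, ln_1; ring).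
      apply is_lim_seq_plus'; [exact Hs|].
      apply (is_lim_seq_continuous ln (fun K => 1 + / INR K)).
      + apply continuity_pt_filterlim. apply (ex_derive_continuous ln). auto_derive. lra.
      + apply is_lim_seq_plus'; [apply is_lim_seq_const|apply is_lim_seq_inv_INR]. }
  assert (E : euler_gamma = Series gamma_term).
  { unfold euler_gamma. apply is_lim_seq_unique in H.
    rewrite (Lim_seq_ext _ (fun K => Rsum (fun k => / INR (S k)) K - ln (INR K))) by (intros; now rewrite harmonic_Rsum).
    now rewrite H. }
  rewrite E. split; [exact H|reflexivity].
Qed.

(** * The double series for q = 1 *)

Section KernelTrivial.
Variables (x : R) (N : nat).
Hypothesis Hx : 0 < x.
Hypothesis HN : (1 <= N)%nat.

(** With all cosines equal to 1 there is no cancellation in k, so the sum is compared with its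
    integral over [0, K], which is the arctangent term. The integrand [G] decreases, hence the two
    differ by at most its value at 0, of order n^(-2) uniformly in K. *)
Lemma kern_atan_bound n K :
  Rabs (Rsum (fun k => kern x N n k) K - / PI * ats N (2 * PI * INR K / x) (INR (S n))) <= 2 / x * / INR (S n) ^ 2.
Proof.
  pose proof PI_RGT_0 as HPI. pose proof (ypt_pos x N Hx HN n) as Hy.
  assert (Hn : 1 <= INR (S n)) by apply INR_S_ge_1.
  set (y := ypt x N n) in *. set (v := INR (S n)) in *.
  set (G := fun u => / v * (2 * y / (y ^ 2 + (2 * PI * u) ^ 2))).
  set (P := fun u => / PI * (atan (2 * PI * u / y) / v)).
  assert (HP : forall u, is_derive P u (G u)).
  { intros u. unfold P, G. assert (0 < y ^ 2) by (apply pow_lt; lra).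
    pose proof (pow2_ge_0 (2 * PI * u)). auto_derive; [easy|]. field.
    repeat split; try lra; nra. }
  assert (HG : forall u w, 0 <= u <= w -> G w <= G u).
  { intros u w Hu. unfold G. apply Rmult_le_compat_l; [left; apply Rinv_0_lt_compat; lra|].
    apply Rmult_le_compat_l; [lra|]. assert (0 < y ^ 2) by (apply pow_lt; lra). pose proof (pow2_ge_0 (2 * PI * u)).
    apply Rinv_le_contravar; [lra|]. apply Rplus_le_compat_l, pow_incr. nra. }
  assert (HPK : P (INR K) = / PI * ats N (2 * PI * INR K / x) v).
  { unfold P, ats. do 3 f_equal. unfold y, ypt. fold v. field. split; [lra|apply pow_nonzero; lra]. }
  rewrite <- HPK.
  assert (HB : G (INR K) - G 0 <= Rsum (fun k => kern x N n k) K - P (INR K) <= 0).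
  { clear HPK. induction K as [|K IH].
    - simpl. unfold P. rewrite Rmult_0_r, Rdiv_0_l, atan_0. lra.
    - cbn [Rsum]. replace (kern x N n K) with (G (INR (S K))) by reflexivity.
      pose proof (pos_INR K) as HK. rewrite S_INR in *.
      destruct (MVT_gen P (INR K) (INR K + 1) G) as (c & Hc & E).
      + intros; apply HP.
      + intros u _. apply continuity_pt_filterlim. apply (ex_derive_continuous P). eexists; apply HP.
      + rewrite Rmin_left, Rmax_right in Hc by lra.
        pose proof (HG (INR K) c ltac:(lra)). pose proof (HG c (INR K + 1) ltac:(lra)). lra. }
  assert (HG0 : 0 <= G (INR K)).
  { unfold G. apply Rmult_le_pos; [left; apply Rinv_0_lt_compat; lra|]. apply Rmult_le_pos; [lra|].
    left. apply Rinv_0_lt_compat. assert (0 < y ^ 2) by (apply pow_lt; lra). pose proof (pow2_ge_0 (2 * PI * INR K)). lra. }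
  assert (G 0 <= 2 / x * / v ^ 2).
  { replace (G 0) with (/ v * (2 / y)) by (unfold G; field; lra). apply (inv_ypt_le x N Hx HN). lra. }
  apply Rabs_le. lra.
Qed.

(** Subtracting the integrals allows the exchange of sums; they are then restored through
    [ats_sum_asymp]. Euler's constant enters twice, as gamma/2 from the arctangents and as
    -gamma/(2N) from the harmonic sum, whence the factor 1 - N. The divergent ln K cancels between
    the same two sources and leaves ln(2 pi) - ln x. *)
Lemma kern_sum_trivial :
  is_lim_seq (fun K => Rsum (fun k => kern_sum x N k - / (2 * INR N * INR (S k))) K)
    (Series (fun n => / INR (S n) * (exp (- (1 * ypt x N n)) / (1 - exp (- ypt x N n)))) - zeta_real (INR N + 1) / x -
     / (2 * INR N) * (euler_gamma * (1 - INR N) - ln (2 * PI) + ln x)).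
Proof.
  pose proof PI_RGT_0 as HPI. assert (HNr : 0 < INR N) by (apply lt_0_INR; lia).
  set (B := fun K => 2 * PI * INR K / x).
  set (a := fun K n => Rsum (fun k => kern x N n k) K - / PI * ats N (B K) (INR (S n))).
  set (T := fun n => / INR (S n) * (exp (- (1 * ypt x N n)) / (1 - exp (- ypt x N n)))).
  assert (HBi : is_lim_seq B p_infty).
  { apply lim_div_p_infty; [|exact Hx].
    replace p_infty with (Rbar_mult (2 * PI) p_infty).
    - apply is_lim_seq_scal_l. apply is_lim_seq_INR.
    - apply is_Rbar_mult_unique. apply is_Rbar_mult_sym. apply is_Rbar_mult_p_infty_pos. simpl; lra. }
  (* [B 0] is 0, where the asymptotics do not apply, so all limits are taken along K + 1. *)
  assert (HBS : forall K, 0 < B (S K)).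
  { intros K. unfold B. apply Rdiv_lt_0_compat; [|exact Hx]. assert (0 < INR (S K)) by (apply lt_0_INR; lia). nra. }
  assert (HBSi : is_lim_seq (fun K => B (S K)) p_infty) by (apply (is_lim_seq_incr_1 B); exact HBi).
  assert (Hlim : is_lim_seq (fun K => Series (a (S K))) (Series (fun n => T n - / INR (S n) * (1 / ypt x N n)))).
  { apply dominated_Series with (fun n => 2 / x * / INR (S n) ^ 2).
    - intros K n. apply kern_atan_bound.
    - apply ex_series_scal_inv_sqr.
    - intros n. unfold a.
      assert (Hv : 0 < INR (S n)) by (apply lt_0_INR; lia).
      assert (Hvp : 0 < INR (S n) ^ N) by now apply pow_lt.
      pose proof (kern_fourier x N Hx HN n 1 1 ltac:(lia)) as KF.
      replace (INR 1 / INR 1) with 1 in KF by (simpl; field).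
      replace (T n - / INR (S n) * (1 / ypt x N n)) with (sym_term x N 1 n - / INR (S n) * (1 / ypt x N n) - / PI * (PI / 2 * / INR (S n))).
      2: { unfold T, sym_term. pose proof (exp_neg_lt_1 _ (ypt_pos x N Hx HN n)) as He.
           replace ((1 - 1) * ypt x N n) with 0 by ring. rewrite Ropp_0, exp_0, Rmult_1_l.
           pose proof (ypt_pos x N Hx HN n). field. lra. }
      apply is_lim_seq_minus'.
      + apply is_lim_seq_incr_1 in KF.
        eapply is_lim_seq_ext; [|exact KF]. intros K. apply Rsum_ext. intros k _. cbv beta.
        replace (2 * PI * INR (S k) * 1) with (0 + 2 * INR (S k) * PI) by ring. rewrite cos_period, cos_0. ring.
      + apply is_lim_seq_mult'; [apply is_lim_seq_const|]. unfold ats, Rdiv at 1.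
        apply is_lim_seq_mult'; [|apply is_lim_seq_const].
        apply atan_lim; [now apply lim_div_p_infty|]. intros K. now apply Rdiv_lt_0_compat. }
  assert (HT : ex_series T) by (apply (ex_series_exp_term x N Hx HN 1); lra).
  rewrite Series_minus in Hlim by (exact HT || now apply ex_series_inv_ypt).
  rewrite Series_inv_ypt in Hlim by (exact Hx || exact HN).
  destruct (ats_sum_asymp N HN (fun K => B (S K)) HBS HBSi) as [Hg Has].
  destruct (harmonic_lim Hg) as [Hh Eg]. rewrite Eg in Has.
  apply is_lim_seq_incr_1 in Hh.
  apply is_lim_seq_incr_1.
  set (A := fun K => Series (fun n => ats N (B (S K)) (INR (S n)))) in *.
  apply (is_lim_seq_ext (fun K => Series (a (S K)) + / PI * (A K - PI / 2 * / INR N * ln (B (S K))) -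
     / (2 * INR N) * (Rsum (fun k => / INR (S k)) (S K) - ln (INR (S K))) + / (2 * INR N) * (ln (2 * PI) - ln x))).
  - intros K. unfold a.
    destruct (Series_Rsum_swap (kern x N) (S K)) as [E1 E2]; [intros; now apply ex_series_kern|].
    assert (E3 : ex_series (fun n => ats N (B (S K)) (INR (S n)))).
    { eexists. apply is_series_Rsum. exact (ats_sum_eq N HN _ (HBS K)). }
    rewrite Series_minus; [|exact E1|now apply (@ex_series_scal R_AbsRing R_NormedModule)].
    change (fun n => Rsum (fun k => kern x N n k) (S K)) with (fun n => Rsum (kern x N n) (S K)).
    rewrite Series_scal_l, E2. fold (A K).
    assert (HK : 0 < INR (S K)) by (apply lt_0_INR; lia).
    assert (EB : ln (B (S K)) = ln (2 * PI) + ln (INR (S K)) - ln x).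
    { unfold B, Rdiv. rewrite ln_mult, ln_Rinv, ln_mult by (try apply Rinv_0_lt_compat; nra). ring. }
    rewrite EB.
    rewrite (Rsum_ext (fun k => kern_sum x N k - / (2 * INR N * INR (S k))) (fun k => kern_sum x N k + - / (2 * INR N) * / INR (S k))).
    + rewrite Rsum_plus, Rsum_scal. unfold kern_sum. field. lra.
    + intros k _. assert (0 < INR (S k)) by (apply lt_0_INR; lia). field. lra.
  - evar_last.
    + apply is_lim_seq_plus'; [|apply is_lim_seq_const].
      apply is_lim_seq_minus'; [apply is_lim_seq_plus'; [exact Hlim|]|].
      * apply is_lim_seq_mult'; [apply is_lim_seq_const|exact Has].
      * apply is_lim_seq_mult'; [apply is_lim_seq_const|exact Hh].
    + f_equal. field. lra.
Qed.
End KernelTrivial.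

(** * The finite sum over j *)

Lemma cis_PI_nat n : cis (PI * INR n) = RtoC ((-1) ^ n).
Proof.
  induction n as [|n IH]; [simpl; rewrite Rmult_0_r; apply cis_0|].
  rewrite S_INR, Rmult_plus_distr_l, Rmult_1_r, cis_plus, IH.
  rewrite cis_eq, cos_PI, sin_PI. rewrite <- tech_pow_Rmult. rewrite RtoC_mult.
  replace ((-1, 0) : CC) with (RtoC (-1)) by reflexivity. ring.
Qed.

Lemma cis_neg_PI_nat n : cis (- (PI * INR n)) = RtoC ((-1) ^ n).
Proof.
  rewrite cis_opp, cis_PI_nat, <- RtoC_inv by (apply pow_nonzero; lra). f_equal.
  rewrite <- pow_inv. f_equal. lra.
Qed.

Lemma alternating_sum h : Rsum (fun l => (-1) ^ l) (2 * h + 1) = 1.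
Proof.
  induction h as [|h IH]; [simpl; ring|].
  replace (2 * S h + 1)%nat with (S (S (2 * h + 1))) by lia. cbn [Rsum]. rewrite IH.
  replace (2 * h + 1)%nat with (S (2 * h)) by lia. rewrite <- !tech_pow_Rmult. ring.
Qed.

Lemma diff_pow_factor (T w : CC) (n : nat) :
  ((T - w) * Csum (fun i => T ^ (n - 1 - i) * w ^ i) n)%C = (T ^ n - w ^ n)%C.
Proof.
  induction n as [|n IH]; [simpl; ring|].
  cbn [Csum]. replace (S n - 1 - n)%nat with O by lia.
  rewrite (Csum_ext (fun i => T ^ (S n - 1 - i) * w ^ i)%C (fun i => T * (T ^ (n - 1 - i) * w ^ i))%C).
  - rewrite Csum_scal, Cmult_plus_distr_l.
    transitivity (T * ((T - w) * Csum (fun i => T ^ (n - 1 - i) * w ^ i) n) + (T - w) * (T ^ 0 * w ^ n))%C; [ring|].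
    rewrite IH. simpl. ring.
  - intros i Hi. replace (S n - 1 - i)%nat with (S (n - 1 - i)) by lia. simpl. ring.
Qed.

Section RootsOfUnity.
Variable h : nat.
Let N := (2 * h + 1)%nat.

(** The N-th roots of unity with index centred at h, so that l - h is half the index j of the sum in
    the theorem. *)
Definition root (l : nat) : CC := cis (- (2 * PI * (INR l - INR h) / INR N)).

Lemma INR_N : INR N = 2 * INR h + 1.
Proof. unfold N. rewrite plus_INR, mult_INR. simpl. ring. Qed.

Lemma INR_N_pos : 0 < INR N.
Proof. rewrite INR_N. pose proof (pos_INR h). lra. Qed.

Lemma shifted_root_sum (d : Z) :
  Csum (fun l => cis (2 * PI * IZR d * (INR l - INR h) / INR N)) N =
  if Z.eq_dec (d mod Z.of_nat N) 0 then RtoC (INR N) else RtoC 0.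
Proof.
  pose proof INR_N_pos as HN.
  rewrite (Csum_ext _ (fun l => cis (- (2 * PI * IZR d * INR h / INR N)) * cis (2 * PI * IZR d * INR l / INR N))%C).
  - rewrite Csum_scal, root_of_unity_sum by (unfold N; lia).
    destruct (Z.eq_dec _ 0) as [H|H]; [|ring].
    apply Z.mod_divide in H; [|unfold N; lia]. destruct H as [c ->].
    rewrite mult_IZR, <- INR_IZR_INZ.
    replace (- (2 * PI * (IZR c * INR N) * INR h / INR N)) with (2 * PI * IZR (- (c * Z.of_nat h)))
      by (rewrite opp_IZR, mult_IZR, <- INR_IZR_INZ; field; lra).
    rewrite cis_2PI_Z. ring.
  - intros l _. rewrite <- cis_plus. f_equal. field. lra.
Qed.

Lemma root_pow_N l : (root l ^ N)%C = 1%C.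
Proof.
  pose proof INR_N_pos. unfold root. rewrite cis_pow.
  replace (INR N * _) with (2 * PI * IZR (Z.of_nat h - Z.of_nat l)).
  - apply cis_2PI_Z.
  - rewrite minus_IZR, <- !INR_IZR_INZ. field. lra.
Qed.

(* Partial fractions of T^h / (T^N + S^N), whose poles in T are the -S * root l. *)
Lemma root_partial_fractions (T S : R) : 0 < T -> 0 < S ->
  (forall l, (l < N)%nat -> (RtoC T + RtoC S * root l)%C <> 0%C) ->
  Csum (fun l => / root l ^ h * / (RtoC T + RtoC S * root l))%C N =
  RtoC (INR N * (-1) ^ h * (T * S) ^ h / (T ^ N + S ^ N)).
Proof.
  intros HT HS Hne. pose proof INR_N_pos as HN.
  assert (HTN : 0 < T ^ N) by now apply pow_lt. assert (HSN : 0 < S ^ N) by now apply pow_lt.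
  assert (HD : RtoC (T ^ N + S ^ N) <> 0%C) by (apply RtoC_neq_0; lra).
  (* Each fraction is expanded by the factorisation of T^N - w^N with w = -S [root l]. Summation
     over l then keeps only the power i = h, by orthogonality. *)
  rewrite (Csum_ext _ (fun l => / RtoC (T ^ N + S ^ N) *
      Csum (fun i => RtoC (T ^ (N - 1 - i) * (- S) ^ i) * cis (2 * PI * IZR (Z.of_nat h - Z.of_nat i) * (INR l - INR h) / INR N)) N)%C).
  - rewrite Csum_scal, Csum_swap.
    rewrite (Csum_ext _ (fun i => RtoC (T ^ (N - 1 - i) * (- S) ^ i) *
       if Z.eq_dec ((Z.of_nat h - Z.of_nat i) mod Z.of_nat N) 0 then RtoC (INR N) else RtoC 0)%C).
    + rewrite (Csum_single _ N h).
      * rewrite Z.sub_diag. destruct (Z.eq_dec _ 0) as [_|H]; [|exfalso; apply H; reflexivity].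
        rewrite <- RtoC_inv, <- !RtoC_mult by lra. f_equal.
        replace (N - 1 - h)%nat with h by (unfold N; lia).
        replace ((- S) ^ h) with ((-1) ^ h * S ^ h) by (rewrite <- Rpow_mult_distr; f_equal; ring).
        rewrite Rpow_mult_distr. field. lra.
      * unfold N; lia.
      * intros i Hi Hne'. destruct (Z.eq_dec _ 0) as [H|_]; [|ring].
        exfalso. apply Z.mod_divide in H; [|unfold N; lia]. destruct H as [c Hc]. unfold N in *.
        assert (c = 0)%Z by nia. lia.
    + intros i _. rewrite Csum_scal. f_equal. apply shifted_root_sum.
  - intros l Hl. specialize (Hne l Hl).
    set (w := (- (RtoC S * root l))%C).
    assert (Ew : (w ^ N)%C = RtoC (- S ^ N)).
    { unfold w. replace (- (RtoC S * root l))%C with (RtoC (- S) * root l)%C by (rewrite RtoC_opp; ring).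
      rewrite Cpow_mult_l, root_pow_N, <- RtoC_pow.
      replace ((- S) ^ N) with (- S ^ N); [ring|].
      replace (- S) with (-1 * S) by ring. rewrite Rpow_mult_distr.
      unfold N. rewrite (Nat.add_comm (2 * h) 1), (pow_add (-1)), pow_mult.
      replace ((-1) ^ 2) with 1 by ring. rewrite pow1. ring. }
    pose proof (diff_pow_factor (RtoC T) w N) as F.
    rewrite Ew, <- RtoC_pow, <- RtoC_minus in F.
    replace (T ^ N - - S ^ N) with (T ^ N + S ^ N) in F by ring.
    replace (RtoC T - w)%C with (RtoC T + RtoC S * root l)%C in F by (unfold w; ring).
    rewrite (Csum_ext (fun i => RtoC (T ^ (N - 1 - i) * (- S) ^ i) * _)%C
      (fun i => / root l ^ h * (RtoC T ^ (N - 1 - i) * w ^ i))%C).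
    + rewrite Csum_scal, <- F.
      assert (Hs : Csum (fun i => RtoC T ^ (N - 1 - i) * w ^ i)%C N <> 0%C).
      { intros Z. rewrite Z in F. apply HD. rewrite <- F. ring. }
      assert (root l <> 0%C) by apply cis_neq_0.
      assert ((root l ^ h)%C <> 0%C) by now apply Cpow_nz.
      field. auto.
    + intros i _. unfold w. replace (- (RtoC S * root l))%C with (RtoC (- S) * root l)%C by (rewrite RtoC_opp; ring).
      rewrite Cpow_mult_l, RtoC_mult, <- !RtoC_pow.
      unfold root. rewrite !cis_pow, <- cis_opp.
      rewrite minus_IZR, <- !INR_IZR_INZ.
      replace (2 * PI * (INR h - INR i) * (INR l - INR h) / INR N)
        with (- (INR h * - (2 * PI * (INR l - INR h) / INR N)) + INR i * - (2 * PI * (INR l - INR h) / INR N)) by (field; lra).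
      rewrite cis_plus. ring.
Qed.
End RootsOfUnity.

Section InnerSum.
Variables (x : R) (h k : nat).
Hypothesis Hx : 0 < x.
Let N := (2 * h + 1)%nat.
Let A := 2 * PI * INR (S k) / x.
Let a := Rpower A (/ INR N).
(** [jl] runs through -(N-1), -(N-3), ..., N-1; [zl] and [cl] are the exponent and the numerator of
    the corresponding term. *)
Let jl (l : nat) : R := 2 * INR l - (INR N - 1).
Let zl (l : nat) : CC := (RtoC (2 * PI * a) * Cexp (0%R, (- PI * jl l / (2 * INR N))%R))%C.
Let cl (l : nat) : CC := Cexp (0%R, (PI * jl l / 2)%R).

Lemma inner_A_pos : 0 < A.
Proof.
  unfold A. pose proof PI_RGT_0. assert (0 < INR (S k)) by (apply lt_0_INR; lia).
  apply Rdiv_lt_0_compat; [nra|exact Hx].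
Qed.

Lemma inner_a_pos : 0 < a.
Proof. apply exp_pos. Qed.

Lemma inner_a_pow : a ^ N = A.
Proof.
  unfold a. rewrite <- Rpower_pow by apply exp_pos. rewrite Rpower_mult.
  rewrite Rinv_l by (apply Rgt_not_eq, (INR_N_pos h)). apply Rpower_1, inner_A_pos.
Qed.

(** Since |j| < N the argument of [zl l] lies strictly between -pi/2 and pi/2, the condition for the
    partial fraction expansion. *)
Lemma inner_zl_re l : (l < N)%nat -> 0 < fst (zl l).
Proof.
  intros Hl. pose proof PI_RGT_0 as HPI. pose proof inner_a_pos as Ha. pose proof (INR_N_pos h) as HN.
  pose proof (INR_N h) as EN. fold N in HN, EN.
  unfold zl. change (Cexp (0, - PI * jl l / (2 * INR N))) with (cis (- PI * jl l / (2 * INR N))).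
  rewrite cis_eq. cbn [fst snd Cmult RtoC]. rewrite Rmult_0_l, Rminus_0_r.
  apply Rmult_lt_0_compat; [nra|].
  assert (Hl' : INR l + 1 <= INR N) by (rewrite <- S_INR; apply le_INR; lia).
  pose proof (pos_INR l).
  assert (Hj : - INR N < jl l < INR N) by (unfold jl; lra).
  replace (- PI * jl l / (2 * INR N)) with (- (PI / 2) * (jl l / INR N)) by (field; lra).
  assert (Hq : -1 < jl l / INR N < 1).
  { split; apply Rmult_lt_reg_r with (INR N); try lra; unfold Rdiv; rewrite Rmult_assoc, Rinv_l; lra. }
  apply cos_gt_0; nra.
Qed.

Lemma inner_zl_neq_0 l : (l < N)%nat -> zl l <> 0%C.
Proof. intros Hl E. pose proof (inner_zl_re l Hl) as H. rewrite E in H. simpl in H. lra. Qed.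

Lemma inner_jl l : jl l = 2 * (INR l - INR h).
Proof. unfold jl. pose proof (INR_N h) as EN. fold N in EN. rewrite EN. ring. Qed.

(** The case r = q = 1 of the expansion, with every cosine equal to 1: (1 + e^(-z))/(2 (1 - e^(-z)))
    is 1/(e^z - 1) + 1/2. *)
Lemma inner_limit l : (l < N)%nat ->
  is_Clim (Csum (fun m => 2 * zl l / (zl l * zl l + RtoC ((2 * PI * INR (S m)) ^ 2)))%C)
    (/ (Cexp (zl l) - 1) + / 2 - / zl l)%C.
Proof.
  intros Hl. pose proof (inner_zl_re l Hl) as Hre. pose proof (inner_zl_neq_0 l Hl) as Hz.
  pose proof (partial_fractions (zl l) Hre 1 1 ltac:(lia)) as P.
  replace (INR 1 / INR 1) with 1 in P by (simpl; field).
  eapply is_Clim_eq; [eapply is_Clim_ext; [|exact P]|].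
  - intros M. apply Csum_ext. intros m _.
    replace (2 * PI * INR (S m) * 1) with (0 + 2 * INR (S m) * PI) by ring.
    rewrite cos_period, cos_0. ring.
  - replace (- (1 * zl l))%C with (- zl l)%C by ring.
    replace (- (RtoC (1 - 1) * zl l))%C with (RtoC 0) by (rewrite Rminus_diag; ring).
    rewrite Cexp_0, Cexp_opp. set (e := Cexp (zl l)).
    assert (He0 : e <> 0%C) by apply Cexp_neq_0.
    assert (He : Cmod e <> 1).
    { unfold e. rewrite Cmod_Cexp. pose proof (exp_increasing 0 _ Hre). rewrite exp_0 in *. lra. }
    assert (He1 : (e - 1)%C <> 0%C).
    { intros Z. apply He. replace e with (e - 1 + 1)%C by ring. rewrite Z.
      replace (0 + 1)%C with (RtoC 1) by ring. apply Cmod_1. }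
    field. repeat split; auto; intros Z; apply He1; rewrite <- Z; ring.
Qed.

Lemma inner_zl_sq l : (zl l * zl l)%C = (RtoC (4 * PI ^ 2 * a ^ 2) * root h l)%C.
Proof.
  pose proof (INR_N_pos h) as HN. fold N in HN.
  unfold zl, root. fold N. change (Cexp (0, - PI * jl l / (2 * INR N))) with (cis (- PI * jl l / (2 * INR N))).
  rewrite inner_jl.
  replace (- (2 * PI * (INR l - INR h) / INR N)) with (- PI * (2 * (INR l - INR h)) / (2 * INR N) + - PI * (2 * (INR l - INR h)) / (2 * INR N)) by (field; lra).
  rewrite cis_plus. replace (4 * PI ^ 2 * a ^ 2) with (2 * PI * a * (2 * PI * a)) by ring.
  rewrite (RtoC_mult (2 * PI * a) (2 * PI * a)). ring.
Qed.

(** The phases combine because pi j/2 - pi j/(2N) = pi j h/N. The numerators thus become exactly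
    those of [root_partial_fractions]. *)
Lemma inner_cl_zl l : (cl l * zl l)%C = (RtoC (2 * PI * a) * / root h l ^ h)%C.
Proof.
  pose proof (INR_N_pos h) as HN. pose proof (INR_N h) as EN. fold N in HN, EN.
  unfold cl, zl, root. fold N. change (Cexp (0, - PI * jl l / (2 * INR N))) with (cis (- PI * jl l / (2 * INR N))).
  change (Cexp (0, PI * jl l / 2)) with (cis (PI * jl l / 2)).
  rewrite cis_pow, <- cis_opp, inner_jl.
  replace (- (INR h * - (2 * PI * (INR l - INR h) / INR N))) with (PI * (2 * (INR l - INR h)) / 2 + - PI * (2 * (INR l - INR h)) / (2 * INR N)).
  - rewrite cis_plus. ring.
  - rewrite EN. pose proof (pos_INR h). field. lra.
Qed.

Lemma inner_root_neq l (m : nat) : (l < N)%nat -> (RtoC (INR (S m) ^ 2) + RtoC (a ^ 2) * root h l)%C <> 0%C.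
Proof.
  intros Hl Z. apply (pf_den_neq_0 (zl l) (inner_zl_re l Hl) (2 * PI * INR (S m))).
  rewrite inner_zl_sq. transitivity (RtoC (4 * PI ^ 2) * (RtoC (INR (S m) ^ 2) + RtoC (a ^ 2) * root h l))%C.
  - replace ((2 * PI * INR (S m)) ^ 2) with (4 * PI ^ 2 * INR (S m) ^ 2) by ring.
    rewrite (RtoC_mult (4 * PI ^ 2) (a ^ 2)), (RtoC_mult (4 * PI ^ 2) (INR (S m) ^ 2)). ring.
  - rewrite Z. ring.
Qed.

(** By [inner_zl_sq] the denominators are 4 pi^2 (T + S [root l]) with T the square of [S m] and S =
    a^2. [root_partial_fractions] then has the denominator T^N + S^N, in which S^N = A^2 because a^N
    = A; up to the factor x^2 this is the denominator of [kern]. *)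
Lemma inner_kern m :
  Csum (fun l => cl l * (2 * zl l / (zl l * zl l + RtoC ((2 * PI * INR (S m)) ^ 2))))%C N =
  RtoC ((-1) ^ h * INR N * INR (S k) * kern x N m k).
Proof.
  pose proof PI_RGT_0 as HPI. pose proof inner_a_pos as Ha. pose proof inner_A_pos as HA.
  assert (Hm : 0 < INR (S m)) by (apply lt_0_INR; lia).
  assert (Hk : 0 < INR (S k)) by (apply lt_0_INR; lia).
  rewrite (Csum_ext _ (fun l => RtoC (a / PI) * (/ root h l ^ h * / (RtoC (INR (S m) ^ 2) + RtoC (a ^ 2) * root h l)))%C).
  - rewrite Csum_scal.
    pose proof (root_partial_fractions h (INR (S m) ^ 2) (a ^ 2)) as RPF. fold N in RPF.
    rewrite RPF; clear RPF.
    + rewrite <- RtoC_mult. f_equal. fold N. unfold kern, ypt.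
      rewrite <- !pow_mult, !(Nat.mul_comm 2 N), !pow_mult, inner_a_pow.
      assert (EA : a * (INR (S m) ^ 2 * a ^ 2) ^ h = A * INR (S m) ^ (2 * h)).
      { rewrite Rpow_mult_distr, <- !pow_mult. rewrite <- inner_a_pow. unfold N.
        rewrite (Nat.add_comm (2 * h) 1), (pow_add a 1). ring. }
      replace (INR (S m) ^ N) with (INR (S m) * INR (S m) ^ (2 * h)) by (unfold N; rewrite (Nat.add_comm (2 * h) 1), pow_add; ring).
      set (p := INR (S m) ^ (2 * h)) in *. assert (Hp : 0 < p) by now apply pow_lt.
      set (mu := INR (S m)) in *.
      transitivity (INR N * (-1) ^ h * (a * (mu ^ 2 * a ^ 2) ^ h) / PI / ((mu * p) ^ 2 + A ^ 2)).
      * field. split; [lra|]. pose proof (pow_lt (mu * p) 2 ltac:(nra)). pose proof (pow2_ge_0 A). lra.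
      * rewrite EA. unfold A. set (n := INR (S k)) in *. field.
        assert (0 < mu ^ 2 * p ^ 2) by (apply Rmult_lt_0_compat; apply pow_lt; lra).
        assert (0 < x ^ 2) by (apply pow_lt; lra). assert (0 < PI ^ 2) by (apply pow_lt; lra).
        assert (0 < n ^ 2) by (apply pow_lt; lra).
        assert (0 < mu ^ 2 * p ^ 2 * x ^ 2) by (apply Rmult_lt_0_compat; lra).
        assert (0 < PI ^ 2 * n ^ 2) by (apply Rmult_lt_0_compat; lra).
        repeat split; nra.
    + apply pow_lt; lra.
    + apply pow_lt; lra.
    + intros l Hl. now apply inner_root_neq.
  - intros l Hl. pose proof (inner_root_neq l m Hl) as Hne.
    assert (H4 : RtoC (4 * PI ^ 2) <> 0%C) by (apply RtoC_neq_0; nra).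
    replace (zl l * zl l + RtoC ((2 * PI * INR (S m)) ^ 2))%C with (RtoC (4 * PI ^ 2) * (RtoC (INR (S m) ^ 2) + RtoC (a ^ 2) * root h l))%C.
    + transitivity (2 * (cl l * zl l) / (RtoC (4 * PI ^ 2) * (RtoC (INR (S m) ^ 2) + RtoC (a ^ 2) * root h l)))%C; [unfold Cdiv; ring|].
      rewrite inner_cl_zl.
      replace (RtoC (a / PI)) with (2 * RtoC (2 * PI * a) / RtoC (4 * PI ^ 2))%C.
      * set (d := (RtoC (INR (S m) ^ 2) + RtoC (a ^ 2) * root h l)%C) in *.
        assert ((root h l ^ h)%C <> 0%C) by (apply Cpow_nz, cis_neq_0). field. auto.
      * rewrite <- RtoC_mult, <- RtoC_div by nra. f_equal. field. lra.
    + rewrite inner_zl_sq. replace ((2 * PI * INR (S m)) ^ 2) with (4 * PI ^ 2 * INR (S m) ^ 2) by ring.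
      rewrite (RtoC_mult (4 * PI ^ 2) (a ^ 2)), (RtoC_mult (4 * PI ^ 2) (INR (S m) ^ 2)). ring.
Qed.

(** The phases are (-1)^(l-h), and an alternating sum of an odd number of terms keeps one of
    them. *)
Lemma inner_cl_sum : Csum cl N = RtoC ((-1) ^ h).
Proof.
  rewrite (Csum_ext _ (fun l => RtoC ((-1) ^ h) * RtoC ((-1) ^ l))%C).
  - rewrite Csum_scal, Csum_RtoC. unfold N. rewrite alternating_sum. ring.
  - intros l _. unfold cl. change (Cexp (0, PI * jl l / 2)) with (cis (PI * jl l / 2)).
    rewrite inner_jl. replace (PI * (2 * (INR l - INR h)) / 2) with (- (PI * INR h) + PI * INR l) by field.
    now rewrite cis_plus, cis_neg_PI_nat, cis_PI_nat.
Qed.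

(** The quotient of [cl] by [zl] oscillates with frequency h + 1, which is a multiple of N = 2h + 1
    only for h = 0. This is why the term with L(-1, chi) occurs for N = 1 alone. *)
Lemma inner_cl_inv_zl_sum :
  Csum (fun l => cl l * / zl l)%C N = if Nat.eqb h 0 then RtoC (x / (4 * PI ^ 2 * INR (S k))) else RtoC 0.
Proof.
  pose proof (INR_N_pos h) as HN. pose proof (INR_N h) as EN. pose proof inner_a_pos as Ha. pose proof PI_RGT_0 as HPI. fold N in HN, EN.
  assert (H2 : RtoC (2 * PI * a) <> 0%C) by (apply RtoC_neq_0; nra).
  rewrite (Csum_ext _ (fun l => / RtoC (2 * PI * a) * cis (2 * PI * IZR (Z.of_nat (h + 1)) * (INR l - INR h) / INR N))%C).
  - rewrite Csum_scal. pose proof (shifted_root_sum h (Z.of_nat (h + 1))) as SR. fold N in SR. rewrite SR; clear SR.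
    destruct (Nat.eqb_spec h 0) as [E|E].
    + destruct (Z.eq_dec _ 0) as [H|H].
      * pose proof inner_a_pow as Hp. pose proof inner_A_pos as HA. unfold N in Hp. rewrite E in Hp. simpl in Hp. rewrite Rmult_1_r in Hp.
        rewrite EN, E, Hp. rewrite <- RtoC_inv, <- RtoC_mult by nra. f_equal. unfold A. simpl (INR 0).
        assert (0 < INR (S k)) by (apply lt_0_INR; lia). field. lra.
      * exfalso. apply H. unfold N. rewrite E. reflexivity.
    + destruct (Z.eq_dec _ 0) as [H|H]; [|ring].
      exfalso. apply Z.mod_divide in H; [|unfold N; lia]. destruct H as [c Hc]. unfold N in Hc.
      assert (0 < c)%Z by nia. nia.
  - intros l _. unfold cl, zl. change (Cexp (0, - PI * jl l / (2 * INR N))) with (cis (- PI * jl l / (2 * INR N))).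
    change (Cexp (0, PI * jl l / 2)) with (cis (PI * jl l / 2)).
    rewrite inner_jl, <- INR_IZR_INZ, plus_INR.
    replace (2 * PI * (INR h + INR 1) * (INR l - INR h) / INR N) with (PI * (2 * (INR l - INR h)) / 2 + - (- PI * (2 * (INR l - INR h)) / (2 * INR N))).
    + rewrite cis_plus, (cis_opp (- PI * (2 * (INR l - INR h)) / (2 * INR N))).
      pose proof (cis_neq_0 (- PI * (2 * (INR l - INR h)) / (2 * INR N))). field. auto.
    + rewrite EN. simpl (INR 1). pose proof (pos_INR h). field. lra.
Qed.

(** Summing [inner_limit] over l and comparing with [inner_kern] evaluates the sum of 1/(e^z - 1) +
    1/2 - 1/z. The constant 1/2 leaves the harmonic correction and 1/z the one in 1/k^2. *)
Lemma inner_sum :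
  Csum (fun l => cl l / (Cexp (zl l) - 1))%C N =
  RtoC ((-1) ^ h * INR N * INR (S k) * (kern_sum x N k - / (2 * INR N * INR (S k)) +
    if Nat.eqb h 0 then x / (4 * PI ^ 2 * INR (S k) ^ 2) else 0)).
Proof.
  assert (HNn : (1 <= N)%nat) by (unfold N; lia).
  pose proof (INR_N_pos h) as HN. fold N in HN.
  assert (Hk : 0 < INR (S k)) by (apply lt_0_INR; lia).
  assert (L1 : is_Clim (fun M => Csum (fun l => cl l * Csum (fun m => 2 * zl l / (zl l * zl l + RtoC ((2 * PI * INR (S m)) ^ 2))) M) N)%C
     (Csum (fun l => cl l * (/ (Cexp (zl l) - 1) + / 2 - / zl l)) N)%C).
  { apply (is_Clim_Csum (fun M l => cl l * Csum (fun m => 2 * zl l / (zl l * zl l + RtoC ((2 * PI * INR (S m)) ^ 2))) M)%C).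
    intros l Hl. apply is_Clim_mult; [apply is_Clim_const|now apply inner_limit]. }
  assert (L2 : is_Clim (fun M => RtoC ((-1) ^ h * INR N * INR (S k) * Rsum (fun m => kern x N m k) M))
     (RtoC ((-1) ^ h * INR N * INR (S k) * kern_sum x N k))).
  { apply is_Clim_RtoC. apply is_lim_seq_mult'; [apply is_lim_seq_const|].
    unfold kern_sum. apply is_series_Rsum, Series_correct. now apply ex_series_kern. }
  assert (E : Csum (fun l => cl l * (/ (Cexp (zl l) - 1) + / 2 - / zl l))%C N = RtoC ((-1) ^ h * INR N * INR (S k) * kern_sum x N k)).
  { apply (is_Clim_unique _ _ _ L1). eapply is_Clim_ext; [|exact L2]. intros M. cbv beta.
    rewrite (Csum_ext (fun l => cl l * Csum _ M)%C (fun l => Csum (fun m => cl l * (2 * zl l / (zl l * zl l + RtoC ((2 * PI * INR (S m)) ^ 2)))) M)%C)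
      by (intros; now rewrite Csum_scal).
    rewrite Csum_swap, <- Rsum_scal, <- Csum_RtoC. apply Csum_ext. intros m _. symmetry. apply inner_kern. }
  rewrite (Csum_ext _ (fun l => (cl l / (Cexp (zl l) - 1)) + (/ 2 * cl l + (- (1)) * (cl l * / zl l)))%C) in E
    by (intros; unfold Cdiv; ring).
  rewrite !Csum_plus, !Csum_scal, inner_cl_sum, inner_cl_inv_zl_sum in E.
  set (X := Csum (fun l => cl l / (Cexp (zl l) - 1))%C N) in *.
  replace (/ RtoC 2)%C with (RtoC (/ 2)) in E by (rewrite RtoC_inv; [reflexivity|lra]).
  match type of E with (X + (?p + ?r))%C = ?e => assert (E' : X = (e - p - r)%C) by (rewrite <- E; ring) end.
  rewrite E'. destruct (Nat.eqb_spec h 0) as [->|Hh].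
  - rewrite <- !RtoC_opp, <- !RtoC_mult, <- !RtoC_minus. f_equal.
    assert (EN1 : INR N = 1) by (unfold N; simpl; ring). pose proof PI_RGT_0.
    rewrite EN1. replace ((-1) ^ 0) with 1 by reflexivity. field. lra.
  - rewrite <- !RtoC_opp, <- !RtoC_mult, <- !RtoC_minus. f_equal. field. lra.
Qed.
End InnerSum.

(** * Characters and Gauss sums *)

Section Characters.
Variables (q : nat) (chi : Z -> CC).
Hypothesis Hprim : primitive_character (Z.of_nat q) chi.

Lemma char_q_pos : (1 <= q)%nat.
Proof. destruct Hprim as [[H _] _]. lia. Qed.

Lemma periodic_Zmul (F : Z -> CC) : (forall n, F (n + Z.of_nat q)%Z = F n) ->
  forall n c, F (n + c * Z.of_nat q)%Z = F n.
Proof.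
  intros HF.
  assert (Hnat : forall m n, F (n + Z.of_nat m * Z.of_nat q)%Z = F n).
  { induction m as [|m IH]; intros n; [f_equal; lia|].
    rewrite <- (IH n), <- (HF (n + Z.of_nat m * Z.of_nat q)%Z). f_equal. lia. }
  intros n c. destruct (Z_le_gt_dec 0 c) as [H|H].
  - rewrite <- (Z2Nat.id c) by lia. apply Hnat.
  - rewrite <- (Hnat (Z.to_nat (- c)) (n + c * Z.of_nat q)%Z). f_equal. rewrite Z2Nat.id by lia. lia.
Qed.

Lemma char_periodic n : chi (n + Z.of_nat q)%Z = chi n.
Proof. apply Hprim. Qed.

Lemma char_mult m n : chi (m * n)%Z = (chi m * chi n)%C.
Proof. apply Hprim. Qed.

Lemma char_1 : chi 1%Z = 1%C.
Proof. apply Hprim. Qed.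

Lemma char_not_coprime n : Z.gcd n (Z.of_nat q) <> 1%Z -> chi n = 0%C.
Proof.
  intros H. destruct (Ceq_dec (chi n) 0) as [E|E]; [exact E|].
  exfalso. apply H. now apply Hprim.
Qed.

Lemma coprime_inverse n : Z.gcd n (Z.of_nat q) = 1%Z -> exists b c, (n * b = 1 + c * Z.of_nat q)%Z.
Proof.
  intros H. destruct (rel_prime_bezout n (Z.of_nat q)) as [u v E].
  - apply Zgcd_1_rel_prime. exact H.
  - exists u, (- v)%Z. lia.
Qed.

Lemma periodic_bounded (F : Z -> CC) : (forall n, F (n + Z.of_nat q)%Z = F n) -> exists B, forall n, Cmod (F n) <= B.
Proof.
  intros HF. exists (Rsum (fun r => Cmod (F (Z.of_nat r))) q). intros n.
  pose proof char_q_pos as Hq.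
  pose proof (Z.div_mod n (Z.of_nat q) ltac:(lia)) as E.
  pose proof (Z.mod_pos_bound n (Z.of_nat q) ltac:(lia)) as Hb.
  replace (F n) with (F (Z.of_nat (Z.to_nat (n mod Z.of_nat q)))).
  - assert (Hr : (Z.to_nat (n mod Z.of_nat q) < q)%nat) by lia.
    clear E Hb. revert Hr. generalize (Z.to_nat (n mod Z.of_nat q)). intros r Hr.
    assert (G : forall m, (r < m)%nat -> Cmod (F (Z.of_nat r)) <= Rsum (fun r => Cmod (F (Z.of_nat r))) m).
    { induction m as [|m IH]; intros Hm; [lia|]. cbn [Rsum].
      destruct (Nat.eq_dec r m) as [->|Hne].
      - pose proof (Rsum_nonneg (fun r => Cmod (F (Z.of_nat r))) m (fun k => Cmod_ge_0 _)). lra.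
      - specialize (IH ltac:(lia)). pose proof (Cmod_ge_0 (F (Z.of_nat m))). lra. }
    now apply G.
  - rewrite Z2Nat.id by lia. rewrite <- (periodic_Zmul F HF (n mod Z.of_nat q) (n / Z.of_nat q)). f_equal. lia.
Qed.

Lemma char_pow n k : chi (n ^ Z.of_nat k)%Z = (chi n ^ k)%C.
Proof.
  induction k as [|k IH]; [apply char_1|].
  rewrite Nat2Z.inj_succ, Z.pow_succ_r, char_mult, IH by lia. reflexivity.
Qed.

(** The powers of chi(n) are values of chi and so stay bounded by periodicity. *)
Lemma char_bound n : Cmod (chi n) <= 1.
Proof.
  destruct (periodic_bounded chi char_periodic) as [B HB].
  destruct (Rle_lt_dec (Cmod (chi n)) 1) as [H|H]; [exact H|exfalso].
  destruct (Pow_x_infinity (Cmod (chi n))) with (b := B + 1) as [k Hk].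
  - now rewrite Rabs_pos_eq by apply Cmod_ge_0.
  - specialize (Hk k (Nat.le_refl k)). specialize (HB (n ^ Z.of_nat k)%Z).
    rewrite char_pow, Cmod_pow in HB. rewrite Rabs_pos_eq in Hk by (apply pow_le, Cmod_ge_0). lra.
Qed.

(** The inverse of chi(n) is again a value of chi, and both moduli are at most 1. *)
Lemma char_conj_mult n : Z.gcd n (Z.of_nat q) = 1%Z -> (Cconj (chi n) * chi n = 1)%C.
Proof.
  intros H. destruct (coprime_inverse n H) as (b & c & E).
  assert (E1 : (chi n * chi b = 1)%C).
  { rewrite <- char_mult, E, (periodic_Zmul chi char_periodic). apply char_1. }
  assert (E2 : Cmod (chi n) * Cmod (chi b) = 1) by (rewrite <- Cmod_mult, E1; apply Cmod_1).
  pose proof (char_bound n). pose proof (char_bound b). pose proof (Cmod_ge_0 (chi n)). pose proof (Cmod_ge_0 (chi b)).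
  assert (E3 : Cmod (chi n) = 1) by nra.
  rewrite Cmult_comm, <- Cmod2_conj, E3. f_equal. ring.
Qed.

(** Instead of an explicit permutation, a double sum over r and s is used, with an indicator of a r
    congruent to s modulo q. It has one non-zero position in each row, and, a being invertible
    modulo q, one in each column. *)
Lemma Csum_unit_perm (F : Z -> CC) a b c : (forall n, F (n + Z.of_nat q)%Z = F n) ->
  (a * b = 1 + c * Z.of_nat q)%Z ->
  Csum (fun r => F (a * Z.of_nat r)%Z) q = Csum (fun r => F (Z.of_nat r)) q.
Proof.
  intros HF Hab. pose proof char_q_pos as Hq. set (Q := Z.of_nat q) in *.
  set (f := fun r s : nat => if Z.eq_dec ((a * Z.of_nat r - Z.of_nat s) mod Q) 0 then F (Z.of_nat s) else RtoC 0).
  transitivity (Csum (fun r => Csum (fun s => f r s) q) q).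
  - apply Csum_ext. intros r Hr. symmetry.
    pose proof (Z.div_mod (a * Z.of_nat r) Q ltac:(lia)) as E.
    pose proof (Z.mod_pos_bound (a * Z.of_nat r) Q ltac:(lia)) as Hb.
    set (m := ((a * Z.of_nat r) mod Q)%Z) in *. set (d := (a * Z.of_nat r / Q)%Z) in *.
    rewrite (Csum_single _ q (Z.to_nat m)); [| lia |].
    + unfold f. rewrite Z2Nat.id by lia. destruct (Z.eq_dec _ 0) as [_|H].
      * rewrite E. rewrite <- (periodic_Zmul F HF m d). f_equal. fold Q. lia.
      * exfalso. apply H. apply Z.mod_divide; [lia|]. exists d. lia.
    + intros s Hs Hne. unfold f. destruct (Z.eq_dec _ 0) as [H|_]; [|reflexivity].
      exfalso. apply Z.mod_divide in H; [|lia]. destruct H as [e He]. apply Hne.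
      assert (Hms : (m - Z.of_nat s = (e - d) * Q)%Z) by lia.
      assert (e - d = 0)%Z by nia. lia.
  - rewrite Csum_swap. apply Csum_ext. intros s Hs.
    pose proof (Z.div_mod (b * Z.of_nat s) Q ltac:(lia)) as E.
    pose proof (Z.mod_pos_bound (b * Z.of_nat s) Q ltac:(lia)) as Hb.
    set (m := ((b * Z.of_nat s) mod Q)%Z) in *. set (d := (b * Z.of_nat s / Q)%Z) in *.
    rewrite (Csum_single _ q (Z.to_nat m)); [| lia |].
    + unfold f. rewrite Z2Nat.id by lia. destruct (Z.eq_dec _ 0) as [_|H]; [reflexivity|].
      exfalso. apply H. apply Z.mod_divide; [lia|]. exists (c * Z.of_nat s - a * d)%Z.
      assert (m = b * Z.of_nat s - Q * d)%Z as -> by lia.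
      transitivity ((a * b) * Z.of_nat s - a * Q * d - Z.of_nat s)%Z; [ring|]. rewrite Hab. ring.
    + intros r Hr Hne. unfold f. destruct (Z.eq_dec _ 0) as [H|_]; [|reflexivity].
      exfalso. apply Z.mod_divide in H; [|lia]. destruct H as [e He]. apply Hne.
      assert (Hmr : (m - Z.of_nat r = (c * Z.of_nat r - b * e - d) * Q)%Z).
      { assert (m = b * Z.of_nat s - Q * d)%Z as -> by lia.
        assert (Z.of_nat s = a * Z.of_nat r - e * Q)%Z as -> by lia.
        transitivity ((a * b) * Z.of_nat r - b * e * Q - Q * d - Z.of_nat r)%Z; [ring|]. rewrite Hab. ring. }
      assert (c * Z.of_nat r - b * e - d = 0)%Z by nia. lia.
Qed.

(** * Gauss sums twisted by k *)

Definition gauss_term (k n : Z) : CC := (chi n * cis (2 * PI * (IZR k * IZR n) / INR q))%C.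
Definition gauss_twist (k : Z) : CC := Csum (fun r => gauss_term k (Z.of_nat r)) q.

Lemma INR_char_q_pos : 0 < INR q.
Proof. apply lt_0_INR. pose proof char_q_pos. lia. Qed.

Lemma gauss_term_periodic k n : gauss_term k (n + Z.of_nat q) = gauss_term k n.
Proof.
  pose proof INR_char_q_pos. unfold gauss_term. rewrite char_periodic. f_equal.
  rewrite plus_IZR, <- INR_IZR_INZ.
  replace (2 * PI * (IZR k * (IZR n + INR q)) / INR q) with (2 * PI * (IZR k * IZR n) / INR q + 2 * PI * IZR k) by (field; lra).
  rewrite cis_plus, cis_2PI_Z. ring.
Qed.

Lemma gauss_sum_twist : gauss_sum q chi = gauss_twist 1.
Proof.
  pose proof char_q_pos as Hq. unfold gauss_sum, gauss_twist. rewrite sum_n_m_1_Csum.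
  rewrite (Csum_ext _ (fun k => gauss_term 1 (Z.of_nat (S k)))).
  - assert (E : (Csum (fun k => gauss_term 1 (Z.of_nat (S k))) q + gauss_term 1 (Z.of_nat 0))%C =
               (Csum (fun r => gauss_term 1 (Z.of_nat r)) q + gauss_term 1 (Z.of_nat q))%C).
    { rewrite Cplus_comm. rewrite <- (Csum_shift (fun r => gauss_term 1 (Z.of_nat r)) q). reflexivity. }
    assert (E2 : gauss_term 1 (Z.of_nat q) = gauss_term 1 (Z.of_nat 0)).
    { rewrite <- (gauss_term_periodic 1 (Z.of_nat 0)). reflexivity. }
    rewrite E2 in E.
    match goal with |- ?u = ?v => replace u with (u + gauss_term 1 (Z.of_nat 0) - gauss_term 1 (Z.of_nat 0))%C by ring end.
    rewrite E. ring.
  - intros k _. unfold gauss_term, cis. do 3 f_equal. rewrite <- INR_IZR_INZ. unfold Rdiv. ring.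
Qed.

Lemma gauss_twist_mult a b c k : (a * b = 1 + c * Z.of_nat q)%Z ->
  (chi a * Csum (fun r => chi (Z.of_nat r) * cis (2 * PI * (IZR k * IZR (a * Z.of_nat r)) / INR q)) q)%C = gauss_twist k.
Proof.
  intros Hab. rewrite <- Csum_scal. unfold gauss_twist.
  rewrite <- (Csum_unit_perm (gauss_term k) a b c (gauss_term_periodic k) Hab).
  apply Csum_ext. intros r _. unfold gauss_term. rewrite char_mult. ring.
Qed.

(* Primitivity enters through the case gcd k q > 1, where chi is not trivial on
   the units congruent to 1 modulo q / gcd k q. *)
Lemma gauss_twist_eq k : gauss_twist k = (Cconj (chi k) * gauss_sum q chi)%C.
Proof.
  pose proof char_q_pos as Hq. pose proof INR_char_q_pos as HqR. set (Q := Z.of_nat q) in *.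
  destruct (Z.eq_dec (Z.gcd k Q) 1) as [Hg|Hg].
  - destruct (coprime_inverse k Hg) as (b & c & E).
    rewrite gauss_sum_twist, <- (gauss_twist_mult k b c 1 E), Cmult_assoc, char_conj_mult, Cmult_1_l by exact Hg.
    apply Csum_ext. intros r _. unfold gauss_term. do 2 f_equal. rewrite mult_IZR. f_equal. ring.
  - rewrite (char_not_coprime k Hg).
    replace (Cconj 0 * gauss_sum q chi)%C with (RtoC 0)
      by (replace (Cconj 0) with (RtoC 0) by (unfold Cconj; apply injective_projections; simpl; ring); ring).
    set (d := Z.gcd k Q) in *.
    assert (Hd0 : (0 < d)%Z).
    { pose proof (Z.gcd_nonneg k Q). destruct (Z.eq_dec d 0) as [Z0|]; [|unfold d in *; lia].
      apply Z.gcd_eq_0_r in Z0. lia. }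
    destruct (Z.gcd_divide_r k Q) as [m Hm]. fold d in Hm.
    destruct (Z.gcd_divide_l k Q) as [k' Hk']. fold d in Hk'.
    assert (Hm0 : (0 < m)%Z) by nia.
    (* m = q/d is a proper divisor of q because d > 1. Primitivity then supplies a unit a congruent
       to 1 modulo m with chi(a) different from 1. *)
    assert (Hni : ~ induced_modulus Q chi m).
    { intros Hi. destruct Hprim as [_ Hp]. specialize (Hp m Hm0). fold Q in Hp.
      assert (m = Q)%Z by (apply Hp; [exists d; lia|exact Hi]). nia. }
    apply not_all_ex_not in Hni. destruct Hni as [a Ha].
    apply imply_to_and in Ha. destruct Ha as [Ha1 Ha]. apply imply_to_and in Ha. destruct Ha as [Ha2 Ha3].
    destruct (coprime_inverse a Ha1) as (b & c & E).
    assert (Hdiv : (m | a - 1)%Z).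
    { apply Z.mod_divide; [lia|]. rewrite Zminus_mod, Ha2, <- Zminus_mod, Z.sub_diag. reflexivity. }
    destruct Hdiv as [e He].
    (* From k = k' d and a - 1 = e m follows k a = k + k' e q, so replacing r by a r fixes every
       exponential. As chi(a) is not 1, the twist must vanish. *)
    assert (ES : (chi a * gauss_twist k)%C = gauss_twist k).
    { rewrite <- (gauss_twist_mult a b c k E) at 2. f_equal. apply Csum_ext. intros r _. unfold gauss_term. f_equal.
      rewrite mult_IZR.
      assert (Ek : IZR k * IZR a = IZR k + IZR (k' * e) * INR q).
      { rewrite INR_IZR_INZ, <- !mult_IZR, <- plus_IZR. f_equal. fold Q.
        assert (E1 : (k * (a - 1) = k' * d * (e * m))%Z) by (rewrite <- Hk', He; reflexivity).
        assert (E2 : (k' * e * Q = k' * d * (e * m))%Z) by (rewrite Hm at 1; ring).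
        lia. }
      replace (2 * PI * (IZR k * (IZR a * IZR (Z.of_nat r))) / INR q) with
        (2 * PI * (IZR k * IZR (Z.of_nat r)) / INR q + 2 * PI * IZR (k' * e * Z.of_nat r)).
      - rewrite cis_plus, cis_2PI_Z. ring.
      - rewrite <- (Rmult_assoc (IZR k)), Ek, (mult_IZR (k' * e)). field. lra. }
    destruct (Ceq_dec (gauss_twist k) 0) as [Z0|Z0]; [exact Z0|].
    exfalso. apply Ha3.
    assert (E0 : ((chi a - 1) * gauss_twist k)%C = 0%C) by (transitivity (chi a * gauss_twist k - gauss_twist k)%C; [ring|rewrite ES; ring]).
    destruct (Ceq_dec (chi a - 1)%C 0) as [Z1|Z1].
    + replace (chi a) with (chi a - 1 + 1)%C by ring. rewrite Z1. ring.
    + exfalso. revert E0. now apply Cmult_neq_0.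
Qed.

(** This is the twist by k = 0, for which gcd(0, q) = q exceeds 1. *)
Lemma char_sum_0 : (1 < q)%nat -> Csum (fun r => chi (Z.of_nat r)) q = 0%C.
Proof.
  intros Hq. pose proof INR_char_q_pos. transitivity (gauss_twist 0).
  - apply Csum_ext. intros r _. unfold gauss_term.
    replace (2 * PI * (0 * IZR (Z.of_nat r)) / INR q) with 0 by (field; lra). rewrite cis_0. ring.
  - rewrite gauss_twist_eq, (char_not_coprime 0).
    + replace (Cconj 0) with (RtoC 0) by (unfold Cconj; apply injective_projections; simpl; ring). ring.
    + rewrite Z.gcd_0_l. lia.
Qed.

Hypothesis Heven : even_character chi.

Lemma char_opp n : chi (- n)%Z = chi n.
Proof. replace (- n)%Z with (-1 * n)%Z by lia. rewrite char_mult, Heven. ring. Qed.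

(** Averaging the twist with its image under r -> -r keeps only the cosine, chi being even. *)
Lemma gauss_cos (k : nat) :
  Csum (fun r => chi (Z.of_nat r) * RtoC (cos (2 * PI * INR k * (INR r / INR q))))%C q =
  (Cconj (chi (Z.of_nat k)) * gauss_sum q chi)%C.
Proof.
  pose proof INR_char_q_pos as HqR.
  rewrite <- gauss_twist_eq.
  assert (E : Csum (fun r => chi (Z.of_nat r) * cis (2 * PI * (IZR (Z.of_nat k) * IZR (-1 * Z.of_nat r)) / INR q))%C q = gauss_twist (Z.of_nat k)).
  { rewrite <- (gauss_twist_mult (-1) (-1) 0 (Z.of_nat k)) by lia. rewrite Heven. ring. }
  assert (E2 : (2 * gauss_twist (Z.of_nat k))%C = (2 * Csum (fun r => chi (Z.of_nat r) * RtoC (cos (2 * PI * INR k * (INR r / INR q)))) q)%C).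
  { transitivity (gauss_twist (Z.of_nat k) + gauss_twist (Z.of_nat k))%C; [ring|].
    rewrite <- E at 2. unfold gauss_twist. rewrite <- Csum_plus, <- Csum_scal. apply Csum_ext. intros r _. unfold gauss_term.
    rewrite mult_IZR, <- !INR_IZR_INZ.
    replace (2 * PI * (INR k * (-1 * INR r)) / INR q) with (- (2 * PI * (INR k * INR r) / INR q)) by (field; lra).
    replace (2 * PI * INR k * (INR r / INR q)) with (2 * PI * (INR k * INR r) / INR q) by (field; lra).
    rewrite <- Cmult_plus_distr_l, cis_add_opp, RtoC_mult. ring. }
  assert (H2 : RtoC 2 <> 0%C) by (apply RtoC_neq_0; lra).
  apply (f_equal (fun z => / 2 * z)%C) in E2. rewrite !Cmult_assoc in E2.
  replace (/ 2 * 2)%C with (RtoC 1) in E2 by (field; auto). rewrite !Cmult_1_l in E2. now symmetry.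
Qed.
End Characters.

(** * Assembly *)

Lemma Csum_shift_range (f : nat -> CC) n : f n = f O -> Csum (fun k => f (S k)) n = Csum f n.
Proof.
  intros H. assert (E : (f O + Csum (fun k => f (S k)) n)%C = (Csum f n + f n)%C) by (rewrite <- Csum_shift; reflexivity).
  rewrite H in E. transitivity (f O + Csum (fun k => f (S k)) n - f O)%C; [ring|]. rewrite E. ring.
Qed.

Lemma CSeries_ext (a b : nat -> CC) : (forall n, a n = b n) -> CSeries a = CSeries b.
Proof.
  intros H. unfold CSeries. f_equal; apply Series_ext; intros n; now rewrite H.
Qed.

Lemma CSeries_scal_R (c : R) (a : nat -> CC) : CSeries (fun n => RtoC c * a n)%C = (RtoC c * CSeries a)%C.
Proof.
  unfold CSeries.
  rewrite (Series_ext _ (fun n => c * fst (a n))), (Series_ext (fun n => snd (RtoC c * a n)%C) (fun n => c * snd (a n)))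
    by (intros; simpl; ring).
  rewrite !Series_scal_l. apply injective_projections; simpl; ring.
Qed.

Lemma CSeries_scal (c : CC) (f : nat -> R) : ex_series f -> CSeries (fun n => c * RtoC (f n))%C = (c * RtoC (Series f))%C.
Proof.
  intros H. apply CSeries_Clim.
  apply (is_Clim_ext (fun n => c * RtoC (Rsum f n))%C).
  - intros n. now rewrite Csum_scal, Csum_RtoC.
  - apply is_Clim_mult; [apply is_Clim_const|]. apply is_Clim_RtoC.
    now apply is_series_Rsum, Series_correct.
Qed.

Section Assembly.
Variables (q h : nat) (chi : Z -> CC) (x : R) (L : CC -> CC).
Hypothesis Hprim : primitive_character (Z.of_nat q) chi.
Hypothesis Heven : even_character chi.
Hypothesis Hx : 0 < x.
Hypothesis HL : L_continuation chi L.
Let N := (2 * h + 1)%nat.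

(** By [inner_sum], the finite sum over j divided by (-1)^h N (k + 1). *)
Definition dual_term (k : nat) : R :=
  kern_sum x N k - / (2 * INR N * INR (S k)) +
  if Nat.eqb h 0 then x / (4 * PI ^ 2 * INR (S k) ^ 2) else 0.

Definition dual_series : CC :=
  (gauss_sum q chi * CSeries (fun k => Cconj (chi (Z.of_nat (S k))) * RtoC (dual_term k)))%C.

Definition exp_series (t : R) : R :=
  Series (fun n => / INR (S n) * (exp (- (t * ypt x N n)) / (1 - exp (- ypt x N n)))).

Definition bern2_val (r : nat) : R := (INR r / INR q) ^ 2 - INR r / INR q + 1 / 6.

Lemma assembly_N_pos : (1 <= N)%nat.
Proof. unfold N. lia. Qed.

Lemma gauss_cos_shifted (k : nat) :
  Csum (fun r => chi (Z.of_nat (S r)) * RtoC (cos (2 * PI * INR k * (INR (S r) / INR q))))%C q =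
  (Cconj (chi (Z.of_nat k)) * gauss_sum q chi)%C.
Proof.
  pose proof (INR_char_q_pos q chi Hprim) as Hq.
  rewrite <- (gauss_cos q chi Hprim Heven).
  apply (Csum_shift_range (fun r => chi (Z.of_nat r) * RtoC (cos (2 * PI * INR k * (INR r / INR q))))%C).
  f_equal.
  - rewrite <- (char_periodic q chi Hprim (Z.of_nat 0)). reflexivity.
  - f_equal. replace (2 * PI * INR k * (INR q / INR q)) with (0 + 2 * INR k * PI) by (field; lra).
    rewrite cos_period. f_equal. simpl. field. lra.
Qed.

(* A limit of the chi-weighted cosine sums evaluates the dual series; the shift b is
   killed by the mean value zero of chi. *)
Lemma dual_series_eq (b : nat -> R) (V : nat -> R) :
  (Csum (fun r => chi (Z.of_nat (S r))) q = 0%C \/ forall M, b M = 0) ->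
  (forall r, (r < q)%nat -> chi (Z.of_nat (S r)) = 0%C \/
    is_lim_seq (fun M => Rsum (fun k => cos (2 * PI * INR (S k) * (INR (S r) / INR q)) * dual_term k) M + b M) (V r)) ->
  dual_series = Csum (fun r => chi (Z.of_nat (S r)) * RtoC (V r))%C q.
Proof.
  intros Hb HV. unfold dual_series.
  set (G := gauss_sum q chi).
  assert (Lim : is_Clim (fun M => G * Csum (fun k => Cconj (chi (Z.of_nat (S k))) * RtoC (dual_term k)) M)%C
     (Csum (fun r => chi (Z.of_nat (S r)) * RtoC (V r))%C q)).
  { apply (is_Clim_ext (fun M => Csum (fun r => chi (Z.of_nat (S r)) *
      RtoC (Rsum (fun k => cos (2 * PI * INR (S k) * (INR (S r) / INR q)) * dual_term k)%R M + b M)) q)%C).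
    - intros M.
      transitivity (Csum (fun k => Csum (fun r => chi (Z.of_nat (S r)) * RtoC (cos (2 * PI * INR (S k) * (INR (S r) / INR q)) * dual_term k)) q) M
         + RtoC (b M) * Csum (fun r => chi (Z.of_nat (S r))) q)%C.
      + rewrite Csum_swap, <- Csum_scal, <- Csum_plus. apply Csum_ext. intros r _.
        rewrite RtoC_plus, <- Csum_RtoC, Cmult_plus_distr_l, <- Csum_scal. f_equal. ring.
      + replace (RtoC (b M) * Csum (fun r => chi (Z.of_nat (S r))) q)%C with (RtoC 0).
        2: { destruct Hb as [Hb|Hb]; [rewrite Hb|rewrite Hb]; ring. }
        rewrite Cplus_0_r, <- Csum_scal. apply Csum_ext. intros k _.
        transitivity (RtoC (dual_term k) * (Cconj (chi (Z.of_nat (S k))) * gauss_sum q chi))%C; [|unfold G; ring].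
        rewrite <- gauss_cos_shifted, <- Csum_scal.
        apply Csum_ext. intros r _. rewrite RtoC_mult. ring.
    - apply (is_Clim_Csum (fun M r => chi (Z.of_nat (S r)) *
      RtoC (Rsum (fun k => cos (2 * PI * INR (S k) * (INR (S r) / INR q)) * dual_term k)%R M + b M))%C).
      intros r Hr. destruct (HV r Hr) as [H0|HVr].
      + rewrite H0. apply is_Clim_eq with (0 * RtoC (V r))%C; [|reflexivity].
        eapply is_Clim_ext; [|apply (is_Clim_const (0 * RtoC (V r))%C)]. intros M. cbv beta. ring.
      + apply is_Clim_mult; [apply is_Clim_const|now apply is_Clim_RtoC]. }
  (* Convergence of the series over k follows on dividing the limit by G; if G = 0, the limit is 0
     and so is the left-hand side. *)
  destruct (Ceq_dec G 0) as [E|E].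
  - rewrite E. apply (is_Clim_unique (fun _ : nat => RtoC 0)).
    + eapply is_Clim_eq; [apply is_Clim_const|ring].
    + eapply is_Clim_ext; [|exact Lim]. intros M. cbv beta. rewrite E. ring.
  - rewrite (CSeries_Clim _ (/ G * Csum (fun r => chi (Z.of_nat (S r)) * RtoC (V r)) q)%C).
    + rewrite Cmult_assoc. replace (G * / G)%C with (RtoC 1) by (field; exact E). ring.
    + eapply is_Clim_ext; [|apply (is_Clim_mult _ _ _ _ (is_Clim_const (/ G)%C) Lim)].
      intros M. cbv beta. rewrite Cmult_assoc. replace (/ G * G)%C with (RtoC 1) by (field; exact E). ring.
Qed.

(** The factor -q/2 in the value of L(-1, chi) turns x/(2q) into -x/4. This is the opposite of the
    contribution of the 1/k^2 part of [dual_term]. *)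
Lemma RN_eq : (if Nat.eqb h 0 then RtoC (x / (2 * INR q)) * L (RtoC (-1)) else RtoC 0)%C =
  Csum (fun r => chi (Z.of_nat (S r)) * RtoC (- if Nat.eqb h 0 then x / 4 * bern2_val (S r) else 0))%C q.
Proof.
  pose proof (INR_char_q_pos q chi Hprim) as Hq.
  destruct (Nat.eqb h 0).
  - rewrite (L_minus_1 q chi L (char_q_pos q chi Hprim) (char_periodic q chi Hprim) (char_bound q chi Hprim) HL).
    rewrite <- RtoC_opp, Cmult_assoc, <- RtoC_mult, <- Csum_scal.
    apply Csum_ext. intros r _. replace (r + 1)%nat with (S r) by lia. fold (bern2_val (S r)).
    transitivity (chi (Z.of_nat (S r)) * (RtoC (x / (2 * INR q) * - (INR q / 2)) * RtoC (bern2_val (S r))))%C; [ring|].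
    rewrite <- RtoC_mult. do 2 f_equal. field. lra.
  - rewrite (Csum_ext _ (fun _ => 0%C)); [now rewrite Csum_0|].
    intros r _. rewrite Ropp_0. ring.
Qed.

(** There is one residue, and every cosine is 1, so the limit is that of [kern_sum_trivial],
    increased for h = 0 by the sum of 1/k^2. *)
Lemma exp_series_trivial_char : q = 1%nat ->
  Csum (fun r => chi (Z.of_nat (S r)) * RtoC (exp_series (INR (S r) / INR q)))%C q =
  (RtoC (/ (2 * INR N) * (euler_gamma * (1 - INR N) - ln (2 * PI) + ln x)) + RtoC (zeta_real (INR N + 1) / x) +
   Csum (fun r => chi (Z.of_nat (S r)) * RtoC (- if Nat.eqb h 0 then x / 4 * bern2_val (S r) else 0))%C q + dual_series)%C.
Proof.
  intros Eq. pose proof PI_RGT_0 as HPI.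
  assert (H1 : INR 1 / INR 1 = 1) by (simpl; field).
  rewrite (dual_series_eq (fun _ => 0) (fun _ =>
    exp_series 1 - zeta_real (INR N + 1) / x - / (2 * INR N) * (euler_gamma * (1 - INR N) - ln (2 * PI) + ln x) +
    if Nat.eqb h 0 then x / 4 * bern2_val 1 else 0)).
  - rewrite Eq. cbn [Csum]. unfold bern2_val. rewrite Eq, H1.
    replace (chi (Z.of_nat 1)) with (RtoC 1) by (symmetry; apply (char_1 q chi Hprim)).
    rewrite !Cplus_0_l, !Cmult_1_l, <- !RtoC_plus. f_equal. ring.
  - now right.
  - intros r Hr. right. replace r with O by lia. rewrite Eq, H1.
    pose proof (kern_sum_trivial x N Hx assembly_N_pos) as KT.
    assert (Hc : forall k, cos (2 * PI * INR (S k) * 1) = 1).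
    { intros k. replace (2 * PI * INR (S k) * 1) with (0 + 2 * INR (S k) * PI) by ring. now rewrite cos_period, cos_0. }
    apply (is_lim_seq_ext (fun M => Rsum (fun k => kern_sum x N k - / (2 * INR N * INR (S k))) M +
       Rsum (fun k => if Nat.eqb h 0 then x / (4 * PI ^ 2 * INR (S k) ^ 2) else 0) M)).
    + intros M. rewrite <- Rsum_plus, Rplus_0_r. apply Rsum_ext. intros k _. rewrite Hc. unfold dual_term. ring.
    + apply is_lim_seq_plus'; [exact KT|].
      destruct (Nat.eqb h 0).
      * pose proof (bern2_fourier 1 1 ltac:(lia)) as B2.
        apply (is_lim_seq_ext (fun M => x / (4 * PI ^ 2) * Rsum (fun k => cos (2 * PI * INR (S k) * (INR 1 / INR 1)) / INR (S k) ^ 2) M)).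
        -- intros M. rewrite <- Rsum_scal. apply Rsum_ext. intros k _. rewrite H1, Hc.
           assert (0 < INR (S k)) by (apply lt_0_INR; lia). field. lra.
        -- unfold bern2_val. rewrite Eq.
           replace (x / 4 * ((INR 1 / INR 1) ^ 2 - INR 1 / INR 1 + 1 / 6)) with (x / (4 * PI ^ 2) * (PI ^ 2 * ((INR 1 / INR 1) ^ 2 - INR 1 / INR 1 + 1 / 6))) by (rewrite H1; field; lra).
           apply is_lim_seq_mult'; [apply is_lim_seq_const|exact B2].
      * eapply is_lim_seq_ext; [|apply is_lim_seq_const]. intros M. induction M as [|M IH]; cbn [Rsum]; [reflexivity|]. rewrite <- IH. ring.
Qed.

(** The limits for the individual r contain the zeta term and the sum at the angle pi, neither of
    which depends on r; the vanishing of the sum of chi removes both, leaving the log-sine term and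
    the Bernoulli term. *)
Lemma exp_series_nontrivial_char : (1 < q)%nat ->
  Csum (fun r => chi (Z.of_nat (S r)) * RtoC (exp_series (INR (S r) / INR q)))%C q =
  (- RtoC (/ (2 * INR N)) * Csum (fun r => chi (Z.of_nat (S r)) * RtoC (ln (sin (INR (S r) * PI / INR q)))) (q - 1) +
   Csum (fun r => chi (Z.of_nat (S r)) * RtoC (- if Nat.eqb h 0 then x / 4 * bern2_val (S r) else 0))%C q + dual_series)%C.
Proof.
  intros Hq. pose proof PI_RGT_0 as HPI. pose proof assembly_N_pos as HN.
  assert (HqR : 0 < INR q) by (apply lt_0_INR; lia).
  assert (HNr : 0 < INR N) by (apply lt_0_INR; lia).
  set (ls := fun r => ln (sin (INR (S r) * PI / INR q))).
  set (bb := fun r => if Nat.eqb h 0 then x / 4 * bern2_val (S r) else 0).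
  (* The term r = q, where t = 1 and the cosine sums are unbounded, carries the character value
     0. *)
  assert (Hchiq : chi (Z.of_nat (S (q - 1))) = 0%C).
  { replace (S (q - 1)) with q by lia. apply (char_not_coprime q chi Hprim). rewrite Z.gcd_diag. lia. }
  assert (Hsum : Csum (fun r => chi (Z.of_nat (S r))) q = 0%C).
  { rewrite (Csum_shift_range (fun r => chi (Z.of_nat r))); [now apply char_sum_0|].
    rewrite <- (char_periodic q chi Hprim (Z.of_nat 0)). reflexivity. }
  assert (Hlast : forall f : nat -> R, Csum (fun r => chi (Z.of_nat (S r)) * RtoC (f r))%C q = Csum (fun r => chi (Z.of_nat (S r)) * RtoC (f r))%C (q - 1)).
  { intros f. replace q with (S (q - 1)) at 1 by lia. cbn [Csum]. rewrite Hchiq. ring. }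
  assert (Ht : forall r, (r < q - 1)%nat -> 0 < INR (S r) / INR q < 1).
  { intros r Hr. split; [apply Rdiv_lt_0_compat; [apply lt_0_INR; lia|exact HqR]|].
    apply Rmult_lt_reg_r with (INR q); [exact HqR|]. unfold Rdiv. rewrite Rmult_assoc, Rinv_l by lra.
    assert (INR (S r) < INR q) by (apply lt_INR; lia). lra. }
  (* chi takes equal values at r and q - r, so each term may be replaced by the half-sum of those at
     t and 1 - t. *)
  assert (Hsym : Csum (fun r => chi (Z.of_nat (S r)) * RtoC (exp_series (INR (S r) / INR q)))%C q =
                 Csum (fun r => chi (Z.of_nat (S r)) * RtoC (Series (sym_term x N (INR (S r) / INR q))))%C q).
  { rewrite !Hlast.
    set (F := fun r => (chi (Z.of_nat (S r)) * RtoC (exp_series (INR (S r) / INR q)))%C).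
    assert (Hhalf : (/ 2 + / 2)%C = RtoC 1) by (field; apply RtoC_neq_0; lra).
    transitivity (/ 2 * Csum F (q - 1) + / 2 * Csum (fun k => F (q - 1 - 1 - k)%nat) (q - 1))%C.
    - rewrite <- Csum_rev, <- Cmult_plus_distr_r, Hhalf, Cmult_1_l. reflexivity.
    - rewrite <- !Csum_scal, <- Csum_plus. apply Csum_ext. intros r Hr. unfold F.
      assert (Er : S (q - 1 - 1 - r) = (q - S r)%nat) by lia.
      rewrite Er.
      replace (chi (Z.of_nat (q - S r))) with (chi (Z.of_nat (S r))).
      2: { rewrite <- (char_opp q chi Hprim Heven), <- (char_periodic q chi Hprim). f_equal. lia. }
      replace (INR (q - S r) / INR q) with (1 - INR (S r) / INR q) by (rewrite minus_INR by lia; field; lra).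
      destruct (Series_sym_term x N Hx HN (INR (S r) / INR q) (Ht r Hr)) as [_ E]. rewrite E.
      fold (exp_series (INR (S r) / INR q)). fold (exp_series (1 - INR (S r) / INR q)).
      rewrite RtoC_mult, RtoC_plus, RtoC_inv by lra. ring. }
  rewrite Hsym.
  (* The shift compensates the sum at the angle pi that [log_sine_sum] subtracts. *)
  rewrite (dual_series_eq (fun M => / (2 * INR N) * Rsum (fun k => cos (INR (S k) * PI) / INR (S k)) M)
    (fun r => Series (sym_term x N (INR (S r) / INR q)) + - (zeta_real (INR N + 1) / x) + / (2 * INR N) * ls r + bb r)).
  - change (Csum _ (q - 1)) with (Csum (fun r => chi (Z.of_nat (S r)) * RtoC (ls r))%C (q - 1)).
    rewrite <- (Hlast ls). rewrite <- RtoC_opp, <- Csum_scal, <- !Csum_plus.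
    transitivity (Csum (fun r => chi (Z.of_nat (S r)) * RtoC (Series (sym_term x N (INR (S r) / INR q))))%C q +
      RtoC (- (zeta_real (INR N + 1) / x)) * Csum (fun r => chi (Z.of_nat (S r))) q)%C; [rewrite Hsum; ring|].
    rewrite <- Csum_scal, <- Csum_plus. apply Csum_ext. intros r _. fold (bb r).
    rewrite !RtoC_plus, RtoC_mult, !RtoC_opp. ring.
  - now left.
  - intros r Hr. destruct (Nat.eq_dec r (q - 1)) as [->|Hne]; [now left|right].
    specialize (Ht r ltac:(lia)). set (t := INR (S r) / INR q) in *.
    pose proof (kern_sum_fourier x N Hx HN (S r) q ltac:(lia)) as K1. fold t in K1.
    pose proof (log_sine_sum (2 * PI * t) ltac:(nra)) as K2.
    replace (2 * PI * t / 2) with (INR (S r) * PI / INR q) in K2 by (unfold t; field; lra). fold (ls r) in K2.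
    assert (K3 : is_lim_seq (fun M => Rsum (fun k => cos (2 * PI * INR (S k) * t) * if Nat.eqb h 0 then x / (4 * PI ^ 2 * INR (S k) ^ 2) else 0) M) (bb r)).
    { unfold bb. destruct (Nat.eqb h 0).
      - pose proof (bern2_fourier (S r) q ltac:(lia)) as B2. fold t in B2.
        apply (is_lim_seq_ext (fun M => x / (4 * PI ^ 2) * Rsum (fun k => cos (2 * PI * INR (S k) * t) / INR (S k) ^ 2) M)).
        + intros M. rewrite <- Rsum_scal. apply Rsum_ext. intros k _.
          assert (0 < INR (S k)) by (apply lt_0_INR; lia). field. lra.
        + unfold bern2_val. fold t.
          replace (x / 4 * (t ^ 2 - t + 1 / 6)) with (x / (4 * PI ^ 2) * (PI ^ 2 * (t ^ 2 - t + 1 / 6))) by (field; lra).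
          apply is_lim_seq_mult'; [apply is_lim_seq_const|exact B2].
      - eapply is_lim_seq_ext; [|apply is_lim_seq_const]. intros M. induction M as [|M IH]; cbn [Rsum]; [reflexivity|]. rewrite <- IH. ring. }
    apply (is_lim_seq_ext (fun M => Rsum (fun k => cos (2 * PI * INR (S k) * t) * kern_sum x N k) M -
      / (2 * INR N) * (Rsum (fun k => cos (INR (S k) * (2 * PI * t)) / INR (S k)) M - Rsum (fun k => cos (INR (S k) * PI) / INR (S k)) M) +
      Rsum (fun k => cos (2 * PI * INR (S k) * t) * if Nat.eqb h 0 then x / (4 * PI ^ 2 * INR (S k) ^ 2) else 0) M)).
    + intros M.
      rewrite (Rsum_ext (fun k => cos (2 * PI * INR (S k) * t) * dual_term k)
        (fun k => (cos (2 * PI * INR (S k) * t) * kern_sum x N k + - / (2 * INR N) * (cos (INR (S k) * (2 * PI * t)) / INR (S k))) +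
           cos (2 * PI * INR (S k) * t) * if Nat.eqb h 0 then x / (4 * PI ^ 2 * INR (S k) ^ 2) else 0)).
      * rewrite !Rsum_plus, Rsum_scal. ring.
      * intros k _. unfold dual_term. replace (INR (S k) * (2 * PI * t)) with (2 * PI * INR (S k) * t) by ring.
        assert (0 < INR (S k)) by (apply lt_0_INR; lia). field. lra.
    + replace (Series (sym_term x N t) + - (zeta_real (INR N + 1) / x) + / (2 * INR N) * ls r + bb r) with
        (Series (sym_term x N t) - zeta_real (INR N + 1) / x - / (2 * INR N) * - ls r + bb r) by ring.
      apply is_lim_seq_plus'; [apply is_lim_seq_minus'; [exact K1|apply is_lim_seq_mult'; [apply is_lim_seq_const|exact K2]]|exact K3].
Qed.
End Assembly.

Theorem theorem2p5
  (q : nat) (chi : Z -> CC) (x : R) (N : nat) (L : CC -> CC)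
  (Hq : (1 <= q)%nat)
  (Hprim : primitive_character (Z.of_nat q) chi)
  (Heven : even_character chi)
  (Hx : 0 < x)
  (HN : Nat.Odd N)
  (HL : L_continuation chi L) :
  let R0 : CC :=
    if (q =? 1)%nat
    then RtoC (/ (2 * INR N) * (euler_gamma * (1 - INR N) - ln (2 * PI) + ln x))
    else (- RtoC (/ (2 * INR N)) *
          sum_n_m (fun r => chi (Z.of_nat r) * RtoC (ln (sin (INR r * PI / INR q))))
                  1 (q - 1))%C in
  let R1 : CC :=
    if (q =? 1)%nat then RtoC (zeta_real (INR N + 1) / x) else 0%C in
  let RN : CC :=
    if (N =? 1)%nat then (RtoC (x / (2 * INR q)) * L (RtoC (-1)))%C else 0%C in
  let K : CC :=
    (RtoC ((-1) ^ ((N + 3) / 2)) * gauss_sum q chi / RtoC (INR N) *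
     CSeries (fun m =>
       let n := (m + 1)%nat in
       Cconj (chi (Z.of_nat n)) / RtoC (INR n) *
       sum_n_m (fun k =>
         let j := (2 * INR k - (INR N - 1))%R in
         Cexp (0%R, (PI * j / 2)%R) /
         (Cexp (RtoC (2 * PI * Rpower (2 * PI * INR n / x) (/ INR N)) *
                Cexp (0%R, (- PI * j / (2 * INR N))%R)) - 1))
         0 (N - 1)))%C in
  sum_n_m (fun r =>
    CSeries (fun m =>
      let n := (m + 1)%nat in
      chi (Z.of_nat r) * RtoC (/ INR n *
        (exp (- (INR r / INR q) * INR n ^ N * x) / (1 - exp (- INR n ^ N * x))))))%C
    1 q
  = (R0 + R1 + RN + K)%C.
Proof.
  destruct HN as [h Hh]. subst N. intros R0 R1 RN K.
  pose proof (INR_char_q_pos q chi Hprim) as HqR.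
  assert (HNr : 0 < INR (2 * h + 1)) by (apply lt_0_INR; lia).
  assert (ELHS : forall r, (r < q)%nat -> CSeries (fun m =>
      let n := (m + 1)%nat in
      chi (Z.of_nat (S r)) * RtoC (/ INR n *
        (exp (- (INR (S r) / INR q) * INR n ^ (2 * h + 1) * x) / (1 - exp (- INR n ^ (2 * h + 1) * x)))))%C =
      (chi (Z.of_nat (S r)) * RtoC (exp_series h x (INR (S r) / INR q)))%C).
  { intros r Hr. unfold exp_series. rewrite <- CSeries_scal.
    - apply CSeries_ext. intros m. cbv zeta.
      replace (m + 1)%nat with (S m) by lia. do 3 f_equal. unfold ypt. f_equal; [f_equal; ring|].
      do 3 f_equal. ring.
    - apply ex_series_exp_term; [exact Hx|lia|]. apply Rdiv_lt_0_compat; [apply lt_0_INR; lia|exact HqR]. }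
  assert (EK : K = dual_series q h chi x).
  { unfold K, dual_series.
    assert (Ein : forall m, sum_n_m (fun k =>
         let j := (2 * INR k - (INR (2 * h + 1) - 1))%R in
         Cexp (0%R, (PI * j / 2)%R) /
         (Cexp (RtoC (2 * PI * Rpower (2 * PI * INR (S m) / x) (/ INR (2 * h + 1))) *
                Cexp (0%R, (- PI * j / (2 * INR (2 * h + 1)))%R)) - 1))%C
         0 (2 * h + 1 - 1) = RtoC ((-1) ^ h * INR (2 * h + 1) * INR (S m) * dual_term h x m)).
    { intros m. replace (2 * h + 1 - 1)%nat with (0 + 2 * h)%nat by lia. rewrite sum_n_m_Csum.
      replace (S (2 * h)) with (2 * h + 1)%nat by lia. exact (inner_sum x h m Hx). }
    assert (Hs : RtoC ((-1) ^ h * INR (2 * h + 1)) <> 0%C).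
    { apply RtoC_neq_0. apply Rmult_integral_contrapositive. split; [apply pow_nonzero; lra|lra]. }
    (* For N = 2h + 1, (N + 3)/2 = h + 2, so the sign agrees with that of [inner_sum] and the two
       cancel. *)
    assert (Es : RtoC ((-1) ^ ((2 * h + 1 + 3) / 2)) = RtoC ((-1) ^ h)).
    { replace (2 * h + 1 + 3)%nat with ((h + 2) * 2)%nat by lia. rewrite Nat.div_mul by lia.
      f_equal. rewrite pow_add. ring. }
    rewrite Es.
    replace (CSeries _) with (CSeries (fun k => RtoC ((-1) ^ h * INR (2 * h + 1)) * (Cconj (chi (Z.of_nat (S k))) * RtoC (dual_term h x k)))%C).
    - rewrite CSeries_scal_R. set (S0 := CSeries _).
      assert (E1 : RtoC ((-1) ^ h) = RtoC (/ (-1) ^ h)).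
      { f_equal. rewrite <- pow_inv. f_equal. lra. }
      assert (Hp : (-1) ^ h <> 0) by (apply pow_nonzero; lra).
      rewrite RtoC_mult, E1 at 1. rewrite RtoC_inv by exact Hp.
      rewrite RtoC_mult in Hs. field. split; apply RtoC_neq_0; (exact Hp || lra).
    - apply CSeries_ext. intros m. cbv zeta.
      replace (m + 1)%nat with (S m) by lia. rewrite Ein.
      assert (Hm : RtoC (INR (S m)) <> 0%C) by (apply RtoC_neq_0, not_0_INR; lia).
      rewrite !RtoC_mult. field. exact Hm. }
  rewrite EK, sum_n_m_1_Csum, (Csum_ext _ _ q ELHS).
  assert (ERN : RN = Csum (fun r => chi (Z.of_nat (S r)) * RtoC (- if Nat.eqb h 0 then x / 4 * bern2_val q (S r) else 0))%C q).
  { rewrite <- (RN_eq q h chi x L Hprim HL). unfold RN.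
    replace (2 * h + 1 =? 1)%nat with (h =? 0)%nat; [reflexivity|].
    destruct (Nat.eqb_spec h 0) as [->|Hne]; [reflexivity|]. symmetry. apply Nat.eqb_neq. lia. }
  rewrite ERN. unfold R0, R1. destruct (Nat.eqb_spec q 1) as [E|E].
  - now apply exp_series_trivial_char.
  - rewrite sum_n_m_1_Csum, (exp_series_nontrivial_char q h chi x Hprim Heven Hx) by lia. now rewrite Cplus_0_r.
Qed.
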